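(* Let $1\le p\le q$, let $\lambda_1,\dots,\lambda_p,\sigma_1,\dots,\sigma_p\in\mathbb C$, and put $\lambda_{p+1}=\sigma_{p+1}=0$. Assume that $\operatorname{Re}(\lambda_k-\frac{q+k}2+1)>0$ and $\operatorname{Re}(\sigma_k-\lambda_k-\frac{p-k}2)>0$ for $k=1,\dots,p$. Then $$\int_{SW_{p,q}(\mathbb R)}\prod_{j=1}^p\frac{\det[M-LL^*]_j^{\lambda_j-\lambda_{j+1}}}{\det[1+M+N]_j^{\sigma_j-\sigma_{j+1}}}\,\det(M-LL^* )^{-(p+q)/2}\,dM\,dN\,dL=\prod_{k=1}^p\pi^{k+(q-p)/2-1}\,\frac{\Gamma(\lambda_k-\frac{q+k}2+1)\,\Gamma(\sigma_k-\lambda_k-\frac{p-k}2)}{\Gamma(\sigma_k-p+k)} .$$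
   Context: $SW_{p,q}(\mathbb R)$ is the set of pairs $(K,L)$, where $K$ is a real $p\times p$ matrix, $L$ is a real $p\times(q-p)$ matrix, and $\frac12(K+K^* )-LL^*$ is positive definite ($*$ is transposition for real matrices; if $p=q$, $L$ is absent). Write $K=M+N$ with $M=M^*$, $N=-N^*$. $[A]_j$ denotes the left upper $j\times j$ block of $A$; $\det[A]_j^a$ means $(\det[A]_j)^a$ (all determinants occurring are positive). $dM=\prod_{k\le m}dm_{km}$, $dN=\prod_{k<m}dn_{km}$, $dL=\prod dl_{km}$ are Lebesgue measures in the independent matrix entries. *)

(* Defs.v *)
From HB Require Import structures.
From mathcomp Require Import all_boot all_order all_algebra.
From mathcomp Require Import all_classical all_reals all_analysis.
From mathcomp Require Import complex.

Set Implicit Arguments.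
Unset Strict Implicit.
Unset Printing Implicit Defensive.

Import Order.TTheory GRing.Theory Num.Theory.
Import numFieldNormedType.Exports.

Local Open Scope classical_set_scope.
Local Open Scope ring_scope.
Local Open Scope complex_scope.

(* x ^ z = exp (z ln x); meant for x > 0 only *)
Definition cpow (R : realType) (x : R) (z : R[i]) : R[i] :=
  (expR (complex.Re z * ln x))%:C *
  (cos (complex.Im z * ln x) +i* sin (complex.Im z * ln x)).

Definition cintegrable (d : measure_display) (T : measurableType d)
    (R : realType) (mu : {measure set T -> \bar R}) (D : set T)
    (f : T -> R[i]) : Prop :=
  mu.-integrable D (fun x => (complex.Re (f x))%:E) /\
  mu.-integrable D (fun x => (complex.Im (f x))%:E).

Definition cintegral (d : measure_display) (T : measurableType d)
    (R : realType) (mu : {measure set T -> \bar R}) (D : set T)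
    (f : T -> R[i]) : R[i] :=
  (\int[mu]_(x in D) complex.Re (f x)) +i* (\int[mu]_(x in D) complex.Im (f x)).

(* Euler's integral, which converges exactly when Re z > 0; no analytic
   continuation is made, so meaningful for Re z > 0 only *)
Definition cGamma (R : realType) (z : R[i]) : R[i] :=
  cintegral (@lebesgue_measure R) `]0, +oo[
    (fun t : R => cpow t (z - 1) * (expR (- t))%:C).

Definition tcons (T : Type) (n : nat) (x : T * n.-tuple T) : n.+1.-tuple T :=
  [tuple of x.1 :: x.2].

Lemma measurable_tcons (d : measure_display) (T : measurableType d) (n : nat) :
  measurable_fun [set: T * n.-tuple T] (@tcons T n).
Proof. exact: measurable_cons. Qed.

(* MathComp-Analysis has this as an instance, but canonical inference on
   (m1 \x m2) only finds the one for subprobabilities *)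
Lemma product_measure1_sigma_finite (d1 d2 : measure_display)
    (T1 : measurableType d1) (T2 : measurableType d2) (R : realType)
    (m1 : {sigma_finite_measure set T1 -> \bar R})
    (m2 : {sigma_finite_measure set T2 -> \bar R}) :
  sigma_finite setT (m1 \x m2)%E.
Proof.
have /sigma_finiteP[F [TF ndF Foo]] := sigma_finiteT m1.
have /sigma_finiteP[G [TG ndG Goo]] := sigma_finiteT m2.
exists (fun n => F n `*` G n).
  rewrite -setXTT TF TG predeqE => -[x y]; split.
    move=> [/= [n _ Fnx] [k _ Gky]]; exists (maxn n k) => //; split.
    - by move: x Fnx; exact/subsetPset/ndF/leq_maxl.
    - by move: y Gky; exact/subsetPset/ndG/leq_maxr.
  by move=> [n _ []/= ? ?]; split; exists n.
move=> k; have [? ?] := Foo k; have [? ?] := Goo k.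
split; first exact: measurableX.
by rewrite product_measure1E// lte_mul_pinfty// ge0_fin_numE.
Qed.

Section ConsMeasure.
Context (R : realType) (n : nat).
Variable m : {sigma_finite_measure set (n.-tuple (measurableTypeR R)) -> \bar R}.

Definition cons_measure : set (n.+1.-tuple (measurableTypeR R)) -> \bar R :=
  pushforward (@lebesgue_measure R \x m)%E (@tcons (measurableTypeR R) n).

Let cons_measure0 : cons_measure set0 = 0%E.
Proof. by rewrite /cons_measure /pushforward preimage_set0 measure0. Qed.

Let cons_measure_ge0 A : (0 <= cons_measure A)%E.
Proof. by rewrite /cons_measure /pushforward; exact: measure_ge0. Qed.

Let cons_measure_sigma_additive : semi_sigma_additive cons_measure.
Proof.
move=> F mF tF mUF; rewrite /cons_measure /pushforward preimage_bigcup.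
apply: measure_semi_sigma_additive.
- by move=> k; rewrite -[X in measurable X]setTI; exact: measurable_tcons.
- apply/trivIsetP => /= i j _ _ ij; rewrite -preimage_setI.
  by move/trivIsetP : tF => /(_ _ _ _ _ ij) ->//; rewrite preimage_set0.
- by rewrite -preimage_bigcup -[X in measurable X]setTI; exact: measurable_tcons.
Qed.

HB.instance Definition _ := isMeasure.Build _ _ _ cons_measure
  cons_measure0 cons_measure_ge0 cons_measure_sigma_additive.

Let cons_measure_sigma_finite : sigma_finite setT cons_measure.
Proof.
have [F FT Foo] : sigma_finite setT (@lebesgue_measure R \x m)%E.
  exact: product_measure1_sigma_finite.
pose h (x : n.+1.-tuple (measurableTypeR R)) :
      measurableTypeR R * n.-tuple (measurableTypeR R) :=
  (thead x, [tuple of behead x]).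
have hK : cancel h (@tcons _ n) by move=> x; rewrite /tcons /= -tuple_eta.
have hcK : cancel (@tcons _ n) h.
  by move=> [a t]; congr pair; apply/val_inj.
have mh : measurable_fun setT h.
  apply/measurable_fun_pair; first exact: (measurable_tnth ord0).
  exact: measurable_behead.
exists (fun k => h @^-1` F k).
  by rewrite -preimage_bigcup -FT preimage_setT.
move=> k; have [mF Fk] := Foo k; split.
  by rewrite -[X in measurable X]setTI; exact: mh.
rewrite /cons_measure /pushforward -comp_preimage.
by rewrite (_ : h \o _ = id) ?preimage_id//; apply/funext => x /=; rewrite hcK.
Qed.

HB.instance Definition _ := Measure_isSigmaFinite.Build _ _ _ cons_measure
  cons_measure_sigma_finite.

End ConsMeasure.

(* Lebesgue measure on R^n: the n-fold product of lebesgue_measure *)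
Fixpoint lebesgue_tuple (R : realType) (n : nat) :
    {sigma_finite_measure set (n.-tuple (measurableTypeR R)) -> \bar R} :=
  match n with
  | 0 => @dirac _ (0.-tuple (measurableTypeR R)) [tuple] R
  | n'.+1 => cons_measure (lebesgue_tuple R n')
  end.

(* the space R^I for a finite type I, as tuples; see icoord for the indexing *)
Notation coords R I := (#|{: I}|.-tuple (measurableTypeR R)).

Definition icoord (R : realType) (I : finType) (x : coords R I) (i : I) : R :=
  tnth x (enum_rank i).

(* index types of the independent entries of symmetric and of skew-symmetric
   p x p matrices *)
Notation sym_idx p := {km : 'I_p * 'I_p | (km.1 <= km.2)%N}.
Notation skew_idx p := {km : 'I_p * 'I_p | (km.1 < km.2)%N}.

Definition sym_of (R : realType) (p : nat) (x : coords R (sym_idx p)) : 'M[R]_p :=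
  \matrix_(k, m)
    if insub (k, m) is Some km then icoord x km
    else if insub (m, k) is Some mk then icoord x mk else 0.

Definition skew_of (R : realType) (p : nat) (x : coords R (skew_idx p)) :
    'M[R]_p :=
  \matrix_(k, m)
    if insub (k, m) is Some km then icoord x km
    else if insub (m, k) is Some mk then - icoord x mk else 0.

Definition full_of (R : realType) (p r : nat) (x : coords R ('I_p * 'I_r)) :
    'M[R]_(p, r) :=
  \matrix_(k, m) icoord x (k, m).

Notation MNLcoords R p r :=
  (coords R (sym_idx p) * coords R (skew_idx p) * coords R ('I_p * 'I_r))%type.

Definition dMNL (R : realType) (p r : nat) :
    {measure set (MNLcoords R p r) -> \bar R} :=
  (lebesgue_tuple R #|{: sym_idx p}| \x lebesgue_tuple R #|{: skew_idx p}|
     \x lebesgue_tuple R #|{: 'I_p * 'I_r}|)%E.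

Definition posdefmx (R : realType) (n : nat) (A : 'M[R]_n) : Prop :=
  A^T = A /\ forall v : 'cV[R]_n, v != 0 -> 0 < (v^T *m A *m v) 0 0.

(* for p = q the matrix L is the empty p x 0 matrix, and L *m L^T = 0 *)
Definition SW (R : realType) (p q : nat) : set ('M[R]_p * 'M[R]_(p, q - p)) :=
  [set KL | posdefmx (2^-1 *: (KL.1 + KL.1^T) - KL.2 *m KL.2^T)].

(* the left upper block of size j.+1 *)
Definition ulblock (R : realType) (p : nat) (A : 'M[R]_p) (j : 'I_p) :
    'M[R]_j.+1 :=
  mxsub (widen_ord (ltn_ord j)) (widen_ord (ltn_ord j)) A.

(* lam and sig are indexed from 1, and the bound j : 'I_p from 0 *)
Definition SWintegrand (R : realType) (p q : nat) (lam sig : nat -> R[i])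
    (M N : 'M[R]_p) (L : 'M[R]_(p, q - p)) : R[i] :=
  (\prod_(j < p)
     (cpow (\det (ulblock (M - L *m L^T) j)) (lam j.+1 - lam j.+2) /
      cpow (\det (ulblock (1%:M + M + N) j)) (sig j.+1 - sig j.+2))) *
  (\det (M - L *m L^T) `^ (- ((p + q)%:R / 2)))%:C.

(* Main.v *)
Require Import Defs.
From mathcomp Require Import all_boot all_order all_algebra.
From mathcomp Require Import all_classical all_reals all_analysis.
From mathcomp Require Import measurable_realfun.
From mathcomp Require Import complex.
From mathcomp Require Import ring lra.

Set Implicit Arguments.
Unset Strict Implicit.
Unset Printing Implicit Defensive.

Import Order.TTheory GRing.Theory Num.Theory.
Import numFieldNormedType.Exports.

Local Open Scope classical_set_scope.
Local Open Scope ring_scope.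
Local Open Scope complex_scope.

(** Put r = q - p, A = M - L L^T and B = 1 + M + N.  The domain is the set where
    A is positive definite, and the integrand is a product of complex powers of
    the leading minors of A and B, that is, of their successive pivots, the
    ratios of consecutive leading minors ([prod_ulblock]).  The integral is
    computed by peeling off the last row and column of K together with the last
    row of L, by induction on p.

    Let A0 and B0 be the blocks that remain, m and n the last columns of M and N,
    l the last row of L, and t the corner entry of M.  By Schur complements the
    last pivots of A and B are
      s = t - |l|^2 - (m - L0 l)^T A0^-1 (m - L0 l),
      1 + t - (m - n)^T B0^-1 (m + n) = 1 + s + Q(m, l, n),
    and A is positive definite iff A0 is and s > 0 ([posdef_pivotE], [pivot_fA],
    [pivot_fK]).  Completing squares in n, then l, then m, shows that Q is a
    positive definite quadratic form in 2p + r variables, with determinant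
    (det A0 * det B0 ^ 2)^-1 ([bordered_form]).  Hence integrating a function of
    the two last pivots over (m, l, n, t) gives sqrt (det A0) * det B0 times the
    integral of that function at (s, 1 + s + |y|^2) over s > 0 and y in
    R^(2p + r) ([ge0_integral_bordered], [ge0_integral_step]).

    For the powers at hand this last integral is elementary: with D = 2p + r,
      Gamma(c) * int s^(a - 1) (1 + s + |y|^2)^(-c) ds dy
        = pi^(D / 2) Gamma(a) Gamma(c - a - D / 2)
    ([dirichlet_integral]), by writing Gamma(c) T^(-c) as the integral of
    w^(c - 1) e^(-T w) and integrating over s and y first.  The factor
    sqrt (det A0) * det B0 merely shifts all exponents lambda_k by -1/2 and
    sigma_k by -1, so the smaller integral is of the same kind, with the same
    values of the Gamma factors ([chain_weight], [pivot_integral]).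

    To divide by Gamma(c) one needs that Euler's integral has no zero in the
    right half-plane ([gamma_neq0]).  The evaluation above with D = 0 is the Beta
    integral; it gives Gamma(z) = 0 -> Gamma(z / 2) = 0, as Gamma(z / 2)^2 is a
    multiple of Gamma(z), and Gamma(w) = 0 -> Gamma(1 + w) = 0.  A zero z thus
    yields zeros 1 + z / 2^n, contradicting Gamma(1 + z / 2^n) --> Gamma(1) > 0.

    All changes of variables are done for nonnegative functions by
    characterising Lebesgue measure on a space of matrices by its values on
    boxes ([leb_coords_unique]); they are carried over to complex functions by
    [transfer_cintegrable] and [transfer_cintegral]. *)

(** * Lebesgue measure in arbitrary coordinates *)
Section LebesgueCoordinates.
Context (R : realType).
Local Notation leb := (@lebesgue_measure R).

(** The coordinates c identify mu with Lebesgue measure on R^K.  Only boxes are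
    mentioned, so that the condition passes to products and reindexings, whatever
    the enumeration of K. *)
Definition leb_coords (d : measure_display) (T : measurableType d) (K : finType)
    (mu : {measure set T -> \bar R}) (c : K -> T -> measurableTypeR R) : Prop :=
  (forall k, measurable_fun setT (c k)) /\
  forall A : K -> set (measurableTypeR R), (forall k, measurable (A k)) ->
    mu [set x | forall k, A k (c k x)] = (\prod_k leb (A k))%E.

Lemma measurable_box (d : measure_display) (T : measurableType d) (K : finType)
    (c : K -> T -> measurableTypeR R) (A : K -> set (measurableTypeR R)) :
  (forall k, measurable_fun setT (c k)) -> (forall k, measurable (A k)) ->
  measurable [set x | forall k, A k (c k x)].
Proof.
move=> mc mA.
rewrite (_ : [set _ | _] = \big[setI/setT]_(k : K) (c k @^-1` A k)).
  apply: bigsetI_measurable => k _.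
  by rewrite -[X in measurable X]setTI; exact: mc.
apply/seteqP; split => x /=.
  by move=> Ax; rewrite -bigcap_seq => k _ /=; exact: Ax.
by rewrite -bigcap_seq => Ax k; apply: (Ax k) => /=; rewrite mem_index_enum.
Qed.

Lemma leb_coords_tuple (n : nat) :
  leb_coords (lebesgue_tuple R n) (fun (i : 'I_n) x => tnth x i).
Proof.
split=> [k|]; first exact: measurable_tnth.
elim: n => [|n IH] A mA.
  rewrite /= diracE big_ord0 mem_set//.
  by move=> [].
rewrite /= /cons_measure /pushforward.
rewrite (_ : _ @^-1` _ =
    A ord0 `*` [set x | forall k, A (lift ord0 k) (tnth x k)]); last first.
  apply/seteqP; split => -[t x] /=.
    move=> H; split; first exact: (H ord0).
    by move=> k; have := H (lift ord0 k); rewrite tnthS.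
  move=> [H0 H] k; case: (unliftP ord0 k) => [j ->|->//].
  by rewrite tnthS; exact: H.
rewrite product_measure1E//; last first.
  exact: (measurable_box (@measurable_tnth _ (measurableTypeR R) n)
    (fun k => mA (lift ord0 k))).
rewrite big_ord_recl; congr (_ * _)%E.
by apply: (IH (fun k => A (lift ord0 k))) => k; exact: mA.
Qed.

Lemma leb_coords_reindex (d : measure_display) (T : measurableType d)
    (K K' : finType) (mu : {measure set T -> \bar R})
    (c : K -> T -> measurableTypeR R) (e : K' -> K) (e' : K -> K') :
  cancel e e' -> cancel e' e ->
  leb_coords mu c -> leb_coords mu (fun k' => c (e k')).
Proof.
move=> eK e'K [mc boxc]; split=> [k|A mA]; first exact: mc.
rewrite (_ : [set _ | _] = [set x | forall k, A (e' k) (c k x)]).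
  rewrite (boxc (fun k => A (e' k)))// (reindex e)/=; last by exists e' => k _; rewrite ?eK ?e'K.
  by apply: eq_bigr => k _; rewrite eK.
apply/seteqP; split => x /= H k; first by have := H (e' k); rewrite e'K.
by have := H (e k); rewrite eK.
Qed.

Lemma leb_coords_prod (d1 d2 : measure_display) (T1 : measurableType d1)
    (T2 : measurableType d2) (K1 K2 : finType)
    (m1 : {measure set T1 -> \bar R}) (m2 : {sigma_finite_measure set T2 -> \bar R})
    (c1 : K1 -> T1 -> measurableTypeR R) (c2 : K2 -> T2 -> measurableTypeR R) :
  leb_coords m1 c1 -> leb_coords m2 c2 ->
  leb_coords (m1 \x m2)%E (fun (k : K1 + K2) x =>
    match k with inl i => c1 i x.1 | inr j => c2 j x.2 end).
Proof.
move=> [mc1 box1] [mc2 box2]; split.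
  by move=> [i|j]; apply: measurableT_comp.
move=> A mA.
rewrite (_ : [set _ | _] = [set x | forall k, A (inl k) (c1 k x)] `*`
    [set x | forall k, A (inr k) (c2 k x)]); last first.
  apply/seteqP; split => -[x y] /=.
    by move=> H; split => k; [exact: (H (inl k))|exact: (H (inr k))].
  by move=> [H1 H2] [i|j].
rewrite [LHS]/= product_measure1E; last 2 first.
- exact: (measurable_box mc1 (fun k => mA (inl k))).
- exact: (measurable_box mc2 (fun k => mA (inr k))).
by rewrite (box1 (fun k => A (inl k)))// (box2 (fun k => A (inr k)))// [RHS]big_sumType.
Qed.

(** The inverse of reading coordinates: a family of K coordinate functions on T
    becomes a map from T to R^K. *)
Definition mkcoords (T : Type) (K : finType) (c : K -> T -> R) (x : T) : coords R K :=
  [tuple c (enum_val i) x | i < #|{: K}|].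

Lemma icoord_mkcoords (T : Type) (K : finType) (c : K -> T -> R) x k :
  icoord (mkcoords c x) k = c k x.
Proof. by rewrite /icoord tnth_mktuple enum_rankK. Qed.

Lemma measurable_mkcoords (d : measure_display) (T : measurableType d)
    (K : finType) (c : K -> T -> measurableTypeR R) :
  (forall k, measurable_fun setT (c k)) ->
  measurable_fun setT (mkcoords c : T -> coords R K).
Proof.
move=> mc; apply/measurable_fun_tnthP => i.
rewrite (_ : _ \o _ = c (enum_val i)); first exact: mc.
by apply/funext => x /=; rewrite tnth_mktuple.
Qed.

Lemma measurable_icoord (K : finType) (k : K) :
  measurable_fun setT (fun x : coords R K => icoord x k : measurableTypeR R).
Proof. exact: measurable_tnth. Qed.

Lemma leb_coords_icoord (K : finType) :
  leb_coords (lebesgue_tuple R #|{: K}|) (fun (k : K) (x : coords R K) => icoord x k).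
Proof.
exact: (leb_coords_reindex (@enum_rankK K) (@enum_valK K)
  (leb_coords_tuple #|{: K}|)).
Qed.

Definition boxes (n : nat) : set (set (n.-tuple (measurableTypeR R))) :=
  [set B | exists2 A : 'I_n -> set (measurableTypeR R), (forall k, measurable (A k)) &
     B = [set x | forall k, A k (tnth x k)]].

Lemma boxes_setI n : setI_closed (@boxes n).
Proof.
move=> _ _ [A mA ->] [B mB ->]; exists (fun k => A k `&` B k).
  by move=> k; exact: measurableI.
apply/seteqP; split => x /=; first by move=> [] ? ? k; split.
by move=> H; split => k; have [] := H k.
Qed.

(** The sigma-algebra of tuples is generated by the preimages under one
    projection, and such a preimage is a box with all other sides equal to R. *)
Lemma boxes_generate n :
  (@measurable _ (n.-tuple (measurableTypeR R))) = <<s @boxes n >>.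
Proof.
apply/seteqP; split; last first.
  apply: smallest_sub; first exact: sigma_algebra_measurable.
  move=> _ [A mA ->].
  exact: (measurable_box (@measurable_tnth _ (measurableTypeR R) n) mA).
apply: smallest_sub => // X.
rewrite -bigcup_seq => -[i /= _ [A mA <-]].
apply: sub_sigma_algebra; exists (fun k => if k == i then A else setT).
  by move=> k; case: ifP.
apply/seteqP; split => x /=.
  by move=> [_ Ax] k; case: eqP => // ->.
by move=> /(_ i); rewrite eqxx.
Qed.

(** Boxes form a pi-system generating the sigma-algebra and covering R^K by sets
    of finite measure, so the image of mu under the coordinates must be Lebesgue
    measure. *)
Lemma leb_coords_unique (d : measure_display) (T : measurableType d) (K : finType)
    (mu : {measure set T -> \bar R}) (c : K -> T -> measurableTypeR R)
    (F : coords R K -> \bar R) :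
  leb_coords mu c -> measurable_fun [set: coords R K] F -> (forall x, 0 <= F x)%E ->
  (\int[lebesgue_tuple R #|{: K}|]_x F x = \int[mu]_x F (mkcoords c x))%E.
Proof.
move=> [mc boxc] mF F0.
have mm := measurable_mkcoords mc.
rewrite -(@ge0_integral_pushforward _ _ _ _ _ _ mm mu setT)//.
apply: eq_measure_integral => A mA _.
pose g (k : nat) : set (coords R K) :=
  [set x | forall i, `[(- k%:R)%R, k%:R]%classic (tnth x i)].
apply: (@measure_unique _ _ _ (@boxes #|{: K}|) g) => //.
- exact: boxes_generate.
- exact: boxes_setI.
- by move=> k; exists (fun=> `[(- k%:R)%R, k%:R]%classic).
- apply/seteqP; split => // x _.
  pose M := \sum_i `|tnth x i|.
  exists (Num.bound M) => // i /=.
  have xM : `|tnth x i| <= (Num.bound M)%:R.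
    apply: le_trans (ltW (archi_boundP _)); last by apply: sumr_ge0.
    by rewrite /M (bigD1 i)//= lerDl; exact: sumr_ge0.
  by rewrite in_itv /=; move: xM; rewrite ler_norml.
- move=> B [A' mA' ->].
  have [_ ->//] := leb_coords_tuple #|{: K}|.
  rewrite [RHS](_ : _ = mu [set x | forall k, A' (enum_rank k) (c k x)]); last first.
    congr (mu _); apply/seteqP; split => x /=.
      move=> + k => /(_ (enum_rank k)); by rewrite tnth_mktuple enum_rankK.
    by move=> + i => /(_ (enum_val i)); rewrite tnth_mktuple enum_valK.
  rewrite (boxc (fun k => A' (enum_rank k)))//.
  rewrite (reindex (@enum_rank K))//=.
  by exists enum_val => k _; rewrite ?enum_rankK ?enum_valK.
- move=> k; have [_ /(_ (fun=> `[(- k%:R)%R, k%:R]%classic)) boxk] :=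
    leb_coords_tuple #|{: K}|.
  rewrite /g boxk//.
  have [r ->] : exists r : R,
      (\prod_(i < #|{: K}|) leb `[(- k%:R)%R, k%:R]%classic = r%:E)%E.
    elim/big_rec: _ => [|i _ _ [r ->]]; first by exists 1.
    rewrite lebesgue_measure_itv/=; case: ifP => _.
      by exists ((k%:R - - k%:R) * r); rewrite EFinM.
    by exists 0; rewrite mul0e.
  by rewrite ltry.
Qed.

End LebesgueCoordinates.

(** * Quadratic forms and Schur complements *)
Section PositiveDefinite.
Context (R : realType).

Definition qf n (A : 'M[R]_n) (v : 'cV[R]_n) : R := (v^T *m A *m v) 0 0.

Lemma bilin_sym m n (A : 'M[R]_(m, n)) (u : 'cV[R]_m) (v : 'cV[R]_n) :
  (u^T *m A *m v) 0 0 = (v^T *m A^T *m u) 0 0.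
Proof.
have -> : u^T *m A *m v = (v^T *m A^T *m u)^T.
  by rewrite !trmx_mul !trmxK mulmxA.
by rewrite mxE.
Qed.

Lemma qfD n (A : 'M[R]_n) u v : A^T = A ->
  qf A (u + v) = qf A u + 2 * (u^T *m A *m v) 0 0 + qf A v.
Proof.
move=> sA; rewrite /qf [(u + v)^T]linearD /= mulmxDl mulmxDl !mulmxDr !mxE.
have := bilin_sym A u v; rewrite !mxE sA => ->; lra.
Qed.

Lemma qfN n (A : 'M[R]_n) u : qf A (- u) = qf A u.
Proof. by rewrite /qf [(- u)^T]linearN /= mulNmx mulNmx mulmxN opprK. Qed.

Lemma qf0 n (A : 'M[R]_n) : qf A 0 = 0.
Proof. by rewrite /qf mulmx0 mxE. Qed.

Lemma qf_congr n m (A : 'M[R]_n) (X : 'M[R]_(n, m)) v :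
  qf (X^T *m A *m X) v = qf A (X *m v).
Proof. by rewrite /qf trmx_mul !mulmxA. Qed.

Lemma qf_addmx n (A B : 'M[R]_n) v : qf (A + B) v = qf A v + qf B v.
Proof. by rewrite /qf mulmxDr mulmxDl mxE. Qed.

Lemma qf_oppmx n (A : 'M[R]_n) v : qf (- A) v = - qf A v.
Proof. by rewrite /qf mulmxN mulNmx mxE. Qed.

Lemma qf_complete_square n (A : 'M[R]_n) x b : A^T = A -> A \in unitmx ->
  qf A x - 2 * (b^T *m x) 0 0 = qf A (x - invmx A *m b) - qf (invmx A) b.
Proof.
move=> sA uA; rewrite qfD// qfN.
rewrite mulmxN mulmxA -(mulmxA _ A) mulmxV// mulmx1.
have -> : qf A (invmx A *m b) = qf (invmx A) b.
  by rewrite -qf_congr trmx_inv sA mulVmx// mul1mx.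
have -> : (- (x^T *m b)) 0 0 = - (b^T *m x) 0 0.
  rewrite mxE; congr (- _).
  by have := bilin_sym 1%:M x b; rewrite trmx1 !mulmx1.
lra.
Qed.

Lemma posdef_congr n m (A : 'M[R]_n) (X : 'M[R]_(n, m)) :
  posdefmx A -> (forall v : 'cV_m, X *m v = 0 -> v = 0) -> posdefmx (X^T *m A *m X).
Proof.
move=> [sA pA] X0; split; first by rewrite !trmx_mul trmxK sA mulmxA.
move=> v v0; rewrite -/(qf _ v) qf_congr; apply: pA.
by apply: contra v0 => /eqP /X0 ->.
Qed.

Lemma qf1_ge0 n (v : 'cV[R]_n) : 0 <= qf 1%:M v.
Proof.
rewrite /qf mulmx1 mxE; apply: sumr_ge0 => i _.
by rewrite mxE -expr2 sqr_ge0.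
Qed.

Lemma posdef1 n : posdefmx (1%:M : 'M[R]_n).
Proof.
split=> [|v v0]; first by rewrite trmx1.
rewrite lt_neqAle qf1_ge0 andbT eq_sym; apply: contra v0.
rewrite mulmx1 mxE psumr_eq0; last by move=> i _; rewrite mxE -expr2 sqr_ge0.
move=> /allP v0; apply/eqP/matrixP => i j; rewrite ord1.
have := v0 i (mem_index_enum _).
by rewrite !mxE mulf_eq0 orbb => /eqP.
Qed.

Lemma posdef_qf_ge0 n (A : 'M[R]_n) v : posdefmx A -> 0 <= qf A v.
Proof.
move=> [_ pA]; have [->|v0] := eqVneq v 0; first by rewrite qf0.
exact/ltW/pA.
Qed.

Lemma posdefD n (A B : 'M[R]_n) : posdefmx A -> B^T = B ->
  (forall v, 0 <= qf B v) -> posdefmx (A + B).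
Proof.
move=> [sA pA] sB pB; split; first by rewrite [(A + B)^T]linearD /= sA sB.
by move=> v v0; rewrite -/(qf _ v) qf_addmx ltr_pwDl//; exact: pA.
Qed.

Lemma qf_gram_ge0 n m (L : 'M[R]_(n, m)) v : 0 <= qf (L *m L^T) v.
Proof.
rewrite -[L in L *m _]trmxK -[L^T^T]mulmx1 qf_congr; exact: qf1_ge0.
Qed.

Lemma det_schur m n (A : 'M[R]_m) (B : 'M[R]_(m, n)) C D : A \in unitmx ->
  \det (block_mx A B C D) = \det A * \det (D - C *m invmx A *m B).
Proof.
move=> uA.
have -> : block_mx A B C D = block_mx 1%:M 0 (C *m invmx A) 1%:M *m
    block_mx A B 0 (D - C *m invmx A *m B).
  rewrite mulmx_block !mul1mx !mul0mx !addr0 mulmxKV//.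
  by rewrite addrC subrK.
by rewrite det_mulmx det_lblock det_ublock !det1 !mul1r.
Qed.

Lemma qf_schur m n (A : 'M[R]_m) (B : 'M[R]_(m, n)) D x y :
  A^T = A -> A \in unitmx ->
  qf (block_mx A B B^T D) (col_mx x y) =
  qf A (x + invmx A *m B *m y) + qf (D - B^T *m invmx A *m B) y.
Proof.
move=> sA uA; rewrite qfD// qf_addmx qf_oppmx.
have -> : qf (B^T *m invmx A *m B) y = qf A (invmx A *m B *m y).
  rewrite -!qf_congr; congr (qf _ y).
  by rewrite trmx_mul trmx_inv sA !mulmxA mulmxKV// .
have -> : qf (block_mx A B B^T D) (col_mx x y) =
    qf A x + (y^T *m B^T *m x) 0 0 + ((x^T *m B *m y) 0 0 + qf D y).
  by rewrite /qf tr_col_mx mul_row_block mul_row_col !mulmxDl !mxE.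
have -> : (x^T *m A *m (invmx A *m B *m y)) 0 0 = (x^T *m B *m y) 0 0.
  by rewrite !mulmxA mulmxK.
by rewrite (bilin_sym B^T) trmxK; lra.
Qed.

Lemma posdef_ulsub m n (A : 'M[R]_m) (B : 'M[R]_(m, n)) C D :
  posdefmx (block_mx A B C D) -> posdefmx A.
Proof.
move=> [s p]; split.
  by move: s; rewrite tr_block_mx => /eq_block_mx[].
move=> v v0; have : col_mx v (0 : 'cV_n) != 0.
  by apply: contra v0 => /eqP; rewrite -(@col_mx0 _ m n 1) => /eq_col_mx[-> _].
move/p; rewrite tr_col_mx mul_row_block mul_row_col trmx0 !mul0mx mulmx0.
by rewrite !addr0.
Qed.

Lemma posdef_schurE m n (A : 'M[R]_m) (B : 'M[R]_(m, n)) D :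
  posdefmx A -> A \in unitmx -> D^T = D ->
  posdefmx (block_mx A B B^T D) <-> posdefmx (D - B^T *m invmx A *m B).
Proof.
move=> pA uA sD; have sA := pA.1.
have sS : (D - B^T *m invmx A *m B)^T = D - B^T *m invmx A *m B.
  by rewrite linearB /= !trmx_mul trmxK trmx_inv sA sD !mulmxA.
split=> [[_ p]|[_ p]]; split=> //.
- move=> v v0.
  have /p : col_mx (- (invmx A *m B *m v)) v != 0.
    by apply: contra v0 => /eqP; rewrite -(@col_mx0 _ m n 1) => /eq_col_mx[_ ->].
  by rewrite -/(qf _ _) qf_schur// addNr qf0 add0r.
- by rewrite tr_block_mx trmxK sA sD.
- move=> v v0; rewrite -/(qf _ _) -[v]vsubmxK qf_schur//.
  have [d0|d0] := eqVneq (dsubmx v) 0.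
    rewrite d0 mulmx0 qf0 !addr0; apply: pA.2.
    by apply: contra v0 => /eqP u0; rewrite -[v]vsubmxK d0 u0 col_mx0.
  by apply: ltr_wpDl; [exact: posdef_qf_ge0|exact: p].
Qed.

(** Needed for the non-symmetric matrix 1 + M + N with N skew.  The Schur complement
    of the first entry again has a positive form: its value at y is the value of
    the original form at the vector that extends y and on which the first row
    vanishes. *)
Lemma qf_gt0_det_gt0 n (A : 'M[R]_n) :
  (forall v, v != 0 -> 0 < qf A v) -> 0 < \det A.
Proof.
elim: n A => [|n IH] A pA; first by rewrite det_mx00.
move: pA; change ((forall v : 'cV[R]_(1 + n), v != 0 -> 0 < qf (A : 'M[R]_(1 + n)) v) ->
  0 < \det (A : 'M[R]_(1 + n))).
move: (A : 'M[R]_(1 + n)) => {}A pA.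
rewrite -[A]submxK; set a := ulsubmx A; set b := ursubmx A.
set c := dlsubmx A; set D := drsubmx A.
have qA (x : 'cV[R]_1) (y : 'cV[R]_n) : qf A (col_mx x y) =
    (x^T *m (a *m x + b *m y)) 0 0 + (y^T *m (c *m x + D *m y)) 0 0.
  rewrite -[A]submxK /qf tr_col_mx -mulmxA mul_block_col mul_row_col.
  by rewrite [LHS]mxE.
have a0 : 0 < \det a.
  rewrite [a]mx11_scalar det_scalar1.
  have := pA (col_mx 1%:M 0); rewrite qA !mulmx0 trmx0 mul0mx addr0.
  rewrite trmx1 mul1mx mulmx1 [X in _ + X]mxE addr0; apply.
  apply/eqP => /matrixP /(_ (lshift n 0) 0).
  by rewrite col_mxEu !mxE eqxx => /eqP; rewrite oner_eq0.
have ua : a \in unitmx by rewrite unitmxE unitfE gt_eqF.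
rewrite det_schur// mulr_gt0//; apply: IH => y y0.
have := pA (col_mx (- (invmx a *m b *m y)) y); rewrite qA.
have -> : a *m (- (invmx a *m b *m y)) + b *m y = 0.
  by rewrite mulmxN !mulmxA mulmxV// mul1mx addNr.
have -> : c *m (- (invmx a *m b *m y)) + D *m y = (D - c *m invmx a *m b) *m y.
  by rewrite mulmxN mulmxBl addrC !mulmxA.
rewrite mulmx0 [X in X + _]mxE add0r /qf mulmxA; apply.
by apply: contra y0 => /eqP; rewrite -(@col_mx0 _ 1 n 1) => /eq_col_mx[_ ->].
Qed.

Lemma posdef_det_gt0 n (A : 'M[R]_n) : posdefmx A -> 0 < \det A.
Proof. by move=> [_ pA]; exact: qf_gt0_det_gt0. Qed.

Lemma posdef_unit n (A : 'M[R]_n) : posdefmx A -> A \in unitmx.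
Proof. by move=> /posdef_det_gt0 d; rewrite unitmxE unitfE gt_eqF. Qed.

Lemma posdef_invmx n (A : 'M[R]_n) : posdefmx A -> posdefmx (invmx A).
Proof.
move=> pA; have uA := posdef_unit pA.
have -> : invmx A = (invmx A)^T *m A *m invmx A.
  by rewrite trmx_inv pA.1 mulmxK ?mulVmx ?mul1mx.
apply: posdef_congr => // v /(congr1 (mulmx A)).
by rewrite mulKVmx// mulmx0.
Qed.

Lemma posdef_addgram n m (A : 'M[R]_n) (L : 'M[R]_(n, m)) :
  posdefmx A -> posdefmx (A + L *m L^T).
Proof.
move=> pA; apply: posdefD => //; first by rewrite trmx_mul trmxK.
exact: qf_gram_ge0.
Qed.

Lemma invmx_eq n (A X : 'M[R]_n) : A *m X = 1%:M -> invmx A = X.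
Proof.
move=> AX; have [uA _] := mulmx1_unit AX.
by rewrite -[LHS]mulmx1 -AX mulKmx.
Qed.

(** The inverse and the determinant of a perturbation of A by a Gram matrix, in
    terms of the r x r matrix 1 + L^T A^-1 L. *)
Section Woodbury.
Variables (p r : nat) (A : 'M[R]_p) (L : 'M[R]_(p, r)).
Hypothesis pA : posdefmx A.
Let P : 'M[R]_r := 1%:M + L^T *m invmx A *m L.

Lemma woodbury_posdef : posdefmx P.
Proof.
apply: posdefD; first exact: posdef1.
  by rewrite !trmx_mul trmxK trmx_inv pA.1 mulmxA.
move=> v; rewrite qf_congr; apply: posdef_qf_ge0; exact: posdef_invmx.
Qed.

Lemma woodbury_det : \det A * \det P = \det (A + L *m L^T).
Proof.
have := @det_schur p r A L (- L^T) 1%:M (posdef_unit pA).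
rewrite !mulNmx opprK -/P => <-.
have -> : block_mx A L (- L^T) 1%:M = block_mx (A + L *m L^T) L 0 1%:M *m
    block_mx 1%:M 0 (- L^T) (1%:M : 'M[R]_r).
  by rewrite mulmx_block !mulmx1 !mulmx0 !add0r mulmxN addrK mul1mx.
by rewrite det_mulmx det_lblock det_ublock !det1 !mulr1.
Qed.

Lemma woodbury_inv :
  invmx (A + L *m L^T) =
  invmx A - (invmx A *m L) *m invmx P *m (L^T *m invmx A).
Proof.
apply: invmx_eq; have uA := posdef_unit pA.
have uP := posdef_unit woodbury_posdef.
rewrite mulmxBr mulmxDl mulmxV//.
have -> : (A + L *m L^T) *m (invmx A *m L *m invmx P *m (L^T *m invmx A)) =
    L *m (1%:M + L^T *m invmx A *m L) *m invmx P *m (L^T *m invmx A).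
  by rewrite mulmxDl mulmxDr mulmx1 !mulmxDl !mulmxA mulmxV// mul1mx.
by rewrite -/P mulmxK// !mulmxA addrK.
Qed.

End Woodbury.

Lemma skew_qf n (N : 'M[R]_n) v : N^T = - N -> qf N v = 0.
Proof.
move=> sN; have : qf N v = - qf N v.
  by rewrite -qf_oppmx -sN /qf bilin_sym.
by move=> h; apply/eqP; rewrite -[_ == 0](mulrn_eq0 _ 2) mulr2n [X in X + _]h addNr eqxx.
Qed.

Lemma unitmx_qf_gt0 n (A : 'M[R]_n) :
  (forall v, v != 0 -> 0 < qf A v) -> A \in unitmx.
Proof. by move=> /qf_gt0_det_gt0 dA; rewrite unitmxE unitfE gt_eqF. Qed.

Lemma bilin_expand n (A : 'M[R]_n) (m x : 'cV[R]_n) :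
  ((m - x)^T *m A *m (m + x)) 0 0 =
  qf A m - qf A x + (m^T *m A *m x) 0 0 - (x^T *m A *m m) 0 0.
Proof.
have addE (X Y : 'M[R]_1) : (X + Y) 0 0 = X 0 0 + Y 0 0 by rewrite mxE.
have oppE (X : 'M[R]_1) : (- X) 0 0 = - X 0 0 by rewrite mxE.
rewrite [(m - x)^T]linearB /= 2!mulmxBl !mulmxDr !(addE, oppE) /qf; lra.
Qed.

(** With E positive definite, N skew and G = (E + N)^-1, the symmetric part of G
    is S = G E G^T = G^T E G, because E is the symmetric part of E + N; T is the
    skew part of G. *)
Section SkewPerturbation.
Variables (n : nat) (E N : 'M[R]_n).
Hypotheses (pE : posdefmx E) (sN : N^T = - N).
Let G := invmx (E + N).
Let S := G *m E *m G^T.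
Let T := G - S.

Lemma unit_skew_perturb : E + N \in unitmx.
Proof.
apply: unitmx_qf_gt0 => v v0; rewrite qf_addmx (skew_qf _ sN) addr0; exact: pE.2.
Qed.
(* Kept in the context, where the terminator // finds the invertibility conditions. *)
Let uK := unit_skew_perturb.

Let uG : G \in unitmx. Proof. by rewrite unitmx_inv. Qed.
Let uGT : G^T \in unitmx. Proof. by rewrite unitmx_tr. Qed.
Let sK : (E + N)^T = E - N. Proof. by rewrite linearD /= pE.1 sN. Qed.

Let sumE : (E + N)^T + (E + N) = 2 *: E.
Proof. by rewrite sK addrACA addNr addr0 scaler_nat mulr2n. Qed.

Let GD : G + G^T = 2 *: S.
Proof.
have -> : 2 *: S = G *m ((E + N)^T + (E + N)) *m G^T.
  by rewrite sumE -scalemxAr -scalemxAl.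
rewrite mulmxDr mulmxDl -/G mulVmx// mul1mx -mulmxA -trmx_mul mulVmx//.
by rewrite trmx1 mulmx1.
Qed.

Let SE : S = G^T *m E *m G.
Proof.
apply: (@scalerI _ _ 2) => //; rewrite -GD.
have -> : 2 *: (G^T *m E *m G) = G^T *m ((E + N)^T + (E + N)) *m G.
  by rewrite sumE -scalemxAr -scalemxAl.
rewrite mulmxDr mulmxDl -trmx_mul mulmxV// trmx1 mul1mx -mulmxA mulmxV//.
by rewrite mulmx1.
Qed.

Lemma skew_part_posdef : posdefmx S.
Proof.
rewrite SE; apply: posdef_congr => // v /(congr1 (mulmx (invmx G))).
by rewrite mulKmx// mulmx0.
Qed.

Let sS : S^T = S. Proof. exact: skew_part_posdef.1. Qed.
Let uS : S \in unitmx. Proof. exact: posdef_unit skew_part_posdef. Qed.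

Let sT : T^T = - T.
Proof.
rewrite /T linearB /= sS; apply/matrixP => i j.
move/matrixP: GD => /(_ i j); rewrite !mxE; lra.
Qed.

Lemma skew_part_det : \det S = \det E / \det (E + N) ^+ 2.
Proof.
rewrite /S !det_mulmx det_tr /G det_inv; field.
by rewrite -unitfE -unitmxE.
Qed.

(** Together with G = S + T this gives S + T S^-1 T^T = E^-1, which is what
    remains after completing the square below. *)
Let SinvE : G *m invmx S *m G^T = invmx E.
Proof.
apply/esym/invmx_eq.
have EE : E = invmx G^T *m S *m invmx G.
  by rewrite SE !mulmxA mulVmx// mul1mx mulmxK.
rewrite [X in X *m _]EE; move: (S) uS => X uX.
by rewrite !mulmxA mulmxKV// mulmxK// mulVmx.
Qed.

Let TSinvT : S + T *m invmx S *m T^T = invmx E.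
Proof.
rewrite -SinvE {1}/T mulmxBl mulmxV// mulmxBl mul1mx /T linearB /= sS mulmxBr.
rewrite mulmxKV// -/T.
apply/matrixP => i j; move/matrixP: GD => /(_ i j); rewrite !mxE.
lra.
Qed.

(** The skew part of G contributes only the cross term of m and x, and the
    symmetric part only the two squares. *)
Lemma skew_part_complete_square (m x : 'cV[R]_n) :
  - ((m - x)^T *m G *m (m + x)) 0 0 =
  qf S (x - invmx S *m (T^T *m m)) - qf (invmx E) m.
Proof.
have -> : ((m - x)^T *m G *m (m + x)) 0 0 =
    qf S m - qf S x + 2 * ((T^T *m m)^T *m x) 0 0.
  have -> : G = S + T by rewrite addrC subrK.
  rewrite [X in X *m _]mulmxDr mulmxDl mxE.
  rewrite !bilin_expand !(skew_qf _ sT) trmx_mul trmxK.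
  rewrite (bilin_sym S x m) (bilin_sym T x m) sS sT mulmxN mulNmx [(- (_ *m _)) 0 0]mxE.
  lra.
have := qf_complete_square x (T^T *m m) sS uS.
have -> : qf (invmx S) (T^T *m m) = qf (invmx E) m - qf S m.
  rewrite -qf_congr trmxK -TSinvT qf_addmx; lra.
lra.
Qed.

End SkewPerturbation.

(** The quadratic form Q by which the last pivot of 1 + M + N exceeds one plus the
    last pivot of M - L L^T.  The witnesses are found by completing squares:
    S is the symmetric part of (1 + M + N)^-1 and absorbs n; what is left is
    l^T P l plus linear terms, with P = 1 + L^T A^-1 L; what is left then is
    M^-1 - (1 + M)^-1 = ((1 + M) M)^-1 = H, applied to m.  The determinants of
    1 + M and M cancel between S, P and H. *)
Lemma bordered_form p r (M N : 'M[R]_p) (L : 'M[R]_(p, r)) :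
  posdefmx (M - L *m L^T) -> N^T = - N ->
  exists (S : 'M[R]_p) (P : 'M[R]_r) (H : 'M[R]_p)
      (c1 : 'cV[R]_p -> 'cV[R]_p) (c2 : 'cV[R]_p -> 'cV[R]_r),
    [/\ posdefmx S, posdefmx P, posdefmx H,
      \det S * \det P * \det H =
        (\det (M - L *m L^T) * \det (1%:M + M + N) ^+ 2)^-1 &
      forall (m n : 'cV[R]_p) (l : 'cV[R]_r),
        qf 1%:M l + qf (invmx (M - L *m L^T)) (m - L *m l)
          - ((m - n)^T *m invmx (1%:M + M + N) *m (m + n)) 0 0 =
        qf S (n - c1 m) + qf P (l - c2 m) + qf H m].
Proof.
move=> pA sN; set A := M - L *m L^T in pA *.
have ME : M = A + L *m L^T by rewrite subrK.
have pM : posdefmx M by rewrite ME; exact: posdef_addgram.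
have uM := posdef_unit pM; have uA := posdef_unit pA.
have pE : posdefmx (1%:M + M).
  by apply: posdefD; [exact: posdef1|exact: pM.1|move=> v; exact: posdef_qf_ge0].
have uE := posdef_unit pE.
set E := 1%:M + M in pE uE *.
pose G := invmx (E + N); pose S := G *m E *m G^T.
pose P := 1%:M + L^T *m invmx A *m L.
have pP : posdefmx P := woodbury_posdef L pA.
pose H := invmx (E *m M).
have EM : E *m M = M + M *m M by rewrite mulmxDl mul1mx.
have pH : posdefmx H.
  apply: posdef_invmx; rewrite EM; apply: posdefD => //.
    by rewrite trmx_mul pM.1.
  move=> v; rewrite -[M in M *m _]pM.1 -[M^T]mulmx1 qf_congr; exact: qf1_ge0.
have HE : invmx M - invmx E = H.
  apply/esym/invmx_eq; rewrite mulmxBr mulmxK//.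
  have -> : E *m M = M *m E by rewrite mulmxDl mulmxDr mul1mx mulmx1.
  by rewrite mulmxK// addrK.
exists S, P, H, (fun m => invmx S *m ((G - S)^T *m m)),
  (fun m => invmx P *m (L^T *m invmx A *m m)); split => //.
- exact: skew_part_posdef.
- have dM := woodbury_det L pA; rewrite -ME -/P in dM.
  have dS : \det S = \det E / \det (E + N) ^+ 2 := skew_part_det pE sN.
  rewrite dS /H det_inv det_mulmx -dM.
  have := posdef_det_gt0 pA; have := posdef_det_gt0 pP.
  have := posdef_det_gt0 pE.
  have := unit_skew_perturb pE sN; rewrite unitmxE unitfE.
  move: (\det _) (\det _) (\det _) (\det _) => dEN dE dP dA dEN0 dE0 dP0 dA0.
  by field; rewrite dEN0 !gt_eqF.
move=> m n l; have := skew_part_complete_square pE sN m n.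
rewrite -/G -/S -addrA => ->.
have -> : qf (invmx A) (m - L *m l) = qf (invmx A) m
    - 2 * ((L^T *m invmx A *m m)^T *m l) 0 0 + qf (L^T *m invmx A *m L) l.
  rewrite qf_congr qfD ?trmx_inv ?pA.1// qfN !trmx_mul trmxK trmx_inv pA.1.
  by rewrite mulmxN !mulmxA [(- (_ *m _)) 0 0]mxE mulrN.
have := qf_complete_square l (L^T *m invmx A *m m) pP.1 (posdef_unit pP).
rewrite {1}/P qf_addmx.
have -> : qf H m = qf (invmx M) m - qf (invmx E) m.
  by rewrite -HE qf_addmx qf_oppmx.
have -> : qf (invmx M) m = qf (invmx A) m - qf (invmx P) (L^T *m invmx A *m m).
  rewrite {1}ME (woodbury_inv L pA) -/P qf_addmx qf_oppmx -qf_congr.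
  by rewrite !trmx_mul trmxK trmx_inv pA.1 !mulmxA.
lra.
Qed.

Lemma det_skew_perturb_gt0 n (E N : 'M[R]_n) :
  posdefmx E -> N^T = - N -> 0 < \det (E + N).
Proof.
move=> [_ pE] sN; apply: qf_gt0_det_gt0 => v v0.
rewrite qf_addmx (skew_qf _ sN) addr0; exact: pE.
Qed.

End PositiveDefinite.

(** * Nonnegative integrals in split coordinates *)
Section Tonelli.
Context (R : realType).
Local Notation leb := (@lebesgue_measure R).
Local Open Scope ereal_scope.

(** Both sides define measures which agree on half-open intervals. *)
Lemma ge0_integral_affine (f : measurableTypeR R -> \bar R) (a b : R) :
  (0 < a)%R -> measurable_fun setT f -> (forall x, 0 <= f x) ->
  \int[leb]_x f (a * x + b)%R = (a^-1)%:E * \int[leb]_x f x.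
Proof.
move=> a0 mf f0.
pose phi (x : measurableTypeR R) : measurableTypeR R := (a * x + b)%R.
have mphi : measurable_fun setT phi.
  by apply: measurable_funD => //; exact: measurable_funM.
pose an : {nonneg R} := NngNum (ltW a0).
have mE A : measurable A -> leb A = mscale an (pushforward leb phi) A.
  move=> mA; apply: (lebesgue_measure_unique (mu := mscale an (pushforward leb phi))) => //.
  move=> _ [[u v] _ <-]; rewrite /mscale/= /pushforward.
  transitivity (a%:E * leb `](u - b) / a, (v - b) / a]%classic%R).
    rewrite !lebesgue_measure_itv/= !lte_fin ltr_pM2r ?invr_gt0// ltrD2r.
    case: ifP => _; last by rewrite mule0.
    rewrite -EFinB -EFinM; congr EFin; field; exact: lt0r_neq0.
  congr (_ * leb _); apply/seteqP; split => x /=;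
    by rewrite /phi !in_itv/= ltr_pdivrMr// ler_pdivlMr// ltrBlDr lerBrDr (mulrC x).
rewrite (_ : \int[leb]_x f x = \int[mscale an (pushforward leb phi)]_x f x); last first.
  by apply: eq_measure_integral => A mA _; exact: mE.
rewrite ge0_integral_mscale// ge0_integral_pushforward//= muleA -EFinM.
by rewrite mulVf ?mul1e// gt_eqF.
Qed.

Lemma ge0_integral_lebesgue_cons n (F : n.+1.-tuple (measurableTypeR R) -> \bar R) :
  measurable_fun setT F -> (forall x, 0 <= F x) ->
  \int[lebesgue_tuple R n.+1]_x F x =
  \int[leb]_t \int[lebesgue_tuple R n]_y F (tcons (t, y)).
Proof.
move=> mF F0.
rewrite (ge0_integral_pushforward (@measurable_tcons _ (measurableTypeR R) n))//.
by rewrite fubini_tonelli1//=; exact: measurableT_comp (@measurable_tcons _ _ _).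
Qed.

(** Coordinates indexed by K, put together from a part indexed by I and a part
    indexed by J along a bijection e. *)
Definition merge_coords (T1 T2 : Type) (I J K : finType) (e : K -> I + J)
    (c1 : I -> T1 -> R) (c2 : J -> T2 -> R) : T1 * T2 -> coords R K :=
  mkcoords (fun k (xy : T1 * T2) =>
    match e k with inl i => c1 i xy.1 | inr j => c2 j xy.2 end).

Section Glue.
Context (d1 d2 : measure_display) (T1 : measurableType d1) (T2 : measurableType d2).
Context (m1 : {sigma_finite_measure set T1 -> \bar R}).
Context (m2 : {sigma_finite_measure set T2 -> \bar R}).
Context (I J K : finType) (e : K -> I + J) (e' : I + J -> K).
Hypotheses (eK : cancel e e') (e'K : cancel e' e).
Variables (c1 : I -> T1 -> measurableTypeR R) (c2 : J -> T2 -> measurableTypeR R).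

Lemma icoord_merge xy k : icoord (merge_coords e c1 c2 xy) k =
  match e k with inl i => c1 i xy.1 | inr j => c2 j xy.2 end.
Proof. by rewrite icoord_mkcoords. Qed.

Hypotheses (leb1 : leb_coords m1 c1) (leb2 : leb_coords m2 c2).

Lemma measurable_merge : measurable_fun setT (merge_coords e c1 c2).
Proof.
apply: measurable_mkcoords => k; case: (e k) => i.
  exact: measurableT_comp (leb1.1 i) measurable_fst.
exact: measurableT_comp (leb2.1 i) measurable_snd.
Qed.

Lemma ge0_integral_merge (F : coords R K -> \bar R) :
  measurable_fun [set: coords R K] F -> (forall x, 0 <= F x) ->
  \int[lebesgue_tuple R #|{: K}|]_x F x =
  \int[m1]_x \int[m2]_y F (merge_coords e c1 c2 (x, y)).
Proof.
move=> mF F0.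
have H := leb_coords_reindex eK e'K (leb_coords_prod leb1 leb2).
rewrite (leb_coords_unique H)// fubini_tonelli1//.
exact: measurableT_comp measurable_merge.
Qed.

End Glue.

Lemma leb_coords_unit :
  leb_coords leb (fun (_ : unit) (x : measurableTypeR R) => x).
Proof.
split=> [_|A mA]; first exact: measurable_id.
rewrite (bigD1 tt)//= big_pred0 ?mule1; last by case.
congr leb.
apply/seteqP; split => x /=; first exact.
by move=> Ax [].
Qed.

Lemma ge0_integral_coords0 (K : finType) (F : coords R K -> \bar R) (x0 : coords R K) :
  (K -> False) -> measurable_fun [set: coords R K] F -> (forall x, 0 <= F x) ->
  \int[lebesgue_tuple R #|{: K}|]_x F x = F x0.
Proof.
move=> K0 mF F0.
have e'K : cancel (fun i : 'I_0 => match notF (ltn_ord i) return K with end)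
    (fun k : K => match K0 k return 'I_0 with end) by case.
have eK : cancel (fun k : K => match K0 k return 'I_0 with end)
    (fun i : 'I_0 => match notF (ltn_ord i) return K with end).
  by move=> k; case: (K0 k).
have H := leb_coords_reindex eK e'K (leb_coords_tuple R 0).
rewrite (leb_coords_unique H)//.
rewrite (_ : (fun x => _) = fun _ => F x0).
  by rewrite integral_cst// /= diracE mem_set// mule1.
apply/funext => x; congr F; apply: eq_from_tnth => i.
by case: (K0 (enum_val i)).
Qed.

Definition sumsq n (x : n.-tuple (measurableTypeR R)) : measurableTypeR R :=
  (\sum_(i < n) tnth x i ^+ 2)%R.

Lemma measurable_sumsq n : measurable_fun setT (@sumsq n).
Proof.
apply: measurable_sum => i; apply: measurable_funX; exact: measurable_tnth.
Qed.

Lemma sumsq_ge0 n (x : n.-tuple (measurableTypeR R)) : (0 <= sumsq x)%R.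
Proof. by apply: sumr_ge0 => i _; rewrite sqr_ge0. Qed.

Lemma sumsq_cons n t (x : n.-tuple (measurableTypeR R)) :
  sumsq (tcons (t, x)) = (t ^+ 2 + sumsq x)%R.
Proof.
rewrite /sumsq big_ord_recl; congr (_ + _)%R.
by apply: eq_bigr => i _; rewrite tnthS.
Qed.

(** The integral over R^n of a function of the squared norm. *)
Definition radial n (f : measurableTypeR R -> \bar R) : \bar R :=
  \int[lebesgue_tuple R n]_x f (sumsq x).

Lemma radial0 f : measurable_fun setT f -> radial 0 f = f 0%R.
Proof.
move=> mf; rewrite /radial /= integral_dirac//=.
  by rewrite diracE mem_set// mul1e /sumsq big_ord0.
exact: measurableT_comp (@measurable_sumsq 0).
Qed.

Lemma radial_ge0 n f : (forall x, 0 <= f x) -> 0 <= radial n f.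
Proof. by move=> f0; exact: integral_ge0. Qed.

Lemma measurable_radial n (d : measure_display) (T : measurableType d)
    (f : T -> measurableTypeR R -> \bar R) :
  measurable_fun setT (fun x : T * measurableTypeR R => f x.1 x.2) ->
  (forall x u, 0 <= f x u) -> measurable_fun setT (fun x => radial n (f x)).
Proof.
move=> mf f0.
apply: (measurable_fun_fubini_tonelli_F
  (fun x : T * n.-tuple (measurableTypeR R) => f x.1 (sumsq x.2))) => //.
apply: (measurableT_comp mf (g := fun x : T * n.-tuple (measurableTypeR R) =>
  (x.1, sumsq x.2 : measurableTypeR R))).
apply: measurable_fun_pair => //=.
exact: measurableT_comp (@measurable_sumsq n) measurable_snd.
Qed.

Lemma radialS n f : measurable_fun setT f -> (forall x, 0 <= f x) ->
  radial n.+1 f = \int[leb]_t radial n (fun u => f (t ^+ 2 + u)%R).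
Proof.
move=> mf f0; rewrite /radial ge0_integral_lebesgue_cons//.
  apply: eq_integral => t _; apply: eq_integral => x _.
  by rewrite sumsq_cons.
exact: measurableT_comp (@measurable_sumsq _).
Qed.

Lemma radialD m n f : measurable_fun setT f -> (forall x, 0 <= f x) ->
  radial (m + n) f = radial m (fun u => radial n (fun v => f (u + v)%R)).
Proof.
elim: m f => [|m IH] f mf f0.
  rewrite radial0.
    by congr (radial n _); apply/funext => v; rewrite add0r.
  apply: measurable_radial => //.
  by apply: measurableT_comp mf _; exact: measurable_funD.
rewrite addSn !radialS//.
- apply: eq_integral => t _; rewrite IH//.
    congr (radial m _); apply/funext => u; congr (radial n _); apply/funext => v.
    by rewrite addrA.
  by apply: measurableT_comp mf _; exact: measurable_funD.
- apply: measurable_radial => //.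
  by apply: measurableT_comp mf _; exact: measurable_funD.
- by move=> x; exact: radial_ge0.
Qed.

End Tonelli.

(** * Measurability of matrix expressions *)
Section MeasurableMatrices.
Context (R : realType) (d : measure_display) (T : measurableType d).

Definition measurable_mx m n (A : T -> 'M[R]_(m, n)) : Prop :=
  forall i j, measurable_fun setT (fun x => A x i j : measurableTypeR R).

Lemma measurable_mx_cst m n (A : 'M[R]_(m, n)) : measurable_mx (fun=> A).
Proof. by move=> i j; exact: measurable_cst. Qed.

Lemma measurable_mxD m n (A B : T -> 'M[R]_(m, n)) :
  measurable_mx A -> measurable_mx B -> measurable_mx (fun x => A x + B x).
Proof.
move=> mA mB i j; under eq_fun do rewrite mxE.
exact: (measurable_funD (mA i j) (mB i j)).
Qed.

Lemma measurable_mxN m n (A : T -> 'M[R]_(m, n)) :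
  measurable_mx A -> measurable_mx (fun x => - A x).
Proof.
move=> mA i j; under eq_fun do rewrite mxE.
exact: measurableT_comp (@oppr_measurable R setT) (mA i j).
Qed.

Lemma measurable_mx_tr m n (A : T -> 'M[R]_(m, n)) :
  measurable_mx A -> measurable_mx (fun x => (A x)^T).
Proof.
move=> mA i j; under eq_fun do rewrite mxE.
exact: mA.
Qed.

Lemma measurable_mxM m n p (A : T -> 'M[R]_(m, n)) (B : T -> 'M[R]_(n, p)) :
  measurable_mx A -> measurable_mx B -> measurable_mx (fun x => A x *m B x).
Proof.
move=> mA mB i j; under eq_fun do rewrite mxE.
by apply: measurable_sum => k; exact: (measurable_funM (mA i k) (mB k j)).
Qed.

Lemma measurable_det n (A : T -> 'M[R]_n) :
  measurable_mx A -> measurable_fun setT (fun x => \det (A x) : measurableTypeR R).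
Proof.
move=> mA; apply: measurable_sum => s; apply: measurable_funM => //.
by apply: measurable_prod => i _; exact: mA.
Qed.

Lemma measurable_qf n (Q : T -> 'M[R]_n) (v : T -> 'cV[R]_n) :
  measurable_mx Q -> measurable_mx v ->
  measurable_fun setT (fun x => qf (Q x) (v x) : measurableTypeR R).
Proof.
move=> mQ mv; apply: measurable_mxM => //; apply: measurable_mxM => //.
exact: measurable_mx_tr.
Qed.

End MeasurableMatrices.

(** * Linear changes of variables in quadratic forms *)
Section QuadraticIntegral.
Context (R : realType).
Local Notation leb := (@lebesgue_measure R).

Definition colof n (x : coords R 'I_n) : 'cV[R]_n := \col_i icoord x i.

Lemma measurable_colof n : measurable_mx (@colof n).
Proof.
move=> i j; under eq_fun do rewrite mxE.
exact: measurable_icoord.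
Qed.

Definition split0 n (k : 'I_n.+1) : 'I_n + unit :=
  if unlift ord0 k is Some j then inl j else inr tt.
Definition unsplit0 n (k : 'I_n + unit) : 'I_n.+1 :=
  if k is inl j then lift ord0 j else ord0.

Lemma split0K n : cancel (@split0 n) (@unsplit0 n).
Proof. by move=> k; rewrite /split0; case: unliftP. Qed.

Lemma unsplit0K n : cancel (@unsplit0 n) (@split0 n).
Proof. by move=> [j|[]]; rewrite /split0 /= ?liftK ?unlift_none. Qed.

Lemma qf_mx11 (a v : 'M[R]_1) : qf a v = a 0 0 * v 0 0 ^+ 2.
Proof.
by rewrite /qf [a]mx11_scalar [v]mx11_scalar tr_scalar_mx -!scalar_mxM !mxE /=; ring.
Qed.

Local Open Scope ereal_scope.

Lemma radial1 (f : measurableTypeR R -> \bar R) :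
  measurable_fun setT f -> (forall x, 0 <= f x) ->
  radial 1 f = \int[leb]_t f (t ^+ 2)%R.
Proof.
move=> mf f0; rewrite radialS//; apply: eq_integral => t _.
rewrite radial0 ?addr0//; apply: measurableT_comp mf _; exact: measurable_funD.
Qed.

Lemma ge0_integral_square (f : measurableTypeR R -> \bar R) (a g : R) :
  (0 < a)%R -> measurable_fun setT f -> (forall x, 0 <= f x) ->
  \int[leb]_t f (a * (t + g) ^+ 2)%R = ((Num.sqrt a)^-1)%:E * radial 1 f.
Proof.
move=> a0 mf f0; rewrite radial1//.
have sa : (0 < Num.sqrt a)%R by rewrite sqrtr_gt0.
rewrite -(@ge0_integral_affine R _ (Num.sqrt a) (Num.sqrt a * g))//; last first.
  by apply: measurableT_comp mf _; exact: measurable_funX.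
apply: eq_integral => t _; congr f.
by rewrite -mulrDr exprMn sqr_sqrtr// ltW.
Qed.

(** The change of variables taking Q to the identity, done one variable at a time:
    the first variable enters through one square, whose coefficient is the first
    pivot a of Q and whose centre depends affinely on the others, and what remains
    is the Schur complement S, with det Q = a * det S. *)
Lemma ge0_integral_qf n (Q : 'M[R]_n) (c : 'cV[R]_n) (f : measurableTypeR R -> \bar R) :
  posdefmx Q -> measurable_fun setT f -> (forall x, 0 <= f x) ->
  \int[lebesgue_tuple R #|{: 'I_n}|]_x f (qf Q (colof x - c)) =
  ((Num.sqrt (\det Q))^-1)%:E * radial n f.
Proof.
move=> + mf f0.
have mfs w : measurable_fun setT (fun v : measurableTypeR R => f (w + v)%R).
  by apply: measurableT_comp mf _; exact: measurable_funD.
have mqf k (P : 'M[R]_k) b : measurable_fun setT (fun x : coords R 'I_k =>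
    qf P (colof x - b) : measurableTypeR R).
  apply: measurable_qf; first exact: measurable_mx_cst.
  apply: measurable_mxD; [exact: measurable_colof|exact: measurable_mx_cst].
elim: n Q c f mf f0 mfs => [|n IH] Q c f mf f0 mfs pQ.
  rewrite (ge0_integral_coords0 (mkcoords (fun _ _ => 0%R) tt))//.
  - by rewrite det_mx00 sqrtr1 invr1 mul1e radial0// (flatmx0 (colof _ - c)%R) qf0.
  - by case.
  - exact: measurableT_comp mf (mqf _ _ _).
(* View matrices of size n.+1 as block matrices of size 1 + n. *)
move: pQ (mqf _ Q c); change (posdefmx (Q : 'M[R]_(1 + n)) ->
  measurable_fun setT (fun x : coords R 'I_n.+1 =>
     qf (Q : 'M[R]_(1 + n)) (colof x - (c : 'cV_(1 + n))) : measurableTypeR R) ->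
 \int[lebesgue_tuple R #|{: 'I_n.+1}|]_x
    f (qf (Q : 'M[R]_(1 + n)) (colof x - (c : 'cV_(1 + n)))) =
  (((Num.sqrt (\det (Q : 'M[R]_(1 + n))))^-1)%:E * radial n.+1 f)).
move: (Q : 'M[R]_(1 + n)) (c : 'cV_(1 + n)) => {}Q {}c pQ mQ.
set a := ulsubmx Q; set b := ursubmx Q; set D := drsubmx Q.
have QE : Q = block_mx a b b^T D by rewrite -[LHS]submxK trmx_ursub pQ.1.
have pB : posdefmx (block_mx a b b^T D) by rewrite -QE.
have pa := posdef_ulsub pB; have ua := posdef_unit pa.
have sD : D^T = D by rewrite trmx_drsub pQ.1.
have pS : posdefmx (D - b^T *m invmx a *m b) by apply/posdef_schurE.
have da := posdef_det_gt0 pa; have dS := posdef_det_gt0 pS.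
have a0 : (0 < a 0 0)%R by move: da; rewrite {1}[a]mx11_scalar det_scalar1.
rewrite (@ge0_integral_merge _ _ _ _ _ _ _ _ _ _ _ _ (@split0K n) (@unsplit0K n) _ _
   (leb_coords_icoord R 'I_n) (leb_coords_unit R))//; last exact: measurableT_comp mf mQ.
pose S := (D - b^T *m invmx a *m b)%R.
pose h (w : measurableTypeR R) := radial 1 (fun v => f (w + v)%R).
have mh : measurable_fun setT h.
  apply: (@measurable_radial R 1 _ (measurableTypeR R) (fun w v => f (w + v)%R)) => //.
  by apply: measurableT_comp mf _; exact: measurable_funD.
have h0 w : 0 <= h w by exact: radial_ge0.
transitivity (\int[lebesgue_tuple R #|{: 'I_n}|]_x
   (((Num.sqrt (a 0 0))^-1)%:E * h (qf S (colof x - dsubmx c)%R))).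
  apply: eq_integral => x _.
  pose g := ((invmx a *m b *m (colof x - dsubmx c)) 0 0 - c (lshift n 0) 0)%R.
  rewrite -(@ge0_integral_square _ _ g)//.
  apply: eq_integral => t _; congr f.
  have -> : (colof (merge_coords (@split0 n) (fun k (x : coords R 'I_n) => icoord x k)
     (fun _ (x : measurableTypeR R) => x) (x, t)) - c =
     col_mx (t%:M - usubmx c) (colof x - dsubmx c) :> 'cV_(1 + n))%R.
    apply/matrixP => i j; rewrite ord1 {j} -[c in LHS]vsubmxK !mxE icoord_merge.
    rewrite /split0; case: (unliftP ord0 i) => [j|] ->.
      by rewrite (_ : lift ord0 j = rshift 1 j) ?(unsplitK (inr _))/= ?mxE//; exact: val_inj.
    rewrite (_ : ord0 = lshift n (ord0 : 'I_1)) ?(unsplitK (inl _))/= ?mxE//; last exact: val_inj.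
  rewrite QE qf_schur ?pa.1// qf_mx11 addrC; congr (_ + _ * _ ^+ 2)%R.
  by rewrite /g !mxE eqxx mulr1n addrA addrAC.
rewrite ge0_integralZl//; last by
  exact: (measurableT_comp mh (mqf n S (dsubmx c))).
have mhs w : measurable_fun setT (fun v : measurableTypeR R => h (w + v)%R).
  by apply: measurableT_comp mh _; exact: measurable_funD.
rewrite (IH S (dsubmx c) h mh h0 mhs pS) muleA.
have -> : radial n.+1 f = radial n h by rewrite -addn1 radialD.
congr (_ * _); rewrite -EFinM; congr EFin.
rewrite QE det_schur// -/S sqrtrM ?(ltW da)// invfM.
by rewrite [in RHS](mx11_scalar a) det_scalar1.
Qed.
End QuadraticIntegral.

(** * Pivots of bordered matrices *)
Section Bordering.
Context (R : realType) (p : nat).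
Implicit Types A : 'M[R]_p.+1.

Definition corner A : 'M[R]_p := \matrix_(i, j) A (lift ord_max i) (lift ord_max j).
Definition last_col A : 'cV[R]_p := \col_i A (lift ord_max i) ord_max.
Definition last_row A : 'rV[R]_p := \row_j A ord_max (lift ord_max j).
Definition pivot A : R := \det A / \det (corner A).

(** The last row is peeled off, whereas the canonical splitting of n.+1 is 1 + n:
    a cast to size p + 1 is needed to use block matrices. *)
Let eqp : p.+1 = (p + 1)%N := esym (addn1 p).
Definition bordered A : 'M[R]_(p + 1) := castmx (eqp, eqp) A.

Lemma borderedE A : bordered A =
  block_mx (corner A) (last_col A) (last_row A) (A ord_max ord_max)%:M.
Proof.
have castl (i : 'I_p) : cast_ord (esym eqp) (lshift 1 i) = lift ord_max i.
  by apply: val_inj => /=; rewrite /bump leqNgt ltn_ord.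
have castr (i : 'I_1) : cast_ord (esym eqp) (rshift p i) = ord_max.
  by apply: val_inj => /=; rewrite ord1 addn0.
apply/matrixP => i j; rewrite castmxE.
case: (splitP i) => i' ii; case: (splitP j) => j' jj.
- have -> : i = lshift 1 i' by exact: val_inj.
  have -> : j = lshift 1 j' by exact: val_inj.
  by rewrite block_mxEul mxE !castl.
- have -> : i = lshift 1 i' by exact: val_inj.
  have -> : j = rshift p j' by exact: val_inj.
  by rewrite block_mxEur mxE castl castr.
- have -> : i = rshift p i' by exact: val_inj.
  have -> : j = lshift 1 j' by exact: val_inj.
  by rewrite block_mxEdl mxE castl castr.
- have -> : i = rshift p i' by exact: val_inj.
  have -> : j = rshift p j' by exact: val_inj.
  by rewrite block_mxEdr !ord1 !castr !mxE eqxx.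
Qed.

Lemma det_castmx n m (e : n = m) (A : 'M[R]_n) : \det (castmx (e, e) A) = \det A.
Proof. by case: m / e; rewrite castmx_id. Qed.

Lemma posdef_castmx n m (e : n = m) (A : 'M[R]_n) :
  posdefmx (castmx (e, e) A) <-> posdefmx A.
Proof. by case: m / e; rewrite castmx_id. Qed.

Lemma pivotE A : corner A \in unitmx ->
  pivot A = A ord_max ord_max - (last_row A *m invmx (corner A) *m last_col A) 0 0.
Proof.
move=> uA; rewrite /pivot -(det_castmx eqp A) -/(bordered A) borderedE.
rewrite det_schur// det_mx11 mulrC mulKf; last by rewrite -unitfE -unitmxE.
by rewrite !mxE eqxx.
Qed.

(** The pivot is the Schur complement of the corner, a 1 x 1 matrix. *)
Lemma posdef_pivotE A : A^T = A ->
  posdefmx A <-> posdefmx (corner A) /\ 0 < pivot A.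
Proof.
move=> sA.
have rc : last_row A = (last_col A)^T.
  by apply/matrixP => i j; rewrite ord1 !mxE -{1}sA mxE.
rewrite -(posdef_castmx eqp A) -/(bordered A) borderedE rc.
have tS x : (x%:M : 'M[R]_1)^T = x%:M by rewrite tr_scalar_mx.
split=> [pA|[pC p0]].
  have pC := posdef_ulsub pA; have uC := posdef_unit pC; split => //.
  move/(posdef_schurE _ pC uC (tS _)): pA => /posdef_det_gt0.
  by rewrite det_mx11 [in 0 < pivot A]pivotE// rc [X in 0 < X -> _]mxE [in X in X + _]mxE eqxx [X in _ + X]mxE.
have uC := posdef_unit pC.
apply/(posdef_schurE _ pC uC (tS _)); split.
  by rewrite linearB /= tS !trmx_mul trmxK trmx_inv pC.1 mulmxA.
move=> v v0; rewrite -/(qf _ _) qf_mx11 mulr_gt0//.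
  by move: p0; rewrite pivotE// rc !mxE eqxx.
rewrite lt_neqAle sqr_ge0 andbT eq_sym sqrf_eq0.
apply: contra v0 => /eqP v0; apply/eqP/matrixP => i j.
by rewrite !ord1 v0 mxE.
Qed.

End Bordering.

(** * Coordinates on the space of pairs (K, L) *)
Section Coordinates.
Context (R : realType).

(** One index type for all independent entries: the pairs (i, j) with i <= j index
    the entries of M, those with i > j the entries of N, and the last summand the
    entries of L.  In this form peeling off a border is a bijection of index types
    that does not have to move order proofs around.  Vidx indexes the border: the
    last column of M, the last row of L, the last column of N and the corner
    entry. *)
Definition Kidx (p r : nat) : finType := ('I_p * 'I_p + 'I_p * 'I_r)%type.
Definition Vidx (p r : nat) : finType := ('I_p + ('I_r + ('I_p + unit)))%type.

Section Functions.
Context (p r : nat).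
Implicit Types c : Kidx p r -> R.

(** The matrices M, N, L, A = M - L L^T and 1 + M + N at a point with coordinates
    c. *)
Definition fM c : 'M[R]_p :=
  \matrix_(i, j) c (inl (if (i <= j)%N then (i, j) else (j, i))).
Definition fN c : 'M[R]_p :=
  \matrix_(i, j) if (i < j)%N then c (inl (j, i))
                 else if (j < i)%N then - c (inl (i, j)) else 0.
Definition fL c : 'M[R]_(p, r) := \matrix_(i, j) c (inr (i, j)).
Definition fA c := fM c - fL c *m (fL c)^T.
Definition fK c := 1%:M + fM c + fN c.

Lemma fM_sym c : (fM c)^T = fM c.
Proof. by apply/matrixP => i j; rewrite !mxE; case: ltngtP => // /val_inj ->. Qed.

Lemma fN_skew c : (fN c)^T = - fN c.
Proof.
apply/matrixP => i j; rewrite !mxE; case: ltngtP => //; rewrite ?opprK//.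
by rewrite oppr0.
Qed.

Lemma fA_sym c : (fA c)^T = fA c.
Proof. by rewrite /fA linearB /= trmx_mul trmxK fM_sym. Qed.

Lemma fK_det_gt0 c : posdefmx (fA c) -> 0 < \det (fK c).
Proof.
move=> pA; apply: det_skew_perturb_gt0 (fN_skew c).
have pM : posdefmx (fM c).
  by rewrite -[fM c](subrK (fL c *m (fL c)^T)); exact: posdef_addgram.
apply: posdefD; [exact: posdef1|exact: fM_sym|].
by move=> v; exact: posdef_qf_ge0.
Qed.

End Functions.

Definition split_border (p r : nat) (k : Kidx p.+1 r) : Kidx p r + Vidx p r :=
  match k with
  | inl (i, j) =>
    match unlift ord_max i, unlift ord_max j with
    | Some i', Some j' => inl (inl (i', j'))
    | Some i', None => inr (inl i')
    | None, Some j' => inr (inr (inr (inl j')))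
    | None, None => inr (inr (inr (inr tt)))
    end
  | inr (i, l) =>
    match unlift ord_max i with
    | Some i' => inl (inr (i', l))
    | None => inr (inr (inl l))
    end
  end.

Definition join_border (p r : nat) (k : Kidx p r + Vidx p r) : Kidx p.+1 r :=
  match k with
  | inl (inl (i, j)) => inl (lift ord_max i, lift ord_max j)
  | inl (inr (i, l)) => inr (lift ord_max i, l)
  | inr (inl i) => inl (lift ord_max i, ord_max)
  | inr (inr (inl l)) => inr (ord_max, l)
  | inr (inr (inr (inl j))) => inl (ord_max, lift ord_max j)
  | inr (inr (inr (inr _))) => inl (ord_max, ord_max)
  end.

Lemma split_borderK p r : cancel (@split_border p r) (@join_border p r).
Proof.
by move=> [[i j]|[i l]] /=; case: unliftP => [i'|] ->; try case: unliftP => [j'|] ->.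
Qed.

Lemma join_borderK p r : cancel (@join_border p r) (@split_border p r).
Proof.
by move=> [[[i j]|[i l]]|[i|[l|[j|[]]]]] /=; rewrite ?liftK ?unlift_none.
Qed.

(** At a bordered point, c0 collects the coordinates of the remaining blocks, and
    m, n, l, t are the border. *)
Section Border.
Context (p r : nat) (c : Kidx p.+1 r -> R).
Let c0 (k : Kidx p r) : R := c (join_border (inl k)).
Let m : 'cV[R]_p := \col_i c (join_border (inr (inl i))).
Let n : 'cV[R]_p := \col_i c (join_border (inr (inr (inr (inl i))))).
Let l : 'cV[R]_r := \col_i c (join_border (inr (inr (inl i)))).
Let t : R := c (join_border (inr (inr (inr (inr tt))))).

Lemma corner_fA : corner (fA c) = fA c0.
Proof.
apply/matrixP => i j; rewrite !mxE !lift_max; congr (_ - _).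
  by rewrite /c0; case: ifP.
by apply: eq_bigr => k _; rewrite !mxE.
Qed.

Lemma corner_fK : corner (fK c) = fK c0.
Proof.
apply/matrixP => i j; rewrite !mxE !lift_max /c0.
rewrite (inj_eq lift_inj); congr (_ + _ + _); by case: ifP.
Qed.

Let maxF (i : 'I_p) : (p < i)%N = false.
Proof. by apply/negbTE; rewrite -leqNgt ltnW. Qed.
Let maxF' (i : 'I_p) : (p <= i)%N = false.
Proof. by apply/negbTE; rewrite -ltnNge. Qed.

Lemma pivot_fA : posdefmx (fA c0) ->
  pivot (fA c) = t - (qf 1%:M l + qf (invmx (fA c0)) (m - fL c0 *m l)).
Proof.
move=> pA; rewrite pivotE corner_fA ?posdef_unit//.
have ec : last_col (fA c) = m - fL c0 *m l.
  apply/matrixP => i j; rewrite !mxE lift_max /= ltnW//; congr (_ - _).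
  by apply: eq_bigr => k _; rewrite !mxE.
have -> : last_row (fA c) = (m - fL c0 *m l)^T.
  by rewrite -ec -{1}(fA_sym c); apply/matrixP => i j; rewrite ord1 !mxE.
rewrite ec opprD addrA /qf; congr (_ - _).
rewrite !mxE leqnn mulmx1; congr (_ - _).
by apply: eq_bigr => k _; rewrite !mxE.
Qed.

Lemma pivot_fK : posdefmx (fA c0) ->
  pivot (fK c) = 1 + t - ((m - n)^T *m invmx (fK c0) *m (m + n)) 0 0.
Proof.
move=> pA; have dK := fK_det_gt0 pA.
rewrite pivotE corner_fK; last by rewrite unitmxE unitfE gt_eqF.
have -> : last_col (fK c) = m + n.
  apply/matrixP => i j; rewrite !mxE lift_max /= ltn_ord ltnW//.
  by rewrite eq_sym (negbTE (neq_lift _ _)) add0r.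
have -> : last_row (fK c) = (m - n)^T.
  apply/matrixP => i j; rewrite !mxE lift_max /= maxF maxF' ltn_ord.
  by rewrite (negbTE (neq_lift _ _)) add0r.
by rewrite !mxE eqxx leqnn ltnn addr0.
Qed.

End Border.
End Coordinates.

(** * Peeling off a border *)
Section MeasurableCoordinates.
Context (R : realType).

Lemma measurable_invr : measurable_fun setT (fun x : measurableTypeR R => x^-1 : measurableTypeR R).
Proof.
rewrite (_ : (fun x => _) = fun x : measurableTypeR R =>
    if 0 < x then powR x (- 1) else if x < 0 then - powR (- x) (- 1) else 0).
  apply: measurable_fun_ifT.
  - exact: measurable_fun_ltr.
  - exact: measurable_powR.
  - apply: measurable_fun_ifT => //.
      exact: measurable_fun_ltr.
    apply: (measurableT_comp (@oppr_measurable R setT)).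
    apply: (@measurableT_comp _ _ _ _ _ _ (fun x : measurableTypeR R => x `^ (-1))
      _ (fun x : measurableTypeR R => - x)); first exact: measurable_powR.
    exact: oppr_measurable.
apply/funext => x; case: ltgtP => [x0|x0|<-]; last by rewrite invr0.
- by rewrite powR_inv1 ?ltW.
- by rewrite powR_inv1 ?invrN ?opprK// oppr_ge0 ltW.
Qed.

Section Family.
Context (d : measure_display) (T : measurableType d) (p r : nat).
Variable c : Kidx p r -> T -> measurableTypeR R.
Hypothesis mc : forall k, measurable_fun setT (c k).

Lemma measurable_fM : measurable_mx (fun x => fM (c^~ x)).
Proof.
move=> i j; under eq_fun do rewrite mxE.
exact: (mc (inl (if (i <= j)%N then (i, j) else (j, i)))).
Qed.

Lemma measurable_fN : measurable_mx (fun x => fN (c^~ x)).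
Proof.
move=> i j; under eq_fun do rewrite mxE.
case: (i < j)%N; first exact: (mc (inl (j, i))).
case: (j < i)%N; last exact: measurable_cst.
exact: (measurableT_comp (@oppr_measurable R setT) (mc (inl (i, j)))).
Qed.

Lemma measurable_fL : measurable_mx (fun x => fL (c^~ x)).
Proof.
move=> i j; under eq_fun do rewrite mxE.
exact: (mc (inr (i, j))).
Qed.

Lemma measurable_fA : measurable_mx (fun x => fA (c^~ x)).
Proof.
apply: measurable_mxD; first exact: measurable_fM.
apply: measurable_mxN; apply: measurable_mxM; first exact: measurable_fL.
by apply: measurable_mx_tr; exact: measurable_fL.
Qed.

Lemma measurable_fK : measurable_mx (fun x => fK (c^~ x)).
Proof.
apply: measurable_mxD; last exact: measurable_fN.
apply: measurable_mxD; [exact: measurable_mx_cst|exact: measurable_fM].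
Qed.

End Family.

Lemma measurable_pivot (d : measure_display) (T : measurableType d) p (A : T -> 'M[R]_p.+1) :
  measurable_mx A -> measurable_fun setT (fun x => pivot (A x) : measurableTypeR R).
Proof.
move=> mA; apply: measurable_funM; first exact: measurable_det.
apply: measurableT_comp measurable_invr _; apply: measurable_det => i j.
under eq_fun do rewrite mxE.
exact: mA.
Qed.

(** Forgetting the border. *)
Definition trunc p r (x : coords R (Kidx p.+1 r)) : coords R (Kidx p r) :=
  mkcoords (fun k (y : coords R (Kidx p.+1 r)) => icoord y (join_border (inl k))) x.

Lemma measurable_trunc p r : measurable_fun setT (@trunc p r).
Proof. apply: measurable_mkcoords => k; exact: measurable_icoord. Qed.

Lemma icoord_trunc p r (x : coords R (Kidx p.+1 r)) :
  icoord (trunc x) = fun k => icoord x (join_border (inl k)).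
Proof. by apply/funext => k; rewrite icoord_mkcoords. Qed.

(** The domain of integration in flat coordinates. *)
Definition PD p r : set (coords R (Kidx p r)) := [set x | posdefmx (fA (icoord x))].

Lemma PDE p r (x : coords R (Kidx p.+1 r)) :
  (x \in @PD p.+1 r) = (trunc x \in @PD p r) && (0 < pivot (fA (icoord x))).
Proof.
apply/idP/andP; rewrite !inE /PD /=.
  by move=> /(posdef_pivotE (fA_sym _))[]; rewrite corner_fA -icoord_trunc.
move=> [pt p0]; apply/(posdef_pivotE (fA_sym _)); split => //.
by rewrite corner_fA -icoord_trunc.
Qed.

Lemma measurable_PD p r : measurable (@PD p r).
Proof.
elim: p => [|p IH].
  rewrite (_ : @PD 0 r = setT)//; apply/seteqP; split => // x _.
  split; first exact: fA_sym.
  by move=> v; rewrite flatmx0 eqxx.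
rewrite (_ : @PD p.+1 r = (@trunc p r) @^-1` (@PD p r) `&`
    (fun x => pivot (fA (icoord x))) @^-1` `]0, +oo[%classic); last first.
  apply/seteqP; split => x.
    move=> /mem_set; rewrite PDE => /andP[/set_mem h p0]; split => //=.
    by rewrite in_itv/= p0.
  move=> [h] /=; rewrite in_itv/= andbT => p0; apply: set_mem.
  by rewrite PDE p0 andbT; exact: mem_set.
apply: measurableI; rewrite -[X in measurable X]setTI.
  exact: (measurable_trunc measurableT IH).
apply: (measurable_pivot (A := fun x => fA (icoord x)) _ measurableT) => //.
apply: measurable_fA => k; exact: measurable_icoord.
Qed.

(** The coordinate function, with its codomain as a measurable type. *)
Definition ic (I : finType) (k : I) (x : coords R I) : measurableTypeR R := icoord x k.

(** Inverse to forgetting the border: the point with remaining blocks x0, last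
    column m of M, last row l of L, last column n of N and corner entry t. *)
Definition assemble p r (x0 : coords R (Kidx p r)) (m : coords R 'I_p)
    (l : coords R 'I_r) (n : coords R 'I_p) (t : measurableTypeR R) :
    coords R (Kidx p.+1 r) :=
  merge_coords (@split_border p r) (@ic _) (@ic _) (x0,
    merge_coords id (@ic _) (@ic _) (m,
      merge_coords id (@ic _) (@ic _) (l,
        merge_coords id (@ic _) (fun (_ : unit) (t : measurableTypeR R) => t) (n, t)))).

Lemma icoord_assemble p r x0 m l n t (k : Kidx p r + Vidx p r) :
  icoord (assemble x0 m l n t) (join_border k) =
  match k with
  | inl k => icoord x0 k | inr (inl i) => icoord m i
  | inr (inr (inl i)) => icoord l i
  | inr (inr (inr (inl i))) => icoord n i
  | inr (inr (inr (inr _))) => t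
  end.
Proof.
rewrite /assemble icoord_merge join_borderK.
case: k => [//|k]; rewrite [LHS]icoord_merge; case: k => [//|k].
rewrite [LHS]icoord_merge; case: k => [//|k].
by rewrite [LHS]icoord_merge; case: k.
Qed.

Lemma trunc_assemble p r x0 m l n t : trunc (@assemble p r x0 m l n t) = x0.
Proof.
apply: eq_from_tnth => i; rewrite tnth_mktuple icoord_assemble.
by rewrite /icoord enum_valK.
Qed.

Local Open Scope ereal_scope.
Local Notation leb := (@lebesgue_measure R).
Local Notation lebI I := (lebesgue_tuple R #|{: I}|).

Lemma ge0_integral_assemble p r (F : coords R (Kidx p.+1 r) -> \bar R) :
  measurable_fun [set: coords R (Kidx p.+1 r)] F -> (forall x, 0 <= F x) ->
  \int[lebI (Kidx p.+1 r)]_x F x =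
  \int[lebI (Kidx p r)]_x0 \int[lebI 'I_p]_m \int[lebI 'I_r]_l
    \int[lebI 'I_p]_n \int[leb]_t F (assemble x0 m l n t).
Proof.
move=> mF F0.
have lc I := leb_coords_icoord R I.
have lu := leb_coords_unit R.
have sect (d d' d'' : measure_display) (S : measurableType d) (S' : measurableType d')
   (S'' : measurableType d'') (G : S'' -> \bar R) (f : S * S' -> S'') (x : S) :
   measurable_fun setT G -> measurable_fun setT f ->
   measurable_fun setT (fun y => G (f (x, y))).
  move=> mG mf; apply: measurableT_comp mG _; exact: measurableT_comp mf _.
rewrite (ge0_integral_merge (@split_borderK p r) (@join_borderK p r) (lc _) (lc _))//.
apply: eq_integral => x0 _.
have idK (T : Type) : cancel (@id T) id by [].
have mF1 := sect _ _ _ _ _ _ _ _ x0 mF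
  (measurable_merge (@split_border p r) (lc (Kidx p r)) (lc (Vidx p r))).
rewrite (ge0_integral_merge (idK _) (idK _) (lc _) (lc _))//.
apply: eq_integral => m _.
have mF2 := sect _ _ _ _ _ _ _ _ m mF1
  (measurable_merge id (lc 'I_p) (lc ('I_r + ('I_p + unit))%type)).
rewrite (ge0_integral_merge (idK _) (idK _) (lc _) (lc _))//.
apply: eq_integral => l _.
have mF3 := sect _ _ _ _ _ _ _ _ l mF2
  (measurable_merge id (lc 'I_r) (lc ('I_p + unit)%type)).
by rewrite (ge0_integral_merge (idK _) (idK _) (lc _) lu).
Qed.

End MeasurableCoordinates.

(** * Integration over the border *)
Section BorderedIntegral.
Context (R : realType).
Local Open Scope ereal_scope.
Local Notation leb := (@lebesgue_measure R).
Local Notation lebI I := (lebesgue_tuple R #|{: I}|).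
Local Notation mR := (measurableTypeR R).

Definition pos_head n : set (n.+1.-tuple mR) := [set z | (0 < thead z)%R].

Lemma measurable_thead n : measurable_fun setT (fun z : n.+1.-tuple mR => thead z : mR).
Proof. exact: (measurable_tnth ord0). Qed.

Lemma measurable_pos_head n : measurable (@pos_head n).
Proof.
rewrite (_ : @pos_head n = (fun z => thead z) @^-1` `]0%R, +oo[%classic).
  by rewrite -[X in measurable X]setTI; exact: measurable_thead.
by apply/seteqP; split => z /=; rewrite /pos_head in_itv/= andbT.
Qed.

Lemma measurable_behead_sumsq n :
  measurable_fun setT (fun z : n.+1.-tuple mR => sumsq [tuple of behead z] : mR).
Proof. exact: measurableT_comp (@measurable_sumsq R n) (@measurable_behead _ mR n). Qed.

(** Radial integrals as functions of the argument shift, so that the integrals over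
    n, l and m can be taken one after the other. *)
Definition radial_shift n (f : mR -> \bar R) (w : mR) : \bar R :=
  radial n (fun v => f (v + w)%R).

Lemma measurable_shift (f : mR -> \bar R) (w : mR) :
  measurable_fun setT f -> measurable_fun setT (fun v : mR => f (v + w)%R).
Proof. by move=> mf; apply: measurableT_comp mf _; exact: measurable_funD. Qed.

Lemma measurable_radial_shift n f :
  measurable_fun setT f -> (forall x, 0 <= f x) ->
  measurable_fun setT (radial_shift n f).
Proof.
move=> mf f0; apply: (@measurable_radial R n _ mR (fun w v => f (v + w)%R)).
  apply: measurableT_comp mf _; exact: measurable_funD.
by move=> w v.
Qed.

Lemma radial_shift_ge0 n f w : (forall x, 0 <= f x) -> 0 <= radial_shift n f w.
Proof. by move=> f0; exact: radial_ge0. Qed.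

Lemma ge0_integral_qf_shift n (Q : 'M[R]_n) (c : 'cV[R]_n) (f : mR -> \bar R) (w : mR) :
  posdefmx Q -> measurable_fun setT f -> (forall x, 0 <= f x) ->
  \int[lebI 'I_n]_x f (qf Q (colof x - c) + w)%R =
  ((Num.sqrt (\det Q))^-1)%:E * radial_shift n f w.
Proof.
move=> pQ mf f0.
exact: (@ge0_integral_qf R n Q c (fun v => f (v + w)%R) pQ (measurable_shift w mf)).
Qed.

Lemma ge0_integral_qf_param n (d : measure_display) (T : measurableType d)
    (mu : {measure set T -> \bar R}) (Q : 'M[R]_n) (c : T -> 'cV[R]_n)
    (f : mR -> \bar R) (w : T -> mR) :
  posdefmx Q -> measurable_fun setT f -> (forall x, 0 <= f x) ->
  measurable_fun setT w ->
  \int[mu]_y \int[lebI 'I_n]_x f (qf Q (colof x - c y) + w y)%R =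
  ((Num.sqrt (\det Q))^-1)%:E * \int[mu]_y radial_shift n f (w y).
Proof.
move=> pQ mf f0 mw.
have mg := measurableT_comp (measurable_radial_shift n mf f0) mw.
have g0 (y : T) : setT y -> 0 <= radial_shift n f (w y).
  by move=> _; exact: radial_shift_ge0.
have k0 : (0 <= (Num.sqrt (\det Q))^-1)%R by rewrite invr_ge0 sqrtr_ge0.
rewrite -(ge0_integralZl _ measurableT mg g0); last by rewrite lee_fin.
apply: eq_integral => y _; exact: ge0_integral_qf_shift.
Qed.

Lemma measurable_qf_colof n (Q : 'M[R]_n) (b : 'cV[R]_n) :
  measurable_fun setT (fun x : coords R 'I_n => qf Q (colof x - b)%R : mR).
Proof.
apply: measurable_qf; first exact: measurable_mx_cst.
apply: measurable_mxD; [exact: measurable_colof|exact: measurable_mx_cst].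
Qed.

Lemma radial_shiftD m n f : measurable_fun setT f -> (forall x, 0 <= f x) ->
  radial m (radial_shift n f) = radial (m + n) f.
Proof.
move=> mf f0; rewrite (@radialD R m n f mf f0); congr (radial m _); apply/funext => u.
by congr (radial n _); apply/funext => v; rewrite addrC.
Qed.

(** The centres of the squares in n and l depend on m only: for fixed m the
    integrals over n and then l do not see them, by translation invariance. *)
Lemma ge0_integral_three_qf p r (S H : 'M[R]_p) (P : 'M[R]_r)
    (c1 : 'cV[R]_p -> 'cV[R]_p) (c2 : 'cV[R]_p -> 'cV[R]_r) (f : mR -> \bar R) :
  posdefmx S -> posdefmx P -> posdefmx H ->
  measurable_fun setT f -> (forall x, 0 <= f x) ->
  \int[lebI 'I_p]_m \int[lebI 'I_r]_l \int[lebI 'I_p]_n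
    f (qf S (colof n - c1 (colof m)) +
       (qf P (colof l - c2 (colof m)) + qf H (colof m - 0)))%R =
  ((Num.sqrt (\det S * \det P * \det H))^-1)%:E * radial (p + (r + p)) f.
Proof.
move=> pS pP pH mf f0.
have mf1 := measurable_radial_shift p mf f0.
have f10 w := radial_shift_ge0 p w f0.
have mf2 := measurable_radial_shift r mf1 f10.
have f20 w := radial_shift_ge0 r w f10.
have mH := measurable_qf_colof H 0.
have dge0 k (Q : 'M[R]_k) : 0 <= ((Num.sqrt (\det Q))^-1)%:E.
  by rewrite lee_fin invr_ge0 sqrtr_ge0.
pose g := radial_shift r (radial_shift p f).
have mg : measurable_fun setT (fun m : coords R 'I_p => g (qf H (colof m - 0)%R)).
  exact: (measurableT_comp mf2 mH).
transitivity (\int[lebI 'I_p]_m (((Num.sqrt (\det S))^-1)%:E *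
    (((Num.sqrt (\det P))^-1)%:E * g (qf H (colof m - 0)%R)))).
  apply: eq_integral => m _.
  rewrite (@ge0_integral_qf_param p _ _ _ S (fun=> c1 (colof m)) f _ pS mf f0); last first.
    apply: measurable_funD; [exact: measurable_qf_colof|exact: measurable_cst].
  congr (_ * _).
  exact: (ge0_integral_qf_shift (c2 (colof m)) _ pP mf1 f10).
rewrite ge0_integralZl; [|exact: measurableT|exact: measurable_funeM|..]; last 2 first.
- by move=> x _; apply: mule_ge0; [exact: dge0|exact: f20].
- exact: dge0.
rewrite ge0_integralZl; [|exact: measurableT|exact: mg|by move=> x _; exact: f20|exact: dge0].
rewrite (ge0_integral_qf 0 pH mf2 f20) (radial_shiftD p r mf1 f10).
rewrite (radial_shiftD (p + r) p mf f0) -addnA !muleA -!EFinM.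
congr (_%:E * _).
have dS0 := ltW (posdef_det_gt0 pS); have dP0 := ltW (posdef_det_gt0 pP).
by rewrite -!invfM -!sqrtrM ?mulr_ge0.
Qed.

Section PositiveShift.
Variable psi : mR -> mR -> \bar R.
Hypothesis mpsi : measurable_fun setT (fun z : mR * mR => psi z.1 z.2).
Hypothesis psi0 : forall s t, 0 <= psi s t.

(** The integrand after the translation that makes the last pivot s of A a
    variable, at the value u of the quadratic form Q. *)
Definition shifted (u s : mR) : \bar R := if (0 < s)%R then psi s (1 + s + u)%R else 0.

Lemma shifted_ge0 u s : 0 <= shifted u s.
Proof. by rewrite /shifted; case: ifP. Qed.

Lemma measurable_shifted : measurable_fun setT (fun z : mR * mR => shifted z.1 z.2).
Proof.
apply: measurable_fun_ifT.
- exact: (measurable_fun_ltr (measurable_cst _) measurable_snd).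
- apply: (measurableT_comp mpsi (g := fun z : mR * mR => (z.2, 1 + z.2 + z.1 : mR)%R)).
  apply: measurable_fun_pair => //; apply: measurable_funD => //.
  by apply: measurable_funD.
- exact: measurable_cst.
Qed.

Definition shift_integral (u : mR) : \bar R := \int[leb]_s shifted u s.

Lemma measurable_shift_integral : measurable_fun setT shift_integral.
Proof.
apply: (measurable_fun_fubini_tonelli_F (fun z : mR * mR => shifted z.1 z.2)).
- exact: measurable_shifted.
- by move=> z; exact: shifted_ge0.
Qed.

Lemma shift_integral_ge0 u : 0 <= shift_integral u.
Proof. by apply: integral_ge0 => s _; exact: shifted_ge0. Qed.

Lemma radial_shift_integral n : radial n shift_integral =
  \int[lebesgue_tuple R n.+1]_(z in @pos_head n)
    psi (thead z) (1 + thead z + sumsq [tuple of behead z])%R.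
Proof.
rewrite integral_mkcond /patch.
transitivity (\int[lebesgue_tuple R n.+1]_z shifted (sumsq [tuple of behead z]) (thead z)).
  rewrite ge0_integral_lebesgue_cons; last 2 first.
  - apply: (measurableT_comp measurable_shifted
      (g := fun z : n.+1.-tuple mR => (sumsq [tuple of behead z] : mR, thead z : mR))).
    by apply: measurable_fun_pair; [exact: measurable_behead_sumsq|exact: measurable_thead].
  - by move=> z; exact: shifted_ge0.
  rewrite /radial /shift_integral.
  rewrite (@fubini_tonelli _ _ _ _ _ (lebesgue_tuple R n) leb
    (fun z : n.-tuple mR * mR => shifted (sumsq z.1) z.2)) => [||z]; last 2 first.
  - apply: (measurableT_comp measurable_shifted
      (g := fun z : n.-tuple mR * mR => (sumsq z.1 : mR, z.2))).
    apply: measurable_fun_pair => //.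
    exact: measurableT_comp (@measurable_sumsq R n) measurable_fst.
  - exact: shifted_ge0.
  apply: eq_integral => t _; apply: eq_integral => y _.
  by congr (shifted (sumsq _) _); exact: val_inj.
apply: eq_integral => z _.
rewrite /shifted; case: ifPn => [z0|z0]; first by rewrite mem_set.
by rewrite memNset//; exact/negP.
Qed.

(** Substitute s for t, then normalise the quadratic form Q, whose determinant
    gives the factor in front. *)
Lemma ge0_integral_bordered p r (M N : 'M[R]_p) (L : 'M[R]_(p, r)) :
  M^T = M -> N^T = (- N)%R -> posdefmx (M - L *m L^T)%R ->
  (0 < \det (1%:M + M + N))%R ->
  \int[lebI 'I_p]_m \int[lebI 'I_r]_l \int[lebI 'I_p]_n \int[leb]_t
    (let s := (t - (qf 1%:M (colof l)
                 + qf (invmx (M - L *m L^T)) (colof m - L *m colof l)))%R in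
     if (0 < s)%R then psi s (1 + t - ((colof m - colof n)^T *m
           invmx (1%:M + M + N) *m (colof m + colof n)) 0 0)%R else 0) =
  (Num.sqrt (\det (M - L *m L^T)) * \det (1%:M + M + N))%:E *
  \int[lebesgue_tuple R (p + (r + p)).+1]_(z in @pos_head (p + (r + p)))
     psi (thead z) (1 + thead z + sumsq [tuple of behead z])%R.
Proof.
move=> sM sN pA dK.
have [S [P [H [c1 [c2 [pS pP pH dets form]]]]]] := bordered_form pA sN.
have mshift := measurable_shift_integral.
have shift0 := shift_integral_ge0.
rewrite -radial_shift_integral.
transitivity (\int[lebI 'I_p]_m \int[lebI 'I_r]_l \int[lebI 'I_p]_n
   shift_integral (qf S (colof n - c1 (colof m)) +
     (qf P (colof l - c2 (colof m)) + qf H (colof m - 0)))%R).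
  apply: eq_integral => m _; apply: eq_integral => l _; apply: eq_integral => n _.
  rewrite subr0 addrA -form /shift_integral.
  set c := (qf 1%:M _ + _)%R; set w := (((_ - _)^T *m _ *m _) 0 0)%R.
  rewrite -[RHS]mul1e -[in RHS](@invr1 R) -(@ge0_integral_affine R _ 1 (- c)%R)//; last 2 first.
  - exact: measurableT_comp measurable_shifted (measurable_pair1 _).
  - by move=> s; exact: shifted_ge0.
  apply: eq_integral => t _; rewrite mul1r /shifted.
  by case: ifP => // _; congr psi; lra.
rewrite (ge0_integral_three_qf c1 c2 pS pP pH mshift shift0); congr (_%:E * _).
rewrite dets sqrtrV; last first.
  by rewrite ltW// mulr_gt0 ?exprn_gt0// posdef_det_gt0.
rewrite invrK sqrtrM ?(ltW (posdef_det_gt0 pA))//.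
by rewrite sqrtr_sqr gtr0_norm.
Qed.

End PositiveShift.
End BorderedIntegral.

(** * The recursion for nonnegative functions of the last pivots *)
Section Step.
Context (R : realType).
Local Open Scope ereal_scope.
Local Notation leb := (@lebesgue_measure R).
Local Notation lebI I := (lebesgue_tuple R #|{: I}|).
Local Notation mR := (measurableTypeR R).

Definition pivA p r (x : coords R (Kidx p.+1 r)) : mR := pivot (fA (icoord x)).
Definition pivK p r (x : coords R (Kidx p.+1 r)) : mR := pivot (fK (icoord x)).
Definition weight p r (x : coords R (Kidx p r)) : mR :=
  (Num.sqrt (\det (fA (icoord x))) * \det (fK (icoord x)))%R.

Lemma measurable_pivA p r : measurable_fun setT (@pivA p r).
Proof.
apply: (measurable_pivot (A := fun x => fA (icoord x))).
apply: measurable_fA => k; exact: measurable_icoord.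
Qed.

Lemma measurable_pivK p r : measurable_fun setT (@pivK p r).
Proof.
apply: (measurable_pivot (A := fun x => fK (icoord x))).
apply: measurable_fK => k; exact: measurable_icoord.
Qed.

(** The integral over the border at fixed remaining blocks x, applied to a function
    that may depend on x: this is what makes the induction on p possible. *)
Lemma ge0_integral_step p r (Psi : coords R (Kidx p r) -> mR -> mR -> \bar R) :
  measurable_fun setT (fun z : coords R (Kidx p r) * (mR * mR) => Psi z.1 z.2.1 z.2.2) ->
  (forall x s t, 0 <= Psi x s t) ->
  \int[lebI (Kidx p.+1 r)]_(x in @PD R p.+1 r) Psi (trunc x) (pivA x) (pivK x) =
  \int[lebI (Kidx p r)]_(x in @PD R p r) ((weight x)%:E *
    \int[lebesgue_tuple R (p + (r + p)).+1]_(z in @pos_head R (p + (r + p)))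
      Psi x (thead z) (1 + thead z + sumsq [tuple of behead z])%R).
Proof.
move=> mPsi Psi0; rewrite integral_mkcond [RHS]integral_mkcond.
rewrite ge0_integral_assemble; last 2 first.
- apply/(measurable_restrictT _ (@measurable_PD R p.+1 r)); apply: measurable_funTS.
  apply: (measurableT_comp mPsi (g := fun x => (trunc x, (pivA x, pivK x)))).
  apply: measurable_fun_pair; first exact: measurable_trunc.
  by apply: measurable_fun_pair; [exact: measurable_pivA|exact: measurable_pivK].
- by move=> x; rewrite /patch; case: ifP.
apply: eq_integral => x0 _; rewrite /patch.
case: ifPn => x0PD; last first.
  rewrite (eq_integral (fun=> 0)) ?integral0// => m _.
  rewrite (eq_integral (fun=> 0)) ?integral0// => l _.
  rewrite (eq_integral (fun=> 0)) ?integral0// => n _.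
  rewrite (eq_integral (fun=> 0)) ?integral0// => t _.
  by rewrite PDE trunc_assemble (negbTE x0PD).
have pA : posdefmx (fA (icoord x0)) by move: x0PD; rewrite inE.
have mPx : measurable_fun setT (fun z : mR * mR => Psi x0 z.1 z.2).
  apply: (measurableT_comp mPsi (g := fun z : mR * mR => (x0, z))).
  exact: measurable_pair1.
have B := ge0_integral_bordered mPx (Psi0 x0) (fM_sym (icoord x0))
  (fN_skew (icoord x0)) pA (fK_det_gt0 pA).
rewrite /weight /fA /fK -B {B}.
apply: eq_integral => m _; apply: eq_integral => l _.
apply: eq_integral => n _; apply: eq_integral => t _.
have ec : (fun k => icoord (assemble x0 m l n t) (join_border (inl k))) = icoord x0.
  by apply/funext => k; rewrite icoord_assemble.
have em : \col_i icoord (assemble x0 m l n t) (join_border (inr (inl i))) = colof m.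
  by apply/matrixP => i j; rewrite !mxE icoord_assemble.
have el : \col_i icoord (assemble x0 m l n t) (join_border (inr (inr (inl i)))) = colof l.
  by apply/matrixP => i j; rewrite !mxE icoord_assemble.
have en : \col_i icoord (assemble x0 m l n t) (join_border (inr (inr (inr (inl i))))) = colof n.
  by apply/matrixP => i j; rewrite !mxE icoord_assemble.
have eA := @pivot_fA R p r (icoord (assemble x0 m l n t)).
have eK := @pivot_fK R p r (icoord (assemble x0 m l n t)).
rewrite ec em el icoord_assemble in eA; rewrite ec em en icoord_assemble in eK.
by rewrite PDE trunc_assemble x0PD /= /pivA /pivK (eA pA) (eK pA).
Qed.

End Step.

(** * Integrals of complex-valued functions *)
Section ComplexIntegral.
Context (R : realType).
Local Notation C := R[i].
Local Notation mR := (measurableTypeR R).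
Local Notation Re := (@complex.Re R).
Local Notation Im := (@complex.Im R).

Definition cnorm (z : C) : R := ComplexField.Normc.normc z.

Lemma cnormM (z w : C) : cnorm (z * w) = cnorm z * cnorm w.
Proof. exact: ComplexField.Normc.normcM. Qed.

Lemma cnorm_ge0 (z : C) : 0 <= cnorm z.
Proof. by case: z => a b; exact: sqrtr_ge0. Qed.

Lemma cnorm_real (x : R) : cnorm x%:C = `|x|.
Proof. by rewrite /cnorm /= expr0n /= addr0 sqrtr_sqr. Qed.

Lemma Re_le_cnorm (z : C) : `|Re z| <= cnorm z.
Proof.
case: z => a b; rewrite /cnorm /= -sqrtr_sqr ler_wsqrtr// lerDl; exact: sqr_ge0.
Qed.

Lemma Im_le_cnorm (z : C) : `|Im z| <= cnorm z.
Proof.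
case: z => a b; rewrite /cnorm /= -[leLHS]sqrtr_sqr ler_wsqrtr// lerDr; exact: sqr_ge0.
Qed.

Lemma cnorm_le_ReIm (z : C) : cnorm z <= `|Re z| + `|Im z|.
Proof.
case: z => a b; rewrite /cnorm /=.
rewrite -[leRHS]ger0_norm ?addr_ge0// -sqrtr_sqr ler_wsqrtr//.
rewrite sqrrD !real_normK ?num_real// [leRHS]addrAC lerDl.
by rewrite mulrn_wge0// mulr_ge0.
Qed.

Lemma cReM (z w : C) : Re (z * w) = Re z * Re w - Im z * Im w.
Proof. by case: z; case: w. Qed.

Lemma cImM (z w : C) : Im (z * w) = Re z * Im w + Im z * Re w.
Proof. by case: z; case: w. Qed.

Lemma eq_complexP (z w : C) : Re z = Re w -> Im z = Im w -> z = w.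
Proof. by case: z w => a b [c e] /= -> ->. Qed.

Definition cmeasurable (d : measure_display) (T : measurableType d) (f : T -> C) :=
  measurable_fun setT (fun x => Re (f x) : mR) /\
  measurable_fun setT (fun x => Im (f x) : mR).

Section Measurability.
Context (d : measure_display) (T : measurableType d).
Implicit Types f g : T -> C.

Lemma cmeasurable_cst (z : C) : cmeasurable (fun _ : T => z).
Proof. by split; exact: measurable_cst. Qed.

Lemma cmeasurable_real (f : T -> mR) :
  measurable_fun setT f -> cmeasurable (fun x => (f x)%:C).
Proof. by move=> mf; split => //=; exact: measurable_cst. Qed.

Lemma cmeasurableM f g : cmeasurable f -> cmeasurable g ->
  cmeasurable (fun x => f x * g x).
Proof.
move=> [f1 f2] [g1 g2]; split.
  under eq_fun do rewrite cReM.
  by apply: measurable_funB; exact: measurable_funM.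
under eq_fun do rewrite cImM.
by apply: measurable_funD; exact: measurable_funM.
Qed.

Lemma measurable_cnorm f : cmeasurable f -> measurable_fun setT (fun x => cnorm (f x) : mR).
Proof.
move=> [f1 f2]; rewrite (_ : (fun x => _) = fun x => Num.sqrt (Re (f x) ^+ 2 + Im (f x) ^+ 2)).
  apply: (measurableT_comp (f := Num.sqrt : mR -> mR)).
    exact: continuous_measurable_fun (@sqrt_continuous R).
  by apply: measurable_funD; exact: measurable_funX.
by apply/funext => x; rewrite /cnorm; case: (f x).
Qed.

Lemma cmeasurable_comp (d' : measure_display) (T' : measurableType d')
    (f : T -> C) (h : T' -> T) :
  cmeasurable f -> measurable_fun setT h -> cmeasurable (f \o h).
Proof.
by move=> [f1 f2] mh; split; [exact: measurableT_comp f1 mh|exact: measurableT_comp f2 mh].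
Qed.

End Measurability.

Section Basic.
Context (d : measure_display) (T : measurableType d) (mu : {measure set T -> \bar R}).
Implicit Types f g : T -> C.

Lemma cintegrable_cmeasurable f : cintegrable mu setT f -> cmeasurable f.
Proof.
by move=> [/measurable_int/measurable_EFinP f1 /measurable_int/measurable_EFinP f2].
Qed.

(** Integrability through the modulus, which is multiplicative; real and imaginary
    parts are not. *)
Lemma cintegrableP f : cintegrable mu setT f <->
  cmeasurable f /\ (\int[mu]_x (cnorm (f x))%:E < +oo)%E.
Proof.
split=> [if_|[[f1 f2] foo]].
  have mf := cintegrable_cmeasurable if_; split => //.
  have [/integrableP[_ i1] /integrableP[_ i2]] := if_.
  apply: (@le_lt_trans _ _ (\int[mu]_x (`|(Re (f x))%:E| + `|(Im (f x))%:E|))%E).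
    apply: ge0_le_integral => //.
    - by move=> x _; rewrite lee_fin cnorm_ge0.
    - exact/measurable_EFinP/measurable_cnorm.
    - by apply: emeasurable_funD; apply: measurableT_comp => //;
        apply/measurable_EFinP; [exact: mf.1|exact: mf.2].
    - by move=> x _; rewrite !abse_EFin -EFinD lee_fin cnorm_le_ReIm.
  rewrite ge0_integralD//; first by rewrite lte_add_pinfty.
  - by apply: measurableT_comp => //; apply/measurable_EFinP; exact: mf.1.
  - by apply: measurableT_comp => //; apply/measurable_EFinP; exact: mf.2.
have mn := measurable_cnorm (conj f1 f2).
split; apply/integrableP; split; try exact/measurable_EFinP.
- apply: le_lt_trans foo; apply: ge0_le_integral => //.
  + by apply: measurableT_comp => //; exact/measurable_EFinP.
  + exact/measurable_EFinP.
  + by move=> x _; rewrite abse_EFin lee_fin Re_le_cnorm.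
- apply: le_lt_trans foo; apply: ge0_le_integral => //.
  + by apply: measurableT_comp => //; exact/measurable_EFinP.
  + exact/measurable_EFinP.
  + by move=> x _; rewrite abse_EFin lee_fin Im_le_cnorm.
Qed.

Lemma integrable_mulrl (k : R) (g : T -> R) :
  mu.-integrable setT (EFin \o g) ->
  mu.-integrable setT (EFin \o (fun x => k * g x)).
Proof. by move=> ig; have := integrableZl measurableT k ig. Qed.

Lemma cintegralZl (c : C) f : cintegrable mu setT f ->
  cintegral mu setT (fun x => c * f x) = c * cintegral mu setT f.
Proof.
move=> [i1 i2]; apply: eq_complexP; rewrite /cintegral /=.
  rewrite cReM /=; under eq_Rintegral do rewrite cReM.
  rewrite RintegralB ?RintegralZl//; exact: integrable_mulrl.
rewrite cImM /=; under eq_Rintegral do rewrite cImM.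
rewrite RintegralD ?RintegralZl//; exact: integrable_mulrl.
Qed.

Lemma cintegrableZl (c : C) f : cintegrable mu setT f ->
  cintegrable mu setT (fun x => c * f x).
Proof.
move=> /cintegrableP[mf foo]; apply/cintegrableP; split.
  by apply: cmeasurableM => //; exact: cmeasurable_cst.
rewrite (eq_integral (fun x => (cnorm c)%:E * (cnorm (f x))%:E)%E); last first.
  by move=> x _; rewrite cnormM.
rewrite ge0_integralZl//.
- by rewrite lte_mul_pinfty// lee_fin cnorm_ge0.
- exact/measurable_EFinP/measurable_cnorm.
- by move=> x _; rewrite lee_fin cnorm_ge0.
- by rewrite lee_fin cnorm_ge0.
Qed.

Lemma eq_cintegral f g : f =1 g -> cintegral mu setT f = cintegral mu setT g.
Proof. by move=> /funext ->. Qed.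

Lemma cintegral_mkcond (D : set T) f : measurable D ->
  (cintegrable mu D f <->
     cintegrable mu setT (fun x => (\1_D x : R)%:C * f x)) /\
  cintegral mu D f = cintegral mu setT (fun x => (\1_D x : R)%:C * f x).
Proof.
move=> mD.
have eRe : (fun x => Re ((\1_D x : R)%:C * f x)) = (fun x => Re (f x)) \_ D.
  apply/funext => x; rewrite cReM /= mul0r subr0 patchE indicE.
  by case: (x \in D); rewrite ?mul1r ?mul0r.
have eIm : (fun x => Im ((\1_D x : R)%:C * f x)) = (fun x => Im (f x)) \_ D.
  apply/funext => x; rewrite cImM /= mul0r addr0 patchE indicE.
  by case: (x \in D); rewrite ?mul1r ?mul0r.
split.
  rewrite /cintegrable (integrable_mkcond _ mD) (integrable_mkcond (fun x => (Im (f x))%:E) mD).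
  rewrite (_ : (fun x => (Re ((\1_D x : R)%:C * f x))%:E) = (fun x => (Re (f x))%:E) \_ D); last first.
    by rewrite restrict_EFin -eRe.
  rewrite (_ : (fun x => (Im ((\1_D x : R)%:C * f x))%:E) = (fun x => (Im (f x))%:E) \_ D)//.
  by rewrite restrict_EFin -eIm.
by rewrite /cintegral Rintegral_mkcond [X in _ +i* X]Rintegral_mkcond -eRe -eIm.
Qed.

End Basic.
End ComplexIntegral.

(** * Changes of variables and products for complex functions *)
Section ComplexFubini.
Context (R : realType).
Local Notation C := R[i].
Local Notation mR := (measurableTypeR R).
Local Notation Re := (@complex.Re R).
Local Notation Im := (@complex.Im R).

(** A change of variables with densities that is known for nonnegative functions
    holds for complex ones: apply it to the modulus, and to the positive and
    negative parts of real and imaginary parts. *)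
Section Transfer.
Context (d d1 d2 : measure_display) (Y : measurableType d)
  (T1 : measurableType d1) (T2 : measurableType d2).
Context (m1 : {measure set T1 -> \bar R}) (m2 : {measure set T2 -> \bar R}).
Context (theta1 : T1 -> Y) (theta2 : T2 -> Y) (w1 : T1 -> mR) (w2 : T2 -> mR).
Hypotheses (mtheta1 : measurable_fun setT theta1) (mw1 : measurable_fun setT w1).
Hypotheses (w10 : forall x, 0 <= w1 x) (w20 : forall x, 0 <= w2 x).
Hypothesis transfer : forall h : Y -> \bar R, measurable_fun setT h ->
  (forall y, 0 <= h y)%E ->
  (\int[m1]_x ((w1 x)%:E * h (theta1 x)) = \int[m2]_x ((w2 x)%:E * h (theta2 x)))%E.

Lemma transfer_integral (f : Y -> mR) : measurable_fun setT f ->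
  (\int[m1]_x (w1 x * f (theta1 x))%:E = \int[m2]_x (w2 x * f (theta2 x))%:E)%E.
Proof.
move=> mf; rewrite integralE [RHS]integralE.
have posE (T : Type) (w : T -> mR) (th : T -> Y) : (forall x, 0 <= w x) ->
    ((fun x => (w x * f (th x))%:E)^\+ = (fun x => (w x)%:E * (EFin \o f)^\+ (th x)))%E.
  move=> w0; apply/funext => x; rewrite !funeposE /= -!EFin_max -EFinM.
  by rewrite maxr_pMr// mulr0.
have negE (T : Type) (w : T -> mR) (th : T -> Y) : (forall x, 0 <= w x) ->
    ((fun x => (w x * f (th x))%:E)^\- = (fun x => (w x)%:E * (EFin \o f)^\- (th x)))%E.
  move=> w0; apply/funext => x; rewrite !funenegE /= -!EFin_max -EFinM.
  by rewrite maxr_pMr// mulr0 mulrN.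
rewrite !posE// !negE//; have mfE : measurable_fun setT (EFin \o f) by exact/measurable_EFinP.
rewrite !transfer//; [exact: measurable_funeneg|exact: measurable_funepos].
Qed.

Lemma transfer_cintegrable (f : Y -> C) : cmeasurable f ->
  cintegrable m2 setT (fun x => (w2 x)%:C * f (theta2 x)) ->
  cintegrable m1 setT (fun x => (w1 x)%:C * f (theta1 x)).
Proof.
move=> mf /cintegrableP[_ foo]; apply/cintegrableP; split.
  by apply: cmeasurableM; [exact: cmeasurable_real|exact: cmeasurable_comp mf mtheta1].
have -> : (\int[m1]_x (cnorm ((w1 x)%:C * f (theta1 x)))%:E =
    \int[m1]_x ((w1 x)%:E * (cnorm (f (theta1 x)))%:E))%E.
  by apply: eq_integral => x _; rewrite cnormM cnorm_real ger0_norm.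
rewrite (transfer (h := fun y => (cnorm (f y))%:E)).
- apply: le_lt_trans foo; rewrite le_eqVlt; apply/orP; left; apply/eqP.
  by apply: eq_integral => x _; rewrite cnormM cnorm_real ger0_norm.
- exact/measurable_EFinP/measurable_cnorm.
- by move=> y; rewrite lee_fin cnorm_ge0.
Qed.

Lemma transfer_cintegral (f : Y -> C) : cmeasurable f ->
  cintegral m1 setT (fun x => (w1 x)%:C * f (theta1 x)) =
  cintegral m2 setT (fun x => (w2 x)%:C * f (theta2 x)).
Proof.
move=> [f1 f2]; rewrite /cintegral /Rintegral.
have ReE (a : R) (z : C) : Re (a%:C * z) = a * Re z by rewrite cReM /= mul0r subr0.
have ImE (a : R) (z : C) : Im (a%:C * z) = a * Im z by rewrite cImM /= mul0r addr0.
congr (fine _ +i* fine _).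
- under eq_integral do rewrite ReE.
  under [RHS]eq_integral do rewrite ReE.
  exact: (transfer_integral f1).
- under eq_integral do rewrite ImE.
  under [RHS]eq_integral do rewrite ImE.
  exact: (transfer_integral f2).
Qed.

End Transfer.

Section Fubini.
Context (d1 d2 : measure_display) (T1 : measurableType d1) (T2 : measurableType d2).
Context (m1 : {sigma_finite_measure set T1 -> \bar R}).
Context (m2 : {sigma_finite_measure set T2 -> \bar R}).

(** An integrable extended real function is finite almost everywhere, so real
    iterated integrals agree with the extended ones. *)
Lemma Rintegral_fine (d : measure_display) (T : measurableType d)
    (mu : {measure set T -> \bar R}) (F : T -> \bar R) :
  mu.-integrable setT F -> \int[mu]_x fine (F x) = fine (\int[mu]_x F x)%E.
Proof.
move=> iF; rewrite /Rintegral; congr fine.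
have mF := measurable_int mu iF.
apply: ae_eq_integral => //.
- exact/measurable_EFinP/measurableT_comp.
- have := integrable_ae measurableT iF; apply: filterS => x /= h _.
  by rewrite fineK//; exact: h.
Qed.

Lemma Rintegral_fubini1 (f : T1 * T2 -> R) :
  (m1 \x m2)%E.-integrable setT (EFin \o f) ->
  \int[m1]_x \int[m2]_y f (x, y) = \int[(m1 \x m2)%E]_z f z.
Proof.
move=> if_; rewrite /Rintegral -integral12_prod_meas1//.
exact: (Rintegral_fine (integrable_fubini_F if_)).
Qed.

Lemma Rintegral_fubini2 (f : T1 * T2 -> R) :
  (m1 \x m2)%E.-integrable setT (EFin \o f) ->
  \int[m2]_y \int[m1]_x f (x, y) = \int[(m1 \x m2)%E]_z f z.
Proof.
move=> if_; rewrite /Rintegral -integral21_prod_meas1//.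
have iF : m2.-integrable setT (fubini_G m1 (EFin \o f)).
  have mf := measurable_int (m1 \x m2)%E if_.
  have mG : measurable_fun setT (fubini_G m1 (EFin \o f)) by exact: (measurable_fubini_G if_).
  apply/integrableP; split => //.
  apply: le_lt_trans ((integrable21ltyP m1 m2 mf).1 if_).
  apply: ge0_le_integral => //.
  - exact: measurableT_comp.
  - apply: (measurable_fun_fubini_tonelli_G (abse \o (EFin \o f))).
      exact: measurableT_comp.
    by move=> z; exact: abse_ge0.
  - move=> y _; apply: le_abse_integral => //.
    exact: measurableT_comp mf (measurable_pair2 y).
exact: (Rintegral_fine iF).
Qed.

Lemma cfubini1 (f : T1 * T2 -> C) : cintegrable (m1 \x m2)%E setT f ->
  cintegral m1 setT (fun x => cintegral m2 setT (fun y => f (x, y))) =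
  cintegral (m1 \x m2)%E setT f.
Proof.
by move=> [f1 f2]; rewrite /cintegral /= (Rintegral_fubini1 f1) (Rintegral_fubini1 f2).
Qed.

Lemma cfubini2 (f : T1 * T2 -> C) : cintegrable (m1 \x m2)%E setT f ->
  cintegral m2 setT (fun y => cintegral m1 setT (fun x => f (x, y))) =
  cintegral (m1 \x m2)%E setT f.
Proof.
by move=> [f1 f2]; rewrite /cintegral /= (Rintegral_fubini2 f1) (Rintegral_fubini2 f2).
Qed.

Lemma cintegrable_prod (f : T1 -> C) (g : T2 -> C) :
  cintegrable m1 setT f -> cintegrable m2 setT g ->
  cintegrable (m1 \x m2)%E setT (fun z => f z.1 * g z.2).
Proof.
move=> /cintegrableP[mf foo] /cintegrableP[mg goo]; apply/cintegrableP; split.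
  apply: cmeasurableM; [exact: cmeasurable_comp mf measurable_fst|
                        exact: cmeasurable_comp mg measurable_snd].
have mnf := measurable_cnorm mf; have mng := measurable_cnorm mg.
rewrite (eq_integral (fun z => (cnorm (f z.1))%:E * (cnorm (g z.2))%:E)%E); last first.
  by move=> z _; rewrite cnormM.
rewrite fubini_tonelli1//=; last 2 first.
- apply: emeasurable_funM; apply/measurable_EFinP.
    exact: measurableT_comp mnf measurable_fst.
  exact: measurableT_comp mng measurable_snd.
- by move=> z; rewrite mule_ge0// lee_fin cnorm_ge0.
rewrite /fubini_F /=.
have g0 : (0 <= \int[m2]_y (cnorm (g y))%:E)%E.
  by apply: integral_ge0 => y _; rewrite lee_fin cnorm_ge0.
rewrite (eq_integral (fun x => (cnorm (f x))%:E * \int[m2]_y (cnorm (g y))%:E)%E); last first.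
  move=> x _; rewrite ge0_integralZl//.
  - exact/measurable_EFinP.
  - by move=> y _; rewrite lee_fin cnorm_ge0.
  - by rewrite lee_fin cnorm_ge0.
rewrite ge0_integralZr//.
- apply: lte_mul_pinfty => //; first by apply: integral_ge0 => y _; rewrite lee_fin cnorm_ge0.
  by rewrite ge0_fin_numE// integral_ge0// => x _; rewrite lee_fin cnorm_ge0.
- exact/measurable_EFinP.
- by move=> x _; rewrite lee_fin cnorm_ge0.
Qed.

Lemma cintegral_prod (f : T1 -> C) (g : T2 -> C) :
  cintegrable m1 setT f -> cintegrable m2 setT g ->
  cintegral (m1 \x m2)%E setT (fun z => f z.1 * g z.2) =
  cintegral m1 setT f * cintegral m2 setT g.
Proof.
move=> if_ ig; rewrite -cfubini1/=; last exact: cintegrable_prod.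
rewrite (@eq_cintegral _ _ _ _ _ (fun x => cintegral m2 setT g * f x)).
  by rewrite cintegralZl// mulrC.
by move=> x; rewrite cintegralZl// mulrC.
Qed.

End Fubini.
End ComplexFubini.

(** * Convergence of Euler's integral *)
Section RealGamma.
Context (R : realType).
Local Notation leb := (@lebesgue_measure R).
Local Notation mR := (measurableTypeR R).

Lemma continuous_powR_gt0 (a x : R) : 0 < x -> {for x, continuous (fun t : R => t `^ a)}.
Proof.
move=> x0; apply: differentiable_continuous; apply/derivable1_diffP.
by have [] := is_derive1_powR a x0.
Qed.

Lemma integral_powR_segment (c a : R) : 0 < c -> c < 1 -> 0 < a ->
  (\int[leb]_(t in `[c, 1%R]) (a * t `^ (a - 1))%:E = (1 - c `^ a)%:E)%E.
Proof.
move=> c0 c1 a0.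
have pos x : c <= x -> 0 < x by exact: lt_le_trans.
rewrite (@continuous_FTC2 _ _ (@powR R ^~ a))//.
- by rewrite powR1 EFinB.
- apply: continuous_in_subspaceT => x; rewrite inE/= in_itv/= => /andP[cx _].
  by apply: (@continuousM _ R^o (fun=> a) (fun t : R => t `^ (a - 1)));
    [exact: cst_continuous|exact/continuous_powR_gt0/pos].
- split.
  + move=> x; rewrite in_itv/= => /andP[/ltW/pos x0 _].
    by have [] := is_derive1_powR a x0.
  + by apply: cvg_at_right_filter; exact: continuous_powR_gt0.
  + by apply: cvg_at_left_filter; exact: continuous_powR_gt0.
- move=> x; rewrite in_itv/= => /andP[/ltW/pos x0 _].
  by rewrite derive1E; have [_ ->] := is_derive1_powR a x0.
Qed.

Lemma integral_powR_unit_lty (a : R) : 0 < a ->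
  (\int[leb]_(t in `]0%R, 1%R]) (t `^ (a - 1))%:E < +oo)%E.
Proof.
move=> a0.
pose F (n : nat) : set mR := `[n.+2%:R^-1, 1]%classic.
have ndF : nondecreasing_seq F.
  move=> m n mn; rewrite subsetEset => t; rewrite /F /= !in_itv/= => /andP[h ->].
  rewrite andbT; apply: le_trans h; rewrite lef_pV2 ?posrE ?ltr0n//.
  by rewrite ler_nat !ltnS.
have UF : \bigcup_i F i = `]0%R, 1%R]%classic.
  apply/seteqP; split => t /=.
    move=> [n _]; rewrite /F/= !in_itv/= => /andP[h ->]; rewrite andbT.
    by apply: lt_le_trans h; rewrite invr_gt0 ltr0n.
  rewrite in_itv/= => /andP[t0 t1]; exists (Num.bound (t^-1)) => //.
  rewrite /F/= in_itv/= t1 andbT invf_ple ?posrE ?ltr0n//.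
  apply: le_trans (ltW (archi_boundP _)) _; first by rewrite invr_ge0 ltW.
  by rewrite ler_nat; apply: leqW.
pose f (t : mR) := (a * t `^ (a - 1))%:E.
have mf (D : set mR) : measurable_fun D f.
  apply: measurable_funTS; apply/measurable_EFinP.
  apply: (@measurable_funM _ mR R setT (fun=> a) (fun t : mR => t `^ (a - 1))).
    exact: measurable_cst.
  exact: measurable_powR.
have f0 t : (0 <= f t)%E by rewrite lee_fin mulr_ge0 ?powR_ge0 ?ltW.
have fle1 : (\int[leb]_(t in `]0%R, 1%R]) f t <= 1)%E.
  have cvgF := @ge0_nondecreasing_set_cvg_integral _ _ _ F f leb ndF
    (fun=> measurable_itv _) (fun=> mf _) (fun _ _ _ => f0 _).
  rewrite -UF -(cvg_lim _ cvgF)//; apply: lime_le; first by apply/cvg_ex; eexists; exact: cvgF.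
  near=> n; rewrite /F integral_powR_segment//.
  + by rewrite lee_fin lerBlDr lerDl powR_ge0.
  + by rewrite invf_lt1 ?ltr0n// ltr1n.
rewrite (eq_integral (fun t => (a^-1)%:E * f t)%E); last first.
  by move=> t _; rewrite -EFinM mulrA mulVf ?mul1r// gt_eqF.
rewrite ge0_integralZl//; last by rewrite lee_fin invr_ge0 ltW.
rewrite lte_mul_pinfty ?lee_fin ?invr_ge0 ?(ltW a0)//.
exact: le_lt_trans fle1 (ltry _).
Unshelve. end_near. Qed.

(** The integrand of Gamma(a), extended by 0 to the negative half-line. *)
Definition gamma_density (a : R) (t : mR) : mR :=
  if 0 < t then t `^ (a - 1) * expR (- t) else 0.

Lemma gamma_density_ge0 a t : 0 <= gamma_density a t.
Proof. by rewrite /gamma_density; case: ifP => // _; rewrite mulr_ge0 ?powR_ge0 ?expR_ge0. Qed.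

Lemma measurable_gamma_density a : measurable_fun setT (gamma_density a).
Proof.
apply: measurable_fun_ifT.
- apply: (@measurable_fun_ltr _ mR R setT (fun=> 0) (fun t : mR => t)).
    exact: measurable_cst.
  exact: measurable_id.
- apply: (@measurable_funM _ mR R setT (fun t : mR => t `^ (a - 1)) (fun t : mR => expR (- t))).
    exact: measurable_powR.
  apply: (@measurableT_comp _ _ _ _ _ _ (fun x : mR => expR x) _ (fun x : mR => - x)).
    exact: measurable_expR.
  exact: oppr_measurable.
- exact: measurable_cst.
Qed.

(** With n > |a|, t^(a - 1) is at most t^(n + 1), which is at most a multiple of
    e^(t / 2) by the exponential series. *)
Lemma powR_expR_tail_bound (a : R) : exists2 C : R, 0 <= C &
  forall t, 1 <= t -> t `^ (a - 1) * expR (- t) <= C * exponential_pdf 2^-1 t.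
Proof.
pose n := Num.bound `|a|; exists (2 * (2 ^+ n.+1 * n.+1`!%:R)).
  by rewrite mulr_ge0// mulr_ge0// exprn_ge0.
move=> t t1; have t0 : 0 <= t by exact: le_trans t1.
rewrite exponential_pdfE//.
have tn : t `^ (a - 1) <= t ^+ n.+1.
  rewrite -powR_mulrn//; apply: ler_powR => //.
  have : `|a| < n%:R by exact: archi_boundP.
  move=> /ltW /(le_trans (ler_norm _)) an.
  by rewrite lerBlDr; apply: le_trans an _; rewrite -natr1 -addrA lerDl addr_ge0.
have te : t ^+ n.+1 <= 2 ^+ n.+1 * n.+1`!%:R * expR (t / 2).
  have : (t / 2) ^+ n.+1 / n.+1`!%:R <= expR (t / 2).
    apply: le_trans (@expR_ge1Dxn R (t / 2) n (divr_ge0 t0 (ler0n _ 2))).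
    by rewrite lerDr.
  rewrite ler_pdivrMr ?ltr0n ?fact_gt0// exprMn exprVn ler_pdivrMr ?exprn_gt0//.
  by move=> /le_trans; apply; rewrite le_eqVlt; apply/orP; left; apply/eqP; ring.
apply: (@le_trans _ _ (2 ^+ n.+1 * n.+1`!%:R * expR (t / 2) * expR (- t))).
  by rewrite ler_wpM2r ?expR_ge0// (le_trans tn te).
rewrite -mulrA -expRD (_ : t / 2 - t = - 2^-1 * t); last by field.
by rewrite le_eqVlt; apply/orP; left; apply/eqP; field.
Qed.

(** Dominated by t^(a - 1) on ]0, 1] and by a multiple of the exponential density
    of rate 1/2 beyond 1. *)
Lemma gamma_density_lty (a : R) : 0 < a ->
  (\int[leb]_t (gamma_density a t)%:E < +oo)%E.
Proof.
move=> a0; have [C C0 tailC] := powR_expR_tail_bound a.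
pose f1 (t : mR) := ((fun t : mR => (t `^ (a - 1))%:E) \_ `]0%R, 1%R]%classic) t.
pose f2 (t : mR) := (C * exponential_pdf 2^-1 t)%:E.
have pdf0 (t : mR) : 0 <= exponential_pdf 2^-1 t :> R.
  by apply: exponential_pdf_ge0; rewrite invr_ge0.
have mf1 : measurable_fun setT f1.
  apply/(measurable_restrictT (fun t : mR => (t `^ (a - 1))%:E)
    (measurable_itv `]0%R, 1%R])).
  apply: measurable_funTS.
  by apply/measurable_EFinP; exact: measurable_powR.
have mpdf : measurable_fun setT (fun t : mR => exponential_pdf 2^-1 t : mR).
  by apply: measurable_exponential_pdf; rewrite invr_ge0.
have mf2 : measurable_fun setT f2.
  apply/measurable_EFinP.
  apply: (@measurable_funM _ mR R setT (fun=> C) _ _ mpdf); exact: measurable_cst.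
have f10 t : (0 <= f1 t)%E.
  by rewrite /f1 patchE; case: ifP => // _; rewrite lee_fin powR_ge0.
have f20 t : (0 <= f2 t)%E by rewrite lee_fin mulr_ge0.
apply: (@le_lt_trans _ _ (\int[leb]_t (f1 t + f2 t))%E).
  apply: ge0_le_integral => //.
  - by move=> t _; rewrite lee_fin gamma_density_ge0.
  - by apply/measurable_EFinP; exact: measurable_gamma_density.
  - exact: emeasurable_funD.
  - move=> t _; rewrite /gamma_density; case: ifPn => t0; last by rewrite adde_ge0.
    have [t1|t1] := leP t 1.
      apply: (@le_trans _ _ (f1 t)); last by rewrite leeDl.
      rewrite /f1 patchE ifT; last by rewrite inE/= in_itv/= t0.
      rewrite lee_fin -[leRHS]mulr1 ler_wpM2l ?powR_ge0//.
      by rewrite expR_le1 oppr_le0 ltW.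
    apply: (@le_trans _ _ (f2 t)); last by rewrite leeDr.
    by rewrite lee_fin; apply: tailC; exact: ltW.
rewrite ge0_integralD// lte_add_pinfty//.
  by rewrite -integral_mkcond; exact: integral_powR_unit_lty.
rewrite /f2; under eq_integral do rewrite EFinM.
rewrite ge0_integralZl; [|exact: measurableT|exact/measurable_EFinP|by move=> t _; rewrite lee_fin; exact: pdf0|by rewrite lee_fin].
by rewrite integral_exponential_pdf ?invr_gt0// mule1 ltry.
Qed.

Lemma ge0_integral_gt0 (f : mR -> R) (u v : R) : u < v ->
  measurable_fun setT (f : mR -> mR) -> (forall t, 0 <= f t) ->
  (forall t, u < t < v -> 0 < f t) -> (0 < \int[leb]_t (f t)%:E)%E.
Proof.
move=> uv mf f0 fuv; rewrite lt0e; apply/andP; split; last first.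
  by apply: integral_ge0 => t _; rewrite lee_fin.
apply/negP => /eqP I0.
have mfE : measurable_fun setT (fun t : mR => (f t)%:E) by exact/measurable_EFinP.
have : (\int[leb]_t `|(f t)%:E| = 0)%E.
  by rewrite -[RHS]I0; apply: eq_integral => t _; rewrite gee0_abs ?lee_fin.
move/(ae_eq_integral_abs leb measurableT mfE) => [N [mN N0 sN]].
have uvN : `]u, v[%classic `<=` N.
  move=> t /=; rewrite in_itv/= => tuv; apply: sN => /= /(_ I) /eqP.
  by rewrite eqe gt_eqF// fuv.
have : (leb `]u, v[%classic <= leb N)%E by apply: le_measure => //; rewrite inE.
rewrite N0 lebesgue_measure_itv/= lte_fin uv -EFinB lee_fin subr_le0.
by rewrite leNgt uv.
Qed.

Lemma gamma_density_integral_gt0 (a : R) : (0 < \int[leb]_t (gamma_density a t)%:E)%E.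
Proof.
apply: (@ge0_integral_gt0 _ 0 1) => //.
- exact: measurable_gamma_density.
- exact: gamma_density_ge0.
- by move=> t /andP[t0 _]; rewrite /gamma_density t0 mulr_gt0 ?powR_gt0 ?expR_gt0.
Qed.

End RealGamma.

(** * Complex powers of positive reals *)
Section ComplexPower.
Context (R : realType).
Local Notation C := R[i].
Local Notation mR := (measurableTypeR R).
Local Notation Re := (@complex.Re R).
Local Notation Im := (@complex.Im R).

Lemma cpowE (x : R) (z : C) : cpow x z =
  (expR (Re z * ln x) * cos (Im z * ln x)) +i* (expR (Re z * ln x) * sin (Im z * ln x)).
Proof. by apply: eq_complexP => /=; rewrite mul0r ?subr0 ?addr0. Qed.

Lemma cpowD (x : R) (z w : C) : cpow x (z + w) = cpow x z * cpow x w.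
Proof.
case: z w => a b [c e]; rewrite !cpowE /= !mulrDl expRD cosD sinD.
by apply: eq_complexP => /=; ring.
Qed.

Lemma cpow0 (x : R) : cpow x 0 = 1.
Proof. by rewrite cpowE /= !mul0r expR0 cos0 sin0 mulr1 mulr0. Qed.

Lemma cpow_neq0 (x : R) (z : C) : cpow x z != 0.
Proof.
apply/eqP => h; have := cpowD x z (- z).
by rewrite subrr cpow0 h mul0r => /eqP; rewrite oner_eq0.
Qed.

Lemma cpowN (x : R) (z : C) : cpow x (- z) = (cpow x z)^-1.
Proof.
apply: (mulfI (cpow_neq0 x z)); rewrite -cpowD subrr cpow0 divff//.
exact: cpow_neq0.
Qed.

Lemma cpowM (x y : R) (z : C) : 0 < x -> 0 < y -> cpow (x * y) z = cpow x z * cpow y z.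
Proof.
move=> x0 y0; rewrite !cpowE lnM ?posrE// !mulrDr expRD cosD sinD.
by apply: eq_complexP => /=; ring.
Qed.

Lemma cpow_real (x r : R) : 0 < x -> cpow x r%:C = (x `^ r)%:C.
Proof. by move=> x0; rewrite cpowE /= mul0r cos0 sin0 mulr1 mulr0 /powR gt_eqF. Qed.

Lemma cpow1 (x : R) : 0 < x -> cpow x 1 = x%:C.
Proof. by move=> x0; rewrite -[1]/(1%:C) cpow_real// powRr1// ltW. Qed.

Lemma cnorm_cpow (x : R) (z : C) : 0 < x -> cnorm (cpow x z) = x `^ Re z.
Proof.
move=> x0; rewrite cpowE /cnorm /= !exprMn -mulrDr cos2Dsin2 mulr1 sqrtr_sqr.
by rewrite ger0_norm ?expR_ge0// /powR gt_eqF.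
Qed.

(** The power extended by 0, so that integrals over a half-line become integrals
    over the whole line. *)
Definition cpowp (x : R) (z : C) : C := if 0 < x then cpow x z else 0.

Lemma cpowp_gt0 x z : 0 < x -> cpowp x z = cpow x z.
Proof. by rewrite /cpowp => ->. Qed.

Lemma cpowp_le0 x z : x <= 0 -> cpowp x z = 0.
Proof. by rewrite /cpowp ltNge => ->. Qed.

Lemma cpowpM (x y : R) (z : C) : 0 < x -> cpowp (x * y) z = cpow x z * cpowp y z.
Proof.
move=> x0; rewrite /cpowp pmulr_rgt0//.
by case: ifP => y0; [rewrite cpowM|rewrite mulr0].
Qed.

Lemma cmeasurable_cpow (z : C) : cmeasurable (fun x : mR => cpow x z).
Proof.
have mexp (a : R) : measurable_fun setT (fun x : mR => expR (a * ln x) : mR).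
  apply: (@measurableT_comp _ _ _ _ _ _ (fun x : mR => expR x : mR) _ (fun x : mR => a * ln x : mR)).
    exact: measurable_expR.
  apply: (@measurable_funM _ mR R setT (fun=> a) (fun x : mR => ln x)).
    exact: measurable_cst.
  exact: measurable_ln.
have mtrig (t : R -> R) (a : R) : continuous t ->
    measurable_fun setT (fun x : mR => t (a * ln x) : mR).
  move=> ct.
  apply: (@measurableT_comp _ _ _ _ _ _ (t : mR -> mR) _ (fun x : mR => a * ln x : mR)).
    exact: continuous_measurable_fun.
  apply: (@measurable_funM _ mR R setT (fun=> a) (fun x : mR => ln x)).
    exact: measurable_cst.
  exact: measurable_ln.
split.
  rewrite (_ : (fun x => _) = fun x : mR => expR (Re z * ln x) * cos (Im z * ln x)); last first.
    by apply/funext => x; rewrite cpowE.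
  apply: (@measurable_funM _ mR R setT (fun x : mR => expR (Re z * ln x)) (fun x : mR => cos (Im z * ln x))).
    exact: mexp.
  apply: mtrig; exact: continuous_cos.
rewrite (_ : (fun x => _) = fun x : mR => expR (Re z * ln x) * sin (Im z * ln x)); last first.
  by apply/funext => x; rewrite cpowE.
apply: (@measurable_funM _ mR R setT (fun x : mR => expR (Re z * ln x)) (fun x : mR => sin (Im z * ln x))).
  exact: mexp.
apply: mtrig; exact: continuous_sin.
Qed.

Lemma cmeasurable_cpowp (z : C) : cmeasurable (fun x : mR => cpowp x z).
Proof.
have [m1 m2] := cmeasurable_cpow z.
have mlt : measurable_fun setT (fun x : mR => 0 < x).
  apply: (@measurable_fun_ltr _ mR R setT (fun=> 0) (fun t : mR => t)).
    exact: measurable_cst.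
  exact: measurable_id.
split.
  rewrite (_ : (fun x => _) = fun x : mR => if 0 < x then Re (cpow x z) else 0).
    by apply: measurable_fun_ifT => //; exact: measurable_cst.
  by apply/funext => x; rewrite /cpowp; case: ifP.
rewrite (_ : (fun x => _) = fun x : mR => if 0 < x then Im (cpow x z) else 0).
  by apply: measurable_fun_ifT => //; exact: measurable_cst.
by apply/funext => x; rewrite /cpowp; case: ifP.
Qed.

End ComplexPower.

(** * The complex Gamma function *)
Section GammaFunction.
Context (R : realType).
Local Notation C := R[i].
Local Notation leb := (@lebesgue_measure R).
Local Notation mR := (measurableTypeR R).
Local Notation Re := (@complex.Re R).
Local Notation Im := (@complex.Im R).

(** Euler's integrand with rate T; its integral is T^(-z) Gamma(z). *)
Definition gamma_kernel (z : C) (T : R) (t : mR) : C :=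
  cpowp t (z - 1) * (expR (- (T * t)))%:C.

Definition rgamma (a : R) : \bar R := (\int[leb]_t (gamma_density a t)%:E)%E.

Lemma measurable_expRN (T : R) : measurable_fun setT (fun t : mR => expR (- (T * t)) : mR).
Proof.
apply: (@measurableT_comp _ _ _ _ _ _ (fun x : mR => expR x : mR) _ (fun x : mR => - (T * x) : mR)).
  exact: measurable_expR.
apply: (@measurableT_comp _ _ _ _ _ _ (fun x : mR => - x : mR) _ (fun x : mR => T * x : mR)).
  exact: oppr_measurable.
exact: mulrl_measurable.
Qed.

Lemma cmeasurable_gamma_kernel z T : cmeasurable (gamma_kernel z T).
Proof.
apply: cmeasurableM; first exact: cmeasurable_cpowp.
by apply: cmeasurable_real; exact: measurable_expRN.
Qed.

(** The right-hand side is arranged for the substitution t |-> T t: the leading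
    factor T is its Jacobian. *)
Lemma cnorm_gamma_kernel z T t : 0 < T ->
  cnorm (gamma_kernel z T t) = T * (T `^ (- Re z) * gamma_density (Re z) (T * t)).
Proof.
move=> T0; rewrite /gamma_kernel cnormM cnorm_real ger0_norm ?expR_ge0//.
rewrite /gamma_density pmulr_rgt0// /cpowp; case: ifPn => t0; last first.
  by rewrite /cnorm ComplexField.Normc.normc0 mul0r !mulr0.
rewrite cnorm_cpow// raddfB /= powRM ?ltW// !mulrA.
have Tn : (T == 0) = false by rewrite gt_eqF.
have -> : T * T `^ (- Re z) * T `^ (Re z - 1) = 1.
  rewrite -[X in X * _ * _](powRr1 (ltW T0)) -!powRD ?Tn ?implybT//.
  by rewrite (_ : 1 + - Re z + (Re z - 1) = 0) ?powRr0//; ring.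
by rewrite mul1r.
Qed.

Lemma integral_cnorm_gamma_kernel z T : 0 < T ->
  (\int[leb]_t (cnorm (gamma_kernel z T t))%:E = (T `^ (- Re z))%:E * rgamma (Re z))%E.
Proof.
move=> T0; under eq_integral do rewrite cnorm_gamma_kernel// -[X in gamma_density _ X]addr0 !EFinM.
have mg : measurable_fun setT (fun t : mR => (gamma_density (Re z) t)%:E).
  by apply/measurable_EFinP; exact: measurable_gamma_density.
have g0 t : (0 <= (gamma_density (Re z) t)%:E)%E by rewrite lee_fin gamma_density_ge0.
have mga : measurable_fun setT (fun t : mR => (gamma_density (Re z) (T * t + 0))%:E).
  apply: (measurableT_comp mg (g := fun t : mR => (T * t + 0 : mR))).
  by apply: measurable_funD => //; exact: mulrl_measurable.
rewrite ge0_integralZl; [|exact: measurableT|exact: measurable_funeM|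
  by move=> t _; rewrite mule_ge0 ?lee_fin ?powR_ge0 ?gamma_density_ge0|by rewrite lee_fin ltW].
rewrite ge0_integralZl; [|exact: measurableT|exact: mga|by move=> t _; exact: g0|
  by rewrite lee_fin powR_ge0].
rewrite (ge0_integral_affine 0 T0 mg g0) -/(rgamma _).
by rewrite !muleA -!EFinM mulrAC divff ?mul1r// gt_eqF.
Qed.

Lemma cintegrable_gamma_kernel z T : 0 < T -> 0 < Re z ->
  cintegrable leb setT (gamma_kernel z T).
Proof.
move=> T0 z0; apply/cintegrableP; split; first exact: cmeasurable_gamma_kernel.
rewrite integral_cnorm_gamma_kernel// lte_mul_pinfty ?lee_fin ?powR_ge0//.
exact: gamma_density_lty.
Qed.

Lemma cGammaE z : cGamma z = cintegral leb setT (gamma_kernel z 1).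
Proof.
have mI : measurable (`]0, +oo[%classic : set mR) by exact: measurable_itv.
rewrite /cGamma.
have [_ ->] := cintegral_mkcond leb (fun t : R => cpow t (z - 1) * (expR (- t))%:C) mI.
apply: eq_cintegral => t; rewrite indicE /gamma_kernel mul1r /cpowp.
case: ifPn => t0; first by rewrite mem_set ?mul1r//= in_itv/= t0.
by rewrite memNset ?mul0r//= in_itv/= (negbTE t0).
Qed.

Lemma cintegral_affine (f : mR -> C) (a b : R) : 0 < a -> cintegrable leb setT f ->
  cintegrable leb setT (fun t : mR => f (a * t + b)) /\
  cintegral leb setT (fun t : mR => f (a * t + b)) = (a^-1)%:C * cintegral leb setT f.
Proof.
move=> a0 if_; have cm := cintegrable_cmeasurable if_.
have maff : measurable_fun setT (fun t : mR => a * t + b : mR).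
  by apply: measurable_funD => //; exact: mulrl_measurable.
have tr (h : mR -> \bar R) : measurable_fun setT h -> (forall y, 0 <= h y)%E ->
    (\int[leb]_x (1%:E * h (a * x + b)%R) = \int[leb]_x ((a^-1)%:E * h x))%E.
  move=> mh h0; under eq_integral do rewrite mul1e.
  rewrite (ge0_integral_affine b a0 mh h0) ge0_integralZl//.
  by rewrite lee_fin invr_ge0 ltW.
have a'0 : 0 <= a^-1 by rewrite invr_ge0 ltW.
have ia : cintegrable leb setT (fun x => (a^-1)%:C * f x).
  exact: cintegrableZl.
have e1 (t : mR) : 1%:C * f (a * t + b) = f (a * t + b) by rewrite mul1r.
have i1 := transfer_cintegrable (m2 := leb) (theta2 := @id mR) (w2 := fun=> a^-1)
  maff (measurable_cst _) (fun=> ler01) (fun=> a'0) tr cm ia.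
have v1 := transfer_cintegral (m2 := leb) (theta2 := @id mR) (w2 := fun=> a^-1)
  (fun=> ler01) (fun=> a'0) tr cm.
rewrite (eq_cintegral _ e1) in v1; split.
  by move: i1; rewrite (_ : (fun x => _) = fun t : mR => f (a * t + b))//; exact/funext.
by rewrite v1 cintegralZl.
Qed.

Lemma cintegral_gamma_kernel z T : 0 < T -> 0 < Re z ->
  cintegral leb setT (gamma_kernel z T) = cpow T (- z) * cGamma z.
Proof.
move=> T0 z0.
have kE t : gamma_kernel z T t = cpow T (1 - z) * gamma_kernel z 1 (T * t + 0).
  have E : cpow T (1 - z) * cpow T (z - 1) = 1.
    by rewrite -!cpowD (_ : 1 - z + (z - 1) = 0) ?cpow0//; ring.
  rewrite addr0 /gamma_kernel mul1r cpowpM//.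
  by move: E; move: (cpow T _) (cpow T _) => a b E; rewrite !mulrA E mul1r.
have [iT vT] := cintegral_affine 0 T0 (cintegrable_gamma_kernel ltr01 z0).
rewrite (eq_cintegral _ kE) (cintegralZl _ iT) vT -cGammaE.
rewrite cpowD (cpow1 T0) fmorphV; move: (cpow T _) (cGamma _) => a b.
have TC : T%:C != 0 by apply/eqP => -[] /eqP; rewrite gt_eqF.
by rewrite mulrACA divff// mul1r.
Qed.

End GammaFunction.

(** * Gaussian integrals *)
Section Dirichlet.
Context (R : realType).
Local Notation C := R[i].
Local Notation leb := (@lebesgue_measure R).
Local Notation mR := (measurableTypeR R).
Local Notation Re := (@complex.Re R).
Local Notation Im := (@complex.Im R).
Local Notation lebT n := (lebesgue_tuple R n).

Lemma measurable_expRN_ereal (w : R) : measurable_fun setT (fun u : mR => (expR (- (w * u)))%:E).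
Proof. by apply/measurable_EFinP; exact: measurable_expRN. Qed.

(** In one variable this is the Gauss integral after rescaling; the exponential of
    the squared norm is a product over the coordinates. *)
Lemma radial_gauss (n : nat) (w : R) : 0 < w ->
  radial n (fun u : mR => (expR (- (w * u)))%:E) = (Num.sqrt (pi / w) ^+ n)%:E.
Proof.
move=> w0; have mf := measurable_expRN_ereal.
have f0 (v : R) (u : mR) : (0 <= (expR (- (v * u)))%:E)%E by rewrite lee_fin expR_ge0.
have gauss : (\int[leb]_t (expR (- (w * t ^+ 2)))%:E = (Num.sqrt (pi / w))%:E)%E.
  have := @ge0_integral_square R (fun u => (expR (- (1 * u)))%:E) w 0 w0 (mf 1) (f0 1).
  rewrite (eq_integral (fun t : mR => (expR (- (w * t ^+ 2)))%:E)); last first.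
    by move=> t _; rewrite addr0 mul1r.
  move=> ->; rewrite (radial1 (mf 1) (f0 1)).
  rewrite (eq_integral (fun t : mR => (gauss_fun t)%:E)); last first.
    by move=> t _; rewrite mul1r.
  by rewrite integralT_gauss -EFinM sqrtrM ?pi_ge0// sqrtrV ?ltW// mulrC.
elim: n => [|n IH].
  by rewrite radial0 ?mulr0 ?oppr0 ?expR0 ?expr0//; exact: mf.
rewrite (radialS n (mf w) (f0 w)).
rewrite (eq_integral (fun t : mR => (expR (- (w * t ^+ 2)))%:E * (Num.sqrt (pi / w) ^+ n)%:E)%E); last first.
  move=> t _; rewrite -IH /radial.
  rewrite -ge0_integralZl; [|exact: measurableT| |by move=> y _; exact: f0|by rewrite lee_fin expR_ge0].
    by apply: eq_integral => y _; rewrite mulrDr opprD expRD EFinM.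
  exact: measurableT_comp (mf w) (@measurable_sumsq R n).
rewrite ge0_integralZr; [|exact: measurableT| |by move=> t _; rewrite lee_fin expR_ge0|].
- by rewrite gauss -EFinM exprS.
- apply: (measurableT_comp (mf w) (g := fun t : mR => (t ^+ 2 : mR))).
  exact: measurable_funX.
- by rewrite lee_fin exprn_ge0// sqrtr_ge0.
Qed.

Definition gauss_kernel (n : nat) (w : R) (y : n.-tuple mR) : C :=
  (expR (- (w * sumsq y)))%:C.

Lemma cmeasurable_gauss_kernel n w : cmeasurable (@gauss_kernel n w).
Proof.
apply: (cmeasurable_real (f := fun y : n.-tuple mR => expR (- (w * sumsq y)))).
exact: (measurableT_comp (measurable_expRN w) (@measurable_sumsq R n)).
Qed.

Lemma integral_gauss_kernel n w : 0 < w ->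
  (\int[lebT n]_y (cnorm (gauss_kernel w y))%:E = (Num.sqrt (pi / w) ^+ n)%:E)%E.
Proof.
move=> w0; rewrite -radial_gauss//; apply: eq_integral => y _.
by rewrite cnorm_real ger0_norm ?expR_ge0.
Qed.

Lemma cintegrable_gauss_kernel n w : 0 < w ->
  cintegrable (lebT n) setT (@gauss_kernel n w).
Proof.
move=> w0; apply/cintegrableP; split; first exact: cmeasurable_gauss_kernel.
by rewrite integral_gauss_kernel// ltry.
Qed.

Lemma cintegral_gauss_kernel n w : 0 < w ->
  cintegral (lebT n) setT (@gauss_kernel n w) = (Num.sqrt (pi / w) ^+ n)%:C.
Proof.
move=> w0; apply: eq_complexP; rewrite /cintegral /Rintegral /=; last by rewrite integral0.
by have := radial_gauss n w0; rewrite /radial => ->.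
Qed.

Section Cons.
Variables (n : nat).
Local Notation hd z := (thead z).
Local Notation tl z := ([tuple of behead z]).

Lemma tcons_transfer (h : n.+1.-tuple mR -> \bar R) : measurable_fun setT h ->
  (forall y, 0 <= h y)%E ->
  (\int[leb \x lebT n]_z (1%:E * h (tcons z)) = \int[lebT n.+1]_z (1%:E * h z))%E.
Proof.
move=> mh h0; under eq_integral do rewrite mul1e.
under [RHS]eq_integral do rewrite mul1e.
rewrite ge0_integral_lebesgue_cons// fubini_tonelli1//.
exact: measurableT_comp (@measurable_tcons _ mR n).
Qed.

Lemma cintegrable_cons (f : mR -> C) (g : n.-tuple mR -> C) :
  cintegrable leb setT f -> cintegrable (lebT n) setT g ->
  cintegrable (lebT n.+1) setT (fun z => f (hd z) * g (tl z)) /\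
  cintegral (lebT n.+1) setT (fun z => f (hd z) * g (tl z)) =
    cintegral leb setT f * cintegral (lebT n) setT g.
Proof.
move=> if_ ig; pose F (z : n.+1.-tuple mR) := f (hd z) * g (tl z).
have FE z : F (tcons z) = f z.1 * g z.2.
  by case: z => t y; rewrite /F; congr (_ * g _); exact: val_inj.
have mF : cmeasurable F.
  apply: cmeasurableM.
    exact: cmeasurable_comp (cintegrable_cmeasurable if_) (@measurable_thead R n).
  exact: cmeasurable_comp (cintegrable_cmeasurable ig) (@measurable_behead _ mR n).
have ip := cintegrable_prod if_ ig.
have mt := @measurable_tcons _ mR n.
have i1 : cintegrable (leb \x lebT n)%E setT (fun z => 1%:C * F (tcons z)).
  by rewrite (_ : (fun z => _) = fun z => f z.1 * g z.2)//; apply/funext => z; rewrite mul1r FE.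
have tr := tcons_transfer.
have e1 (z : n.+1.-tuple mR) : 1%:C * F z = F z by rewrite mul1r.
split.
  have := transfer_cintegrable (m1 := lebT n.+1) (m2 := (leb \x lebT n)%E)
    (theta1 := @id (n.+1.-tuple mR)) (theta2 := @tcons mR n) (w1 := fun=> 1) (w2 := fun=> 1)
    (@measurable_id _ _ setT) (measurable_cst _) (fun=> ler01) (fun=> ler01)
    (fun h mh h0 => esym (tr h mh h0)) mF i1.
  by rewrite (_ : (fun z => _) = F)//; apply/funext => z.
rewrite -(cintegral_prod if_ ig).
have := transfer_cintegral (m1 := lebT n.+1) (m2 := (leb \x lebT n)%E)
    (theta1 := @id (n.+1.-tuple mR)) (theta2 := @tcons mR n) (w1 := fun=> 1) (w2 := fun=> 1)
    (fun=> ler01) (fun=> ler01)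
    (fun h mh h0 => esym (tr h mh h0)) mF.
rewrite (eq_cintegral _ e1) => ->; apply: eq_cintegral => z.
by rewrite mul1r FE.
Qed.

End Cons.
End Dirichlet.

(** * The Dirichlet integral of the last pivots *)
Section DirichletIntegral.
Context (R : realType).
Local Notation C := R[i].
Local Notation leb := (@lebesgue_measure R).
Local Notation mR := (measurableTypeR R).
Local Notation Re := (@complex.Re R).
Local Notation Im := (@complex.Im R).
Local Notation lebT n := (lebesgue_tuple R n).
Local Notation hd z := (thead z).
Local Notation tl z := ([tuple of behead z]).

Lemma cintegral0 (d : measure_display) (T : measurableType d)
    (mu : {measure set T -> \bar R}) : cintegral mu setT (fun=> 0 : C) = 0.
Proof. by apply: eq_complexP; rewrite /cintegral /Rintegral /= integral0. Qed.

Lemma ge0_integral_cons_prod n (u : mR -> mR) (v : n.-tuple mR -> mR) :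
  measurable_fun setT u -> measurable_fun setT v ->
  (forall t, 0 <= u t) -> (forall y, 0 <= v y) ->
  (\int[lebT n.+1]_z (u (hd z) * v (tl z))%:E =
   \int[leb]_t (u t)%:E * \int[lebT n]_y (v y)%:E)%E.
Proof.
move=> mu mv u0 v0; rewrite ge0_integral_lebesgue_cons; last 2 first.
- apply/measurable_EFinP; apply: measurable_funM.
    exact: measurableT_comp mu (@measurable_thead R n).
  exact: measurableT_comp mv (@measurable_behead _ mR n).
- by move=> z; rewrite lee_fin mulr_ge0.
have Iv0 : (0 <= \int[lebT n]_y (v y)%:E)%E by apply: integral_ge0 => y _; rewrite lee_fin.
rewrite -ge0_integralZr; [|exact: measurableT|exact/measurable_EFinP|by move=> t _; rewrite lee_fin|exact: Iv0].
apply: eq_integral => t _.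
rewrite -ge0_integralZl; [|exact: measurableT|exact/measurable_EFinP|by move=> y _; rewrite lee_fin|by rewrite lee_fin].
apply: eq_integral => y _; rewrite -EFinM; congr (_ * v _)%:E; exact: val_inj.
Qed.

Lemma sqrt_div_exp (n : nat) (w : R) : 0 < w ->
  Num.sqrt (pi / w) ^+ n = Num.sqrt pi ^+ n * w `^ (- (n%:R / 2)).
Proof.
move=> w0; rewrite sqrtrM ?pi_ge0// exprMn; congr (_ * _).
rewrite -powR_mulrn ?sqrtr_ge0// -powR12_sqrt ?invr_ge0 ?ltW//.
by rewrite -powR_inv1 ?ltW// -!powRrM; congr (_ `^ _); field.
Qed.

Variables (n : nat) (al sg : C).
Hypotheses (al0 : 0 < Re al) (sg0 : 0 < Re (sg - al - (n%:R / 2)%:C)).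

Let Resg : 0 < Re sg.
Proof.
move: sg0; rewrite !raddfB /= => h.
rewrite (_ : Re sg = (Re sg - Re al - n%:R / 2) + (Re al + n%:R / 2)); last by ring.
by rewrite addr_gt0// ltr_wpDr.
Qed.

(** The power of the last pivots: s = thead z is the last pivot of A, and
    1 + s + |y|^2 that of 1 + M + N, with y the tail of z. *)
Definition dirichlet_kernel (z : n.+1.-tuple mR) : C :=
  cpowp (hd z) (al - 1) * cpow (1 + hd z + sumsq (tl z)) (- sg).

Let T (z : n.+1.-tuple mR) : mR := 1 + hd z + sumsq (tl z).

Let mT : measurable_fun setT T.
Proof.
apply: measurable_funD; last exact: measurable_behead_sumsq.
apply: measurable_funD; [exact: measurable_cst|exact: measurable_thead].
Qed.

Let T_gt0 z : 0 < hd z -> 0 < T z.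
Proof. by move=> z0; rewrite /T ltr_pwDl ?sumsq_ge0// addr_gt0. Qed.

(** Integrating joint over its second argument w gives Gamma(sg) times
    dirichlet_kernel. *)
Let joint (x : n.+1.-tuple mR * mR) : C :=
  cpowp (hd x.1) (al - 1) * gamma_kernel sg (T x.1) x.2.

(** For fixed w the variables s and y separate: e^(- w (1 + s + |y|^2)) is a
    product. *)
Let jointE z w : joint (z, w) =
  gamma_kernel al w (hd z) * gauss_kernel w (tl z) * gamma_kernel sg 1 w.
Proof.
rewrite /joint /gamma_kernel /gauss_kernel /T /= mul1r.
have -> : expR (- ((1 + hd z + sumsq (tl z)) * w)) =
    expR (- (w * hd z)) * expR (- (w * sumsq (tl z))) * expR (- w).
  by rewrite -!expRD; congr expR; ring.
by rewrite !rmorphM /=; ring.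
Qed.

Let cmeasurable_joint : cmeasurable joint.
Proof.
apply: cmeasurableM.
  apply: (cmeasurable_comp (cmeasurable_cpowp (al - 1)) (h := fun x => hd x.1 : mR)).
  exact: measurableT_comp (@measurable_thead R n) measurable_fst.
apply: cmeasurableM.
  exact: (cmeasurable_comp (cmeasurable_cpowp (sg - 1)) measurable_snd).
apply: (cmeasurable_real (f := fun x : n.+1.-tuple mR * mR => expR (- (T x.1 * x.2)))).
apply: (@measurableT_comp _ _ _ _ _ _ (fun x : mR => expR x : mR) _
  (fun x : n.+1.-tuple mR * mR => - (T x.1 * x.2) : mR)).
  exact: measurable_expR.
apply: (@measurableT_comp _ _ _ _ _ _ (fun x : mR => - x : mR) _
  (fun x : n.+1.-tuple mR * mR => T x.1 * x.2 : mR)).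
  exact: oppr_measurable.
apply: measurable_funM => //; exact: measurableT_comp mT measurable_fst.
Qed.

Let cpowp0 (x : R) (z : C) : ~~ (0 < x) -> cpowp x z = 0.
Proof. by rewrite -leNgt; exact: cpowp_le0. Qed.

Let cnorm0 : cnorm (0 : C) = 0.
Proof. exact: ComplexField.Normc.normc0. Qed.

(** Integrating the modulus over s and y leaves the density of
    Gamma(sg - al - n/2), up to a constant. *)
Let joint_slice w : (\int[lebT n.+1]_z (cnorm (joint (z, w)))%:E =
  rgamma (Re al) * (Num.sqrt pi ^+ n)%:E *
    (gamma_density (Re (sg - al - (n%:R / 2)%:C)) w)%:E)%E.
Proof.
have [w0|w0] := boolP (0 < w); last first.
  rewrite /gamma_density (negbTE w0) mule0 integral0_eq// => z _.
  by rewrite jointE /gamma_kernel (cpowp0 _ w0) mul0r mulr0 cnorm0.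
rewrite (eq_integral (fun z => (cnorm (gamma_kernel al w (hd z)) *
    cnorm (gauss_kernel w (tl z)))%:E * (cnorm (gamma_kernel sg 1 w))%:E)%E); last first.
  by move=> z _; rewrite jointE !cnormM.
have mg := measurable_cnorm (cmeasurable_gamma_kernel al w).
have mh := measurable_cnorm (@cmeasurable_gauss_kernel R n w).
rewrite ge0_integralZr; [|exact: measurableT| |
   by move=> z _; rewrite lee_fin mulr_ge0 ?cnorm_ge0|by rewrite lee_fin cnorm_ge0]; last first.
  apply/measurable_EFinP; apply: measurable_funM.
    exact: measurableT_comp mg (@measurable_thead R n).
  exact: measurableT_comp mh (@measurable_behead _ mR n).
rewrite (ge0_integral_cons_prod mg mh (fun=> cnorm_ge0 _) (fun=> cnorm_ge0 _)).
rewrite integral_cnorm_gamma_kernel// integral_gauss_kernel// cnorm_gamma_kernel//.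
rewrite (muleC _ (rgamma _)) -!muleA; congr (_ * _)%E; rewrite -!EFinM; congr EFin.
rewrite sqrt_div_exp// powR1 !mul1r /gamma_density w0 !raddfB /=.
have wn : (w == 0) = false by rewrite gt_eqF.
rewrite [RHS](_ : _ = Num.sqrt pi ^+ n * (w `^ (- Re al) * w `^ (- (n%:R / 2)) *
   w `^ (Re sg - 1)) * expR (- w)); first by ring.
by rewrite -!powRD ?wn ?implybT// -mulrA; congr (_ * (_ `^ _ * _)); ring.
Qed.

Let cintegrable_joint : cintegrable (lebT n.+1 \x leb)%E setT joint.
Proof.
apply/cintegrableP; split; first exact: cmeasurable_joint.
have mj := measurable_cnorm cmeasurable_joint.
rewrite fubini_tonelli2//; last 2 first.
- exact/measurable_EFinP.
- by move=> x; rewrite lee_fin cnorm_ge0.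
rewrite /fubini_G.
rewrite (eq_integral (fun w => rgamma (Re al) * (Num.sqrt pi ^+ n)%:E *
    (gamma_density (Re (sg - al - (n%:R / 2)%:C)) w)%:E)%E); last first.
  by move=> w _; exact: joint_slice.
have r0 : (0 <= rgamma (Re al))%E by apply: integral_ge0 => t _; rewrite lee_fin gamma_density_ge0.
rewrite ge0_integralZl; [|exact: measurableT| | |]; last 3 first.
- by apply/measurable_EFinP; exact: measurable_gamma_density.
- by move=> t _; rewrite lee_fin gamma_density_ge0.
- by rewrite mule_ge0// lee_fin exprn_ge0// sqrtr_ge0.
apply: lte_mul_pinfty; [| |exact: gamma_density_lty].
- by rewrite mule_ge0// lee_fin exprn_ge0// sqrtr_ge0.
- rewrite fin_numM// ge0_fin_numE//; exact: gamma_density_lty.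
Qed.

Lemma cmeasurable_dirichlet_kernel : cmeasurable dirichlet_kernel.
Proof.
apply: cmeasurableM.
  exact: (cmeasurable_comp (cmeasurable_cpowp (al - 1)) (@measurable_thead R n)).
exact: (cmeasurable_comp (cmeasurable_cpow (- sg)) mT).
Qed.

(** The integral over w of the modulus of the joint integrand is the modulus of
    dirichlet_kernel times the positive constant Gamma(Re sg). *)
Lemma cintegrable_dirichlet_kernel : cintegrable (lebT n.+1) setT dirichlet_kernel.
Proof.
apply/cintegrableP; split; first exact: cmeasurable_dirichlet_kernel.
have [_] := (cintegrableP _ _).1 cintegrable_joint.
have mj := measurable_cnorm cmeasurable_joint.
have mk := measurable_cnorm cmeasurable_dirichlet_kernel.
rewrite fubini_tonelli1//; last 2 first.
- exact/measurable_EFinP.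
- by move=> x; rewrite lee_fin cnorm_ge0.
rewrite /fubini_F.
rewrite [X in (X < _)%E -> _](eq_integral (fun z => (cnorm (dirichlet_kernel z))%:E * rgamma (Re sg))%E); last first.
  move=> z _; have [z0|z0] := boolP (0 < hd z); last first.
    transitivity (\int[leb]_w (0 : \bar R))%E.
      by apply: eq_integral => w _; rewrite /joint /= (cpowp0 _ z0) mul0r cnorm0.
    by rewrite integral0 /dirichlet_kernel (cpowp0 _ z0) mul0r cnorm0 mul0e.
  have mg := measurable_cnorm (cmeasurable_gamma_kernel sg (T z)).
  transitivity (\int[leb]_w ((cnorm (cpowp (hd z) (al - 1)))%:E *
      (cnorm (gamma_kernel sg (T z) w))%:E))%E.
    by apply: eq_integral => w _; rewrite /joint /= cnormM EFinM.
  rewrite ge0_integralZl; [|exact: measurableT|exact/measurable_EFinP|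
    by move=> w _; rewrite lee_fin cnorm_ge0|by rewrite lee_fin cnorm_ge0].
  rewrite integral_cnorm_gamma_kernel ?T_gt0// muleA -EFinM; congr (_%:E * _)%E.
  by rewrite /dirichlet_kernel cnormM (cnorm_cpow _ (T_gt0 z0)) raddfN.
rewrite ge0_integralZr; [|exact: measurableT|exact/measurable_EFinP|
  by move=> z _; rewrite lee_fin cnorm_ge0|by apply/ltW; exact: gamma_density_integral_gt0].
have : (0 <= \int[lebT n.+1]_z (cnorm (dirichlet_kernel z))%:E)%E.
  by apply: integral_ge0 => z _; rewrite lee_fin cnorm_ge0.
case: integral => [r _ _|//|//]; first by rewrite ltry.
by rewrite gt0_mulye// gamma_density_integral_gt0.
Qed.

(** Fubini for the joint integrand.  The statement avoids division, because it is
    itself used to show that Gamma does not vanish. *)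
Lemma dirichlet_integral :
  cGamma sg * cintegral (lebT n.+1) setT dirichlet_kernel =
  (Num.sqrt pi ^+ n)%:C * (cGamma al * cGamma (sg - al - (n%:R / 2)%:C)).
Proof.
transitivity (cintegral (lebT n.+1 \x leb)%E setT joint).
  rewrite -cfubini1//.
  rewrite -cintegralZl; last exact: cintegrable_dirichlet_kernel.
  apply: eq_cintegral => z; rewrite /joint /=.
  have [z0|z0] := boolP (0 < hd z); last first.
    rewrite /dirichlet_kernel (cpowp0 _ z0) mul0r mulr0.
    by rewrite (@eq_cintegral _ _ _ _ _ (fun=> 0)) ?cintegral0// => w; rewrite mul0r.
  rewrite cintegralZl; last exact: cintegrable_gamma_kernel (T_gt0 z0) Resg.
  rewrite (cintegral_gamma_kernel (T_gt0 z0) Resg) /dirichlet_kernel -/(T z).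
  by rewrite mulrC -mulrA.
rewrite -cfubini2//.
rewrite [cGamma (sg - al - _)]cGammaE mulrA -cintegralZl; last exact: cintegrable_gamma_kernel.
apply: eq_cintegral => w.
have [w0|w0] := boolP (0 < w); last first.
  rewrite [in RHS]/gamma_kernel (cpowp0 _ w0) mul0r mulr0.
  rewrite (@eq_cintegral _ _ _ _ _ (fun=> 0)) ?cintegral0// => z.
  by rewrite /joint /gamma_kernel /= (cpowp0 _ w0) mul0r mulr0.
have [ig _] := cintegrable_cons (cintegrable_gamma_kernel w0 al0) (@cintegrable_gauss_kernel R n w w0).
rewrite (@eq_cintegral _ _ _ _ _ (fun z => gamma_kernel sg 1 w * (gamma_kernel al w (hd z) * gauss_kernel w (tl z)))); last first.
  by move=> z; rewrite jointE mulrC.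
rewrite (cintegralZl _ ig).
have [_ ->] := cintegrable_cons (cintegrable_gamma_kernel w0 al0) (@cintegrable_gauss_kernel R n w w0).
rewrite (cintegral_gamma_kernel w0 al0) (cintegral_gauss_kernel n w0) sqrt_div_exp//.
rewrite rmorphM /= -(cpow_real _ w0) /gamma_kernel !cpowp_gt0//.
have -> : cpow w (sg - al - (n%:R / 2)%:C - 1) =
    cpow w (sg - 1) * cpow w (- al) * cpow w (- (n%:R / 2))%:C.
  by rewrite -!cpowD rmorphN; congr cpow; ring.
by move: (cpow w _) (cpow w _) (cpow w _) => a b c; ring.
Qed.

End DirichletIntegral.

(** * Gamma has no zero in the right half-plane *)
Section GammaNonvanishing.
Context (R : realType).
Local Notation C := R[i].
Local Notation leb := (@lebesgue_measure R).
Local Notation mR := (measurableTypeR R).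
Local Notation Re := (@complex.Re R).
Local Notation Im := (@complex.Im R).

(** With no variable y the Dirichlet integral is the Beta integral. *)
Lemma gamma_beta (z w : C) : 0 < Re z -> 0 < Re w ->
  cGamma (z + w) * cintegral (lebesgue_tuple R 1) setT (@dirichlet_kernel R 0 z (z + w)) =
  cGamma z * cGamma w.
Proof.
move=> z0 w0; have e : z + w - z - (0%:R / 2)%:C = w by rewrite mul0r subr0 addrC addrA addNr add0r.
have h : 0 < Re (z + w - z - (0%:R / 2)%:C) by rewrite e.
by rewrite (dirichlet_integral z0 h) e expr0 mul1r.
Qed.

Lemma gamma_half_eq0 (z : C) : 0 < Re z -> cGamma z = 0 -> cGamma (2^-1%:C * z) = 0.
Proof.
move=> z0 g0; have h0 : 0 < Re (2^-1%:C * z) by rewrite cReM /= mul0r subr0 mulr_gt0.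
have zz : 2^-1%:C * z + 2^-1%:C * z = z.
  rewrite -mulrDl -rmorphD /= (_ : 2^-1 + 2^-1 = 1) ?mul1r//; lra.
have := gamma_beta h0 h0; rewrite zz g0 mul0r => /esym/eqP.
by rewrite mulf_eq0 orbb => /eqP.
Qed.

(** The integral of (1 + s)^(-1 - w) over s > 0 is nonzero by self-similarity: the
    integral of t^(-1 - w) over ]c, +oo[ is a multiple of the one over ]1, +oo[.
    If the latter vanished, so would the integral over every ]1, c], but for c
    close to 1 the real part of the integrand is positive there. *)
Section TailIntegral.
Variable w : C.
Hypothesis w0 : 0 < Re w.

Let tail (c : R) (t : mR) : C := if c < t then cpow t (- (1 + w)) else 0.

Let shift_cpow (s : mR) : C := cpowp s 0 * cpow (1 + s) (- (1 + w)).

Let shift_cpowE s : shift_cpow s = tail 1 (1 * s + 1).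
Proof.
rewrite /shift_cpow /tail mul1r ltrDr /cpowp; case: ifP => s0; last by rewrite mul0r.
by rewrite cpow0 mul1r addrC.
Qed.

Let thead_transfer (h : mR -> \bar R) : measurable_fun setT h -> (forall y, 0 <= h y)%E ->
  (\int[leb]_x (1%:E * h x) =
   \int[lebesgue_tuple R 1]_z (1%:E * h (thead z)))%E.
Proof.
move=> mh h0; under eq_integral do rewrite mul1e.
under [RHS]eq_integral do rewrite mul1e.
rewrite ge0_integral_lebesgue_cons//; last exact: measurableT_comp mh (@measurable_thead R 0).
apply: eq_integral => t _.
rewrite (eq_integral (fun=> h t)); last by move=> y _.
by rewrite integral_cst//= diracE mem_set// mule1.
Qed.

Let shift_cpow_integral : cintegrable leb setT shift_cpow /\
  cintegral leb setT shift_cpow =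
  cintegral (lebesgue_tuple R 1) setT (@dirichlet_kernel R 0 1 (1 + w)).
Proof.
have mF : cmeasurable shift_cpow.
  apply: cmeasurableM; first exact: cmeasurable_cpowp.
  apply: (cmeasurable_comp (cmeasurable_cpow (- (1 + w))) (h := fun s : mR => 1 + s : mR)).
  by apply: measurable_funD => //; exact: measurable_cst.
have kE (z : 1.-tuple mR) : 1%:C * shift_cpow (thead z) = @dirichlet_kernel R 0 1 (1 + w) z.
  by rewrite mul1r /shift_cpow /dirichlet_kernel subrr /sumsq big_ord0 addr0.
have h1 : 0 < Re (1 : C) by [].
have h2 : 0 < Re (1 + w - 1 - (0%:R / 2)%:C) by rewrite mul0r subr0 addrAC subrr add0r.
have iD := cintegrable_dirichlet_kernel h1 h2.
have tr := transfer_cintegrable (m1 := leb) (m2 := lebesgue_tuple R 1)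
  (theta1 := @id mR) (theta2 := fun z : 1.-tuple mR => thead z : mR)
  (w1 := fun=> 1) (w2 := fun=> 1)
  (@measurable_id _ _ setT) (measurable_cst _) (fun=> ler01) (fun=> ler01) thead_transfer mF.
have vtr := transfer_cintegral (m1 := leb) (m2 := lebesgue_tuple R 1)
  (theta1 := @id mR) (theta2 := fun z : 1.-tuple mR => thead z : mR)
  (w1 := fun=> 1) (w2 := fun=> 1)
  (fun=> ler01) (fun=> ler01) thead_transfer mF.
have e1 (s : mR) : 1%:C * shift_cpow s = shift_cpow s by rewrite mul1r.
rewrite (eq_cintegral _ e1) (eq_cintegral _ kE) in vtr; split => //.
move: tr; rewrite (_ : (fun x => 1%:C * shift_cpow (thead x)) = @dirichlet_kernel R 0 1 (1 + w)); last exact/funext.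
by move=> /(_ iD); rewrite (_ : (fun x => 1%:C * shift_cpow x) = shift_cpow)//; exact/funext.
Qed.

Let tail_integral c : 0 < c -> cintegrable leb setT (tail c) /\
  cintegral leb setT (tail c) =
    cpow c (- (1 + w)) * (c%:C * cintegral leb setT shift_cpow).
Proof.
move=> c0; have [is_ _] := shift_cpow_integral.
have c'0 : 0 < c^-1 by rewrite invr_gt0.
have [i1 v1] := cintegral_affine (-1) c'0 is_.
have tE t : tail c t = cpow c (- (1 + w)) * shift_cpow (c^-1 * t + -1).
  rewrite shift_cpowE mul1r addrNK /tail.
  rewrite (_ : (1 < c^-1 * t) = (c < t)); last by rewrite mulrC ltr_pdivlMr// mul1r.
  case: ifP => ct; last by rewrite mulr0.
  by rewrite -cpowM ?mulrA ?divff ?mul1r ?gt_eqF// mulr_gt0// (lt_trans c0).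
rewrite (_ : tail c = fun t => cpow c (- (1 + w)) * shift_cpow (c^-1 * t + -1)); last exact/funext.
split; first exact: cintegrableZl.
by rewrite cintegralZl// v1 invrK.
Qed.

Lemma tail_integral_neq0 :
  cintegral (lebesgue_tuple R 1) setT (@dirichlet_kernel R 0 1 (1 + w)) != 0.
Proof.
apply/eqP => I0; have [is_ vs] := shift_cpow_integral.
(* On ]1, c] the argument of t^(-1 - w) is less than 1 < pi/2 in absolute value. *)
pose c : R := expR ((`|Im w| + 1)^-1).
have c1 : 1 < c by rewrite expR_gt1 invr_gt0 ltr_wpDl.
have c0 : 0 < c by exact: lt_trans c1.
have [[i1 _] v1] := tail_integral ltr01; have [[ic _] vc] := tail_integral c0.
rewrite vs I0 !mulr0 in v1 vc.
pose g (t : mR) : R := Re (tail 1 t) - Re (tail c t).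
have gE t : g t = if (1 < t) && (t <= c) then Re (cpow t (- (1 + w))) else 0.
  rewrite /g /tail; case: (ltP 1 t) => /= t1.
    by case: ltP => tc; rewrite /= ?subrr ?subr0.
  by rewrite ltNge (le_trans t1 (ltW c1)) subrr.
have gpos t : 1 < t -> t <= c -> 0 < Re (cpow t (- (1 + w))).
  move=> t1 tc; rewrite cpowE /= mulr_gt0 ?expR_gt0//.
  have ln0 : 0 <= ln t by rewrite ln_ge0// ltW.
  have lnc : ln t <= (`|Im w| + 1)^-1.
    by rewrite -[leRHS]expRK ler_ln ?posrE// (lt_trans ltr01).
  have yl : `|Im (- (1 + w)) * ln t| < 1.
    rewrite raddfN raddfD /= add0r normrM normrN (ger0_norm ln0).
    apply: (@le_lt_trans _ _ (`|Im w| * (`|Im w| + 1)^-1)); first by rewrite ler_wpM2l.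
    by rewrite ltr_pdivrMr ?mul1r ?ltrDl// ltr_wpDl.
  have := pi_ge2 R => pi2.
  move: yl; rewrite ltr_norml => /andP[y1 y2].
  by apply: cos_gt0_pihalf; apply/andP; split; lra.
have g0 t : 0 <= g t.
  by rewrite gE; case: ifP => // /andP[t1 tc]; exact/ltW/gpos.
have mg : measurable_fun setT (g : mR -> mR).
  apply: measurable_funB.
    exact: (cintegrable_cmeasurable (tail_integral ltr01).1).1.
  exact: (cintegrable_cmeasurable (tail_integral c0).1).1.
have : (0 < \int[leb]_t (g t)%:E)%E.
  apply: (ge0_integral_gt0 c1 mg g0) => t /andP[t1 tc].
  by rewrite gE t1 (ltW tc); apply: gpos => //; exact: ltW.
have -> : (\int[leb]_t (g t)%:E = 0)%E.
  rewrite /g; under eq_integral do rewrite EFinB.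
  rewrite integralB//.
  have fin1 := integrable_fin_num measurableT i1; have finc := integrable_fin_num measurableT ic.
  rewrite -(fineK fin1) -(fineK finc) -EFinB; congr EFin.
  by move: v1 vc => [+ _] [+ _]; rewrite /cintegral /Rintegral => -> ->; rewrite subrr.
by rewrite ltxx.
Qed.

End TailIntegral.

Lemma gamma_succ_eq0 (w : C) : 0 < Re w -> cGamma w = 0 -> cGamma (1 + w) = 0.
Proof.
move=> w0 g0; have := @gamma_beta 1 w ltr01 w0.
rewrite g0 mulr0 => /eqP; rewrite mulf_eq0 (negbTE (tail_integral_neq0 w0)) orbF.
by move/eqP.
Qed.

(** Halving and shifting zeros gives Gamma(1 + z / 2^n) = 0 for all n.  The
    integrands converge to e^(-t), and they are dominated by the densities of
    Gamma(1) for t <= 1 and of Gamma(1 + Re z) for t > 1. *)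
Lemma gamma_neq0 (z : C) : 0 < Re z -> cGamma z != 0.
Proof.
move=> z0; apply/eqP => g0.
pose h n : R := 2^-1 ^+ n.
have h0 n : 0 < h n by rewrite exprn_gt0.
have hz n : 0 < Re ((h n)%:C * z) by rewrite cReM /= mul0r subr0 mulr_gt0.
have gn n : cGamma ((h n)%:C * z) = 0.
  elim: n => [|n IH]; first by rewrite /h expr0 mul1r.
  by rewrite /h exprS rmorphM /= -mulrA; exact: gamma_half_eq0.
have gn1 n : cGamma (1 + (h n)%:C * z) = 0 by exact: gamma_succ_eq0.
pose f_ (n : nat) (t : mR) : \bar R := (Re (gamma_kernel (1 + (h n)%:C * z) 1 t))%:E.
pose f (t : mR) : \bar R := (gamma_density 1 t)%:E.
pose g (t : mR) : \bar R := ((gamma_density 1 t)%:E + (gamma_density (1 + Re z) t)%:E)%E.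
have fE n t : f_ n t = (if 0 < t then
    expR (h n * (Re z * ln t)) * cos (h n * (Im z * ln t)) * expR (- t) else 0)%:E.
  rewrite /f_ /gamma_kernel /cpowp; case: ifP => t0; last by rewrite mul0r.
  rewrite addrAC subrr add0r cpowE cReM /= mulr0 subr0 !cReM !cImM /=.
  by rewrite !mul0r subr0 addr0 mul1r !mulrA.
have h1 n : h n <= 1 by rewrite /h exprn_ile1// invf_le1// ler1n.
have mgd a : measurable_fun setT (fun t : mR => (gamma_density a t)%:E).
  by apply/measurable_EFinP; exact: measurable_gamma_density.
have igd a : 0 < a -> leb.-integrable setT (fun t : mR => (gamma_density a t)%:E).
  move=> a0; apply/integrableP; split; first exact: mgd.
  rewrite (eq_integral (fun t : mR => (gamma_density a t)%:E)); first exact: gamma_density_lty.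
  by move=> t _; rewrite gee0_abs// lee_fin gamma_density_ge0.
have ig : leb.-integrable setT g.
  by apply: integrableD => //; [exact: igd|apply: igd; exact: addr_gt0].
have mf_ n : measurable_fun setT (f_ n).
  by apply/measurable_EFinP; exact: (cmeasurable_gamma_kernel _ 1).1.
have hcvg : h @ \oo --> (0 : R).
  by apply: cvg_expr; rewrite ger0_norm ?invr_ge0// invf_lt1 ?ltr1n.
have f_f : {ae leb, forall t, setT t -> f_ ^~ t @ \oo --> f t}.
  apply: aeW => t _; under eq_fun do rewrite fE.
  rewrite /f /gamma_density; case: ifP => t0; last exact: cvg_cst.
  apply: cvg_EFin; first by near=> n.
  rewrite subrr powRr0.
  rewrite (_ : 1 * expR (- t) = expR (0 * (Re z * ln t)) * cos (0 * (Im z * ln t)) * expR (- t)); last first.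
    by rewrite !mul0r expR0 cos0 mulr1.
  apply: cvgM; last exact: cvg_cst.
  apply: cvgM.
    apply: continuous_cvg; first exact: continuous_expR.
    by apply: cvgM => //; exact: cvg_cst.
  apply: continuous_cvg; first exact: continuous_cos.
  by apply: cvgM => //; exact: cvg_cst.
have f_g : {ae leb, forall t n, setT t -> (`|f_ n t| <= g t)%E}.
  apply: aeW => t n _; rewrite fE /g.
  have gd0 a : (0 <= (gamma_density a t)%:E)%E by rewrite lee_fin gamma_density_ge0.
  case: ifPn => t0; last by rewrite abse0 adde_ge0.
  rewrite abse_EFin.
  have le1 : `|expR (h n * (Re z * ln t)) * cos (h n * (Im z * ln t)) * expR (- t)| <=
      expR (h n * (Re z * ln t)) * expR (- t).
    rewrite !normrM !(ger0_norm (expR_ge0 _)) ler_wpM2r ?expR_ge0//.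
    by rewrite ler_piMr ?expR_ge0// ler_norml cos_geN1 cos_le1.
  have [lt0|lt0] := leP (ln t) 0.
    apply: (@le_trans _ _ (gamma_density 1 t)%:E); last by rewrite leeDl.
    rewrite lee_fin /gamma_density t0 subrr powRr0; apply: le_trans le1 _.
    rewrite ler_wpM2r ?expR_ge0// expR_le1 mulrA.
    by rewrite mulr_ge0_le0// mulr_ge0 ?ltW.
  apply: (@le_trans _ _ (gamma_density (1 + Re z) t)%:E); last by rewrite leeDr.
  rewrite lee_fin /gamma_density t0 addrAC subrr add0r; apply: le_trans le1 _.
  rewrite ler_wpM2r ?expR_ge0// /powR gt_eqF// ler_expR ler_piMl//.
  by rewrite mulr_ge0 ?ltW.
have [_ _] := dominated_convergence measurableT mf_ (mgd 1) f_f ig f_g.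
have I_ n : (\int[leb]_t f_ n t = 0)%E.
  have hzn : 0 < Re (1 + (h n)%:C * z) by rewrite raddfD /= addr_gt0.
  have [i1 _] := cintegrable_gamma_kernel ltr01 hzn.
  rewrite -(fineK (integrable_fin_num measurableT i1)).
  by have := gn1 n; rewrite cGammaE /cintegral /Rintegral => -[-> _].
rewrite (_ : [sequence _]_n = fun=> 0%E); last exact/funext.
move=> cv0; have := @gamma_density_integral_gt0 R 1.
have -> : (\int[leb]_t (gamma_density 1 t)%:E = 0)%E.
  by rewrite -(cvg_lim _ cv0)//; apply: cvg_lim => //; exact: cvg_cst.
by rewrite ltxx.
Unshelve. all: by end_near. Qed.

End GammaNonvanishing.

(** * Products of powers of leading minors *)
Section PivotChain.
Context (R : realType).
Local Notation C := R[i].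
Local Notation mR := (measurableTypeR R).

(** The product over k < n of the k-th pivot to the power e k, defined along the
    bordering so that the induction on p sees it directly. *)
Fixpoint chain (n : nat) : 'M[R]_n -> (nat -> C) -> C :=
  match n with
  | 0 => fun _ _ => 1
  | n'.+1 => fun A e => chain (corner A) e * cpow (pivot A) (e n')
  end.

Fixpoint minors_gt0 (n : nat) : 'M[R]_n -> Prop :=
  match n with
  | 0 => fun _ => True
  | n'.+1 => fun A => minors_gt0 (corner A) /\ 0 < \det A
  end.

Lemma minors_gt0_det n (A : 'M[R]_n) : minors_gt0 A -> 0 < \det A.
Proof. by case: n A => [|n] A; [rewrite det_mx00|case]. Qed.

Lemma minors_gt0_pivot n (A : 'M[R]_n.+1) : minors_gt0 A -> 0 < pivot A.
Proof. by move=> [/minors_gt0_det c0 A0]; rewrite divr_gt0. Qed.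

Lemma eq_chain n (A : 'M[R]_n) e e' : (forall k, (k < n)%N -> e k = e' k) ->
  chain A e = chain A e'.
Proof.
elim: n A => //= n IH A ee; rewrite (IH _ (fun k kn => ee k (leqW kn))).
by rewrite ee.
Qed.

(** The determinant is the product of the pivots. *)
Lemma chain_shift n (A : 'M[R]_n) e z : minors_gt0 A ->
  chain A (fun k => e k + z) = chain A e * cpow (\det A) z.
Proof.
elim: n A => [|n IH] A.
  by rewrite /= det_mx00 cpowE ln1 !mulr0 expR0 cos0 sin0 mulr1 mulr0 mul1r.
move=> mA; have [mC A0] := mA; have C0 := minors_gt0_det mC.
have -> : \det A = \det (corner A) * pivot A.
  by rewrite /pivot mulrC divfK// gt_eqF.
have e1 := cpowM z C0 (minors_gt0_pivot mA).
have e2 := cpowD (pivot A) (e n) z.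
rewrite /= IH// e1 e2.
by move: (chain _ _) (cpow _ _) (cpow _ _) (cpow _ _) => a b c d; ring.
Qed.

Lemma posdef_minors_gt0 n (A : 'M[R]_n) : posdefmx A -> minors_gt0 A.
Proof.
elim: n A => //= n IH A pA; split; last exact: posdef_det_gt0.
by apply: IH; have [] := (posdef_pivotE pA.1).1 pA.
Qed.

Lemma fK_minors_gt0 p r (c : Kidx p r -> R) : posdefmx (fA c) -> minors_gt0 (fK c).
Proof.
elim: p c => //= p IH c pA; split; last exact: fK_det_gt0.
rewrite corner_fK; apply: IH; rewrite -corner_fA.
by have [] := (posdef_pivotE pA.1).1 pA.
Qed.

Lemma cmeasurable_chain n (d : measure_display) (T : measurableType d) (A : T -> 'M[R]_n) e :
  measurable_mx A -> cmeasurable (fun x => chain (A x) e).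
Proof.
elim: n A => [|n IH] A mA; first exact: cmeasurable_cst.
apply: cmeasurableM.
  by apply: IH => i j; under eq_fun do rewrite mxE; exact: mA.
apply: (cmeasurable_comp (cmeasurable_cpow (e n)) (h := fun x => pivot (A x) : mR)).
exact: measurable_pivot.
Qed.

(** Summation by parts in the exponents: the j-th leading minor is the product of
    the pivots up to j, and the exponents telescope. *)
Lemma prod_ulblock n (A : 'M[R]_n) (e : nat -> C) : minors_gt0 A ->
  \prod_(j < n) cpow (\det (ulblock A j)) (e j.+1 - e j.+2) =
  chain A (fun k => e k.+1 - e n.+1).
Proof.
elim: n A => [|n IH] A mA; first by rewrite big_ord0.
rewrite big_ord_recr /=.
have -> : \det (ulblock A ord_max) = \det A.
  congr (\det _); apply/matrixP => i j; rewrite !mxE; congr (A _ _); exact: val_inj.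
have -> : \prod_(i < n) cpow (\det (ulblock A (widen_ord (leqnSn n) i))) (e i.+1 - e i.+2) =
    chain (corner A) (fun k => e k.+1 - e n.+1).
  rewrite -IH; last exact: mA.1.
  apply: eq_bigr => i _.
  have -> // : ulblock A (widen_ord (leqnSn n) i) = ulblock (corner A) i :> 'M[R]_(i.+1).
  apply/matrixP => j k; rewrite !mxE.
  have lE (j' : 'I_i.+1) : widen_ord (ltn_ord (widen_ord (leqnSn n) i)) j' =
      lift ord_max (widen_ord (ltn_ord i) j') :> 'I_n.+1.
    by apply: val_inj; rewrite [RHS]lift_max.
  by rewrite !lE.
have -> : chain (corner A) (fun k => e k.+1 - e n.+2) * cpow (pivot A) (e n.+1 - e n.+2) =
    chain A (fun k => (e k.+1 - e n.+1) + (e n.+1 - e n.+2)).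
  rewrite -[LHS]/(chain A (fun k => e k.+1 - e n.+2)).
  by apply: eq_chain => k _; rewrite addrA subrK.
rewrite (chain_shift _ _ mA) /= subrr cpow0 mulr1.
by [].
Qed.

End PivotChain.

(** * The induction on the size of K *)
Section Induction.
Context (R : realType).
Local Notation C := R[i].
Local Notation mR := (measurableTypeR R).
Local Notation Re := (@complex.Re R).
Local Notation Im := (@complex.Im R).
Local Notation lebI I := (lebesgue_tuple R #|{: I}|).
Local Notation lebT n := (lebesgue_tuple R n).

(** The arguments of the three Gamma factors, with k counted from 0. *)
Definition argA (p r : nat) (lam : nat -> C) (k : nat) : C :=
  lam k - ((p + r + k.+1)%:R / 2 - 1)%:C.
Definition argB (p : nat) (lam sig : nat -> C) (k : nat) : C :=
  sig k - lam k - ((p%:R - k.+1%:R) / 2)%:C.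
Definition argC (p : nat) (sig : nat -> C) (k : nat) : C :=
  sig k - (p%:R - k.+1%:R)%:C.

Definition pivot_integrand p r (lam sig : nat -> C) (x : coords R (Kidx p r)) : C :=
  chain (fA (icoord x)) (fun k => lam k - ((p + p + r)%:R / 2)%:C) *
  chain (fK (icoord x)) (fun k => - sig k).

Definition PDfun p r (x : coords R (Kidx p r)) : mR := \1_(@PD R p r) x.

Lemma PDfun_ge0 p r x : 0 <= @PDfun p r x.
Proof. by rewrite /PDfun indicE. Qed.

Lemma measurable_PDfun p r : measurable_fun setT (@PDfun p r).
Proof. by apply: measurable_indic; exact: measurable_PD. Qed.

(** The two sides of the recursion, written as maps to a common space: the
    remaining blocks and the last pivots of A and 1 + M + N. *)
Definition step_source p r (x : coords R (Kidx p.+1 r)) :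
    coords R (Kidx p r) * (mR * mR) := (trunc x, (pivA x, pivK x)).

Definition step_target p r (y : coords R (Kidx p r) * (p + (r + p)).+1.-tuple mR) :
    coords R (Kidx p r) * (mR * mR) :=
  (y.1, (thead y.2, 1 + thead y.2 + sumsq [tuple of behead y.2])).

Definition step_weight p r (y : coords R (Kidx p r) * (p + (r + p)).+1.-tuple mR) : mR :=
  PDfun y.1 * weight y.1 * \1_(@pos_head R (p + (r + p))) y.2.

Lemma weight_ge0 p r (x : coords R (Kidx p r)) : PD x -> 0 <= weight x.
Proof.
by move=> xPD; rewrite /weight mulr_ge0 ?sqrtr_ge0// ltW// fK_det_gt0.
Qed.

Lemma PDweight_ge0 p r (x : coords R (Kidx p r)) : 0 <= PDfun x * weight x.
Proof.
rewrite /PDfun indicE; case: (boolP (x \in _)) => xPD; last by rewrite mul0r.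
by rewrite mul1r weight_ge0//; move: xPD; rewrite inE.
Qed.

Lemma measurable_weight p r : measurable_fun setT (@weight R p r).
Proof.
have mA : measurable_mx (fun x : coords R (Kidx p r) => fA (icoord x)).
  apply: measurable_fA => k; exact: measurable_icoord.
have mK : measurable_mx (fun x : coords R (Kidx p r) => fK (icoord x)).
  apply: measurable_fK => k; exact: measurable_icoord.
apply: measurable_funM; last exact: measurable_det.
apply: (measurableT_comp (f := Num.sqrt : mR -> mR)); last exact: measurable_det.
exact: continuous_measurable_fun (@sqrt_continuous R).
Qed.

Lemma measurable_step_weight p r : measurable_fun setT (@step_weight p r).
Proof.
apply: measurable_funM.
  apply: measurable_funM; apply: measurableT_comp measurable_fst.
    exact: measurable_PDfun.
  exact: measurable_weight.
apply: measurableT_comp measurable_snd.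
by apply: measurable_indic; exact: measurable_pos_head.
Qed.

Lemma step_weight_ge0 p r y : 0 <= @step_weight p r y.
Proof. by rewrite /step_weight mulr_ge0 ?PDweight_ge0// indicE. Qed.

Lemma measurable_step_source p r : measurable_fun setT (@step_source p r).
Proof.
apply: measurable_fun_pair; first exact: measurable_trunc.
by apply: measurable_fun_pair; [exact: measurable_pivA|exact: measurable_pivK].
Qed.

Lemma measurable_step_target p r : measurable_fun setT (@step_target p r).
Proof.
apply: measurable_fun_pair => //; apply: measurable_fun_pair.
  exact: measurableT_comp (@measurable_thead R _) measurable_snd.
apply: measurable_funD.
  apply: measurable_funD; first exact: measurable_cst.
  exact: measurableT_comp (@measurable_thead R _) measurable_snd.
exact: measurableT_comp (@measurable_behead_sumsq R _) measurable_snd.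
Qed.

Lemma step_transfer p r (h : coords R (Kidx p r) * (mR * mR) -> \bar R) :
  measurable_fun setT h -> (forall y, 0 <= h y)%E ->
  (\int[lebI (Kidx p.+1 r)]_x ((PDfun x)%:E * h (step_source x)) =
   \int[lebI (Kidx p r) \x lebT (p + (r + p)).+1]_y
      ((step_weight y)%:E * h (step_target y)))%E.
Proof.
move=> mh h0.
have mht : measurable_fun setT (fun y => h (@step_target p r y)).
  exact: measurableT_comp mh (@measurable_step_target p r).
have := @ge0_integral_step R p r (fun x s t => h (x, (s, t))).
rewrite integral_mkcond [X in _ -> _ -> _ = X]integral_mkcond => step.
transitivity (\int[lebI (Kidx p.+1 r)]_x
    ((fun x => h (step_source x)) \_ (@PD R p.+1 r)) x)%E.
  apply: eq_integral => x _; rewrite /PDfun indicE patchE.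
  by case: (x \in _); rewrite ?mul1e ?mul0e.
rewrite [LHS]step//; last first.
  rewrite (_ : (fun z => _) = h)//; apply/funext => -[x [s t]] //.
rewrite fubini_tonelli1//; last 2 first.
- by apply: emeasurable_funM => //; apply/measurable_EFinP; exact: measurable_step_weight.
- by move=> y; rewrite mule_ge0// lee_fin step_weight_ge0.
apply: eq_integral => x _; rewrite /fubini_F patchE /step_weight /PDfun /=.
rewrite indicE; case: (boolP (x \in _)) => xPD; last first.
  by rewrite integral0_eq// => z _; rewrite !mul0r mul0e.
have w0 : 0 <= weight x by apply: weight_ge0; move: xPD; rewrite inE.
rewrite integral_mkcond.
have mz : measurable_fun setT (fun z => h (@step_target p r (x, z))).
  exact: measurableT_comp mht (measurable_pair1 x).
rewrite -ge0_integralZl//.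
- apply: eq_integral => z _; rewrite patchE mul1r indicE.
  case: (z \in _); rewrite ?mulr1 ?mulr0 ?mul0e ?mule0//.
- apply/(measurable_restrictT _ (@measurable_pos_head R _)); exact: measurable_funTS.
- by move=> z _; rewrite patchE; case: ifP.
Qed.

Lemma det_fA_gt0 p r (x : coords R (Kidx p r)) : PD x -> 0 < \det (fA (icoord x)).
Proof. exact: posdef_det_gt0. Qed.

(** The weight sqrt (det A) * det (1 + M + N) adds 1/2 and 1 to all exponents.
    Raising p by one lowers those of A by 1 through the power - (2p + r)/2 of
    det A, so the net effect is lambda - 1/2 and sigma - 1 at size p. *)
Lemma chain_weight p r (lam sig : nat -> C) (x : coords R (Kidx p r)) : PD x ->
  (weight x)%:C * (chain (fA (icoord x)) (fun k => lam k - ((p.+1 + p.+1 + r)%:R / 2)%:C) *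
                   chain (fK (icoord x)) (fun k => - sig k)) =
  pivot_integrand (fun k => lam k - (2^-1)%:C) (fun k => sig k - 1) x.
Proof.
move=> xPD; have dA := det_fA_gt0 xPD; have dK := fK_det_gt0 xPD.
have mA := posdef_minors_gt0 xPD; have mK := fK_minors_gt0 xPD.
rewrite /pivot_integrand.
have -> : chain (fA (icoord x)) (fun k => lam k - (2^-1)%:C - ((p + p + r)%:R / 2)%:C) =
    chain (fA (icoord x)) (fun k => lam k - ((p.+1 + p.+1 + r)%:R / 2)%:C) *
    (Num.sqrt (\det (fA (icoord x))))%:C.
  rewrite -powR12_sqrt ?ltW// -cpow_real// -chain_shift//.
  apply: eq_chain => k _; rewrite -!addrA; congr (_ + _).
  rewrite -!rmorphN -!rmorphD; congr (_%:C).
  by rewrite addSn addnS !addSn -!natr1; field.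
have -> : chain (fK (icoord x)) (fun k => - (sig k - 1)) =
    chain (fK (icoord x)) (fun k => - sig k) * (\det (fK (icoord x)))%:C.
  rewrite -cpow1// -chain_shift//.
  by apply: eq_chain => k _; rewrite opprB addrC.
rewrite /weight rmorphM /=.
by move: (chain _ _) (chain _ _) => a b; ring.
Qed.

(** The integrand at size p.+1 as a function of the remaining blocks and of the
    last pivots. *)
Definition step_function p r (lam sig : nat -> C)
    (y : coords R (Kidx p r) * (mR * mR)) : C :=
  (chain (fA (icoord y.1)) (fun k => lam k - ((p.+1 + p.+1 + r)%:R / 2)%:C) *
   chain (fK (icoord y.1)) (fun k => - sig k)) *
  (cpow y.2.1 (argA p.+1 r lam p - 1) * cpow y.2.2 (- sig p)).

Lemma cmeasurable_step_function p r lam sig : cmeasurable (@step_function p r lam sig).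
Proof.
have mic k : measurable_fun setT (fun y : coords R (Kidx p r) * (mR * mR) => icoord y.1 k : mR).
  exact: measurableT_comp (@measurable_icoord R _ k) measurable_fst.
apply: cmeasurableM; apply: cmeasurableM.
- by apply: cmeasurable_chain; exact: (measurable_fA mic).
- by apply: cmeasurable_chain; exact: (measurable_fK mic).
- apply: (cmeasurable_comp (cmeasurable_cpow _) (h := fun y : coords R (Kidx p r) * (mR * mR) => y.2.1)).
  exact: measurableT_comp measurable_fst measurable_snd.
- apply: (cmeasurable_comp (cmeasurable_cpow _) (h := fun y : coords R (Kidx p r) * (mR * mR) => y.2.2)).
  exact: measurableT_comp measurable_snd measurable_snd.
Qed.

Lemma step_function_source p r lam sig (x : coords R (Kidx p.+1 r)) :
  step_function lam sig (step_source x) = pivot_integrand lam sig x.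
Proof.
rewrite /step_function /pivot_integrand /step_source /= icoord_trunc -corner_fA -corner_fK.
rewrite /pivA /pivK.
have -> : argA p.+1 r lam p - 1 = lam p - ((p.+1 + p.+1 + r)%:R / 2)%:C.
  rewrite /argA addnAC; apply: eq_complexP; rewrite !raddfB /=; last by ring.
  by ring.
by move: (chain _ _) (chain _ _) (cpow _ _) (cpow _ _) => a b c d; ring.
Qed.

Lemma step_function_target p r lam sig y :
  (step_weight y)%:C * step_function lam sig (@step_target p r y) =
  ((PDfun y.1)%:C * pivot_integrand (fun k => lam k - (2^-1)%:C) (fun k => sig k - 1) y.1) *
  dirichlet_kernel (argA p.+1 r lam p) (sig p) y.2.
Proof.
case: y => x z; rewrite /step_weight /step_function /step_target /dirichlet_kernel /=.
have -> : cpowp (thead z) (argA p.+1 r lam p - 1) =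
    (\1_(@pos_head R (p + (r + p))) z)%:C * cpow (thead z) (argA p.+1 r lam p - 1).
  rewrite /cpowp indicE; case: ifPn => z0; first by rewrite mem_set ?mul1r.
  by rewrite memNset ?mul0r//; exact/negP.
rewrite /PDfun indicE; case: (boolP (x \in _)) => xPD; last by rewrite !mul0r.
rewrite -chain_weight; last by move: xPD; rewrite inE.
rewrite !mul1r rmorphM /=.
by move: (chain _ _) (chain _ _) (cpow _ _) (cpow _ _) => a b c d; ring.
Qed.

Definition closed_form p r (lam sig : nat -> C) : C :=
  \prod_(k < p) ((Num.sqrt pi ^+ (k + (r + k)))%:C *
     (cGamma (argA p r lam k) * cGamma (argB p lam sig k) / cGamma (argC p sig k))).

(** The shifts lambda - 1/2 and sigma - 1 compensate the change of size in the
    arguments of the Gamma factors. *)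
Lemma argA_shift p r lam k :
  argA p r (fun k => lam k - (2^-1)%:C) k = argA p.+1 r lam k.
Proof.
rewrite /argA -addrA; congr (_ + _); rewrite -!rmorphN -!rmorphD; congr (_%:C).
by rewrite !addSn -natr1; field.
Qed.

Lemma argB_shift p lam sig k :
  argB p (fun k => lam k - (2^-1)%:C) (fun k => sig k - 1) k = argB p.+1 lam sig k.
Proof.
rewrite /argB; apply: eq_complexP; rewrite !raddfB /=; last by ring.
by rewrite -[in RHS]natr1; field.
Qed.

Lemma argC_shift p sig k :
  argC p (fun k => sig k - 1) k = argC p.+1 sig k.
Proof.
rewrite /argC; apply: eq_complexP; rewrite !raddfB /=; last by ring.
by rewrite -[in RHS]natr1; ring.
Qed.

(** Peeling off the border splits the integral into the same integral at size p
    with shifted exponents and a Dirichlet integral, which is the last factor of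
    the closed form. *)
Lemma pivot_integral p r (lam sig : nat -> C) :
  (forall k, (k < p)%N -> 0 < Re (argA p r lam k)) ->
  (forall k, (k < p)%N -> 0 < Re (argB p lam sig k)) ->
  let f x := (PDfun x)%:C * @pivot_integrand p r lam sig x in
  cintegrable (lebI (Kidx p r)) setT f /\
  cintegral (lebI (Kidx p r)) setT f = closed_form p r lam sig.
Proof.
elim: p lam sig => [|p IH] lam sig hA hB f.
  have K0 : Kidx 0 r -> False by case=> -[[]].
  have f1 x : f x = 1.
    rewrite /f /PDfun /pivot_integrand indicE mem_set ?/chain ?big_ord0 ?mulr1//.
    by split; [exact: fA_sym|move=> v; rewrite flatmx0 eqxx].
  have int0 (g : R) : 0 <= g -> (\int[lebI (Kidx 0 r)]_x g%:E = g%:E)%E.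
    by move=> g0; apply: (ge0_integral_coords0 [tuple of nseq _ 0] K0) => //;
       move=> x; rewrite lee_fin.
  rewrite /closed_form big_ord0; have -> : f = fun=> 1 by exact/funext.
  split.
    apply/cintegrableP; split; last by rewrite int0 ?ltry// cnorm_ge0.
    exact: cmeasurable_cst.
  by apply: eq_complexP; rewrite /cintegral /Rintegral /= int0//.
have [ih vh] := IH (fun k => lam k - (2^-1)%:C) (fun k => sig k - 1)
  (fun k kp => etrans (congr1 (fun z => 0 < Re z) (argA_shift p r lam k)) (hA k (leqW kp)))
  (fun k kp => etrans (congr1 (fun z => 0 < Re z) (argB_shift p lam sig k)) (hB k (leqW kp))).
have al0 := hA p (ltnSn p).
have dE : sig p - argA p.+1 r lam p - ((p + (r + p))%:R / 2)%:C = argB p.+1 lam sig p.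
  rewrite /argB /argA; apply: eq_complexP; rewrite !raddfB /=; last by ring.
  by rewrite !natrD -!natr1; field.
have sg0 : 0 < Re (sig p - argA p.+1 r lam p - ((p + (r + p))%:R / 2)%:C).
  by rewrite dE; exact: hB.
have iD := cintegrable_dirichlet_kernel al0 sg0.
have vD := dirichlet_integral al0 sg0.
have mF := @cmeasurable_step_function p r lam sig.
have eT := @step_function_target p r lam sig.
have eS x : (PDfun x)%:C * step_function lam sig (step_source x) = f x.
  by rewrite step_function_source.
have i2 : cintegrable (lebI (Kidx p r) \x lebT (p + (r + p)).+1)%E setT
    (fun y => (step_weight y)%:C * step_function lam sig (@step_target p r y)).
  have /(@funext _ _ _ _) e := eT; rewrite [X in cintegrable _ _ X]e.
  exact: cintegrable_prod ih iD.
have i1 := transfer_cintegrable (@measurable_step_source p r) (@measurable_PDfun p.+1 r)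
  (@PDfun_ge0 p.+1 r) (@step_weight_ge0 p r) (@step_transfer p r) mF i2.
have v1 := transfer_cintegral (@PDfun_ge0 p.+1 r) (@step_weight_ge0 p r) (@step_transfer p r) mF.
rewrite (eq_cintegral _ eS) (eq_cintegral _ eT) (cintegral_prod ih iD) vh in v1.
split; first by move: i1; rewrite (_ : (fun x => _) = f)//; exact/funext.
rewrite v1 /closed_form big_ord_recr /=.
congr (_ * _).
  by apply: eq_bigr => k _; rewrite argA_shift argB_shift argC_shift.
have cE : argC p.+1 sig p = sig p by rewrite /argC subrr subr0.
have s0 : 0 < Re (sig p).
  have -> : sig p = argB p.+1 lam sig p + argA p.+1 r lam p + ((p + (r + p))%:R / 2)%:C.
    by rewrite -dE; ring.
  rewrite raddfD /= ltr_wpDr//.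
  by rewrite raddfD /= addr_gt0// hB.
rewrite cE -dE; apply: (mulfI (gamma_neq0 s0)); rewrite vD.
rewrite [RHS]mulrCA; congr (_ * _).
by rewrite [RHS]mulrC divfK// gamma_neq0.
Qed.

End Induction.

(** * From independent entries to flat coordinates *)
Section Coordinates.
Context (R : realType) (p r : nat).
Local Notation mR := (measurableTypeR R).

Lemma leq_lt_dec (i j : nat) : {(i <= j)%N} + {(j < i)%N}.
Proof. by case: leqP; [left|right]. Qed.

Definition triangle (ij : 'I_p * 'I_p) : sym_idx p + skew_idx p :=
  match leq_lt_dec ij.1 ij.2 with
  | left h => inl (exist _ ij h)
  | right h => inr (exist _ (ij.2, ij.1) h)
  end.

Definition untriangle (s : sym_idx p + skew_idx p) : 'I_p * 'I_p :=
  match s with inl s => val s | inr t => ((val t).2, (val t).1) end.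

Lemma triangleK : cancel triangle untriangle.
Proof. by move=> [i j]; rewrite /triangle; case: leq_lt_dec. Qed.

Lemma triangle_sym (i j : 'I_p) (h : (i <= j)%N) : triangle (i, j) = inl (exist _ (i, j) h).
Proof.
rewrite /triangle; case: leq_lt_dec => h' /=; last by exfalso; move: h'; rewrite ltnNge h.
by congr inl; exact: val_inj.
Qed.

Lemma triangle_skew (i j : 'I_p) (h : (i < j)%N) : triangle (j, i) = inr (exist _ (i, j) h).
Proof.
rewrite /triangle; case: leq_lt_dec => h' /=; first by exfalso; move: h'; rewrite leqNgt h.
by congr inr; exact: val_inj.
Qed.

Lemma untriangleK : cancel untriangle triangle.
Proof.
by case=> -[[i j] h]; [exact: (triangle_sym h)|exact: (triangle_skew h)].
Qed.

Definition MNLcoord (k : Kidx p r) (x : MNLcoords R p r) : mR :=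
  match k with
  | inl ij => match triangle ij with
              | inl s => icoord x.1.1 s
              | inr t => icoord x.1.2 t
              end
  | inr il => icoord x.2 il
  end.

Lemma leb_coords_dMNL : leb_coords (dMNL R p r) MNLcoord.
Proof.
have H := leb_coords_prod
  (leb_coords_prod (leb_coords_icoord R _) (leb_coords_icoord R _))
  (leb_coords_icoord R ('I_p * 'I_r)%type).
pose e (k : Kidx p r) : (sym_idx p + skew_idx p) + 'I_p * 'I_r :=
  match k with inl ij => inl (triangle ij) | inr il => inr il end.
pose e' (k : (sym_idx p + skew_idx p) + 'I_p * 'I_r) : Kidx p r :=
  match k with inl s => inl (untriangle s) | inr il => inr il end.
have eK : cancel e e' by case=> //= ij; rewrite triangleK.
have e'K : cancel e' e by case=> //= ij; rewrite untriangleK.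
have := leb_coords_reindex eK e'K (H _ _).
rewrite (_ : (fun k => _) = MNLcoord)//.
by apply/funext => k; apply/funext => x; case: k => [ij|il] //=.
Qed.

Local Notation theta := (@mkcoords R _ (Kidx p r) MNLcoord).

Lemma fM_MNL x : fM (icoord (theta x)) = sym_of x.1.1.
Proof.
apply/matrixP => i j; rewrite !mxE !icoord_mkcoords /MNLcoord.
case: ifPn => ij.
  by rewrite (triangle_sym ij) (@insubT _ (fun km : 'I_p * 'I_p => (km.1 <= km.2)%N) _ (i, j) ij).
have ji : (j <= i)%N by rewrite leq_eqVlt ltnNge ij orbT.
rewrite (triangle_sym ji) insubF; last exact: negbTE.
by rewrite (@insubT _ (fun km : 'I_p * 'I_p => (km.1 <= km.2)%N) _ (j, i) ji).
Qed.

Lemma fN_MNL x : fN (icoord (theta x)) = skew_of x.1.2.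
Proof.
apply/matrixP => i j; rewrite !mxE !icoord_mkcoords /MNLcoord.
case: (ltngtP i j) => ij.
- by rewrite (triangle_skew ij) (@insubT _ (fun km : 'I_p * 'I_p => (km.1 < km.2)%N) _ (i, j) ij).
- rewrite (triangle_skew ij) insubF; last by rewrite /= ltnNge ltnW.
  by rewrite (@insubT _ (fun km : 'I_p * 'I_p => (km.1 < km.2)%N) _ (j, i) ij).
- by rewrite !insubF//= ij ltnn.
Qed.

Lemma fL_MNL x : fL (icoord (theta x)) = full_of x.2.
Proof. by apply/matrixP => i j; rewrite !mxE icoord_mkcoords. Qed.

End Coordinates.

Section Change.
Context (R : realType) (p q : nat).
Local Notation C := R[i].
Local Notation mR := (measurableTypeR R).
Local Notation Re := (@complex.Re R).
Local Notation r := (q - p)%N.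
Local Notation lebI I := (lebesgue_tuple R #|{: I}|).
Local Notation theta := (mkcoords (K := Kidx p r) (@MNLcoord R p r)).

Lemma fA_MNL x : fA (icoord (theta x)) = sym_of x.1.1 - full_of x.2 *m (full_of x.2)^T.
Proof. by rewrite /fA fM_MNL fL_MNL. Qed.

Lemma fK_MNL x : fK (icoord (theta x)) = 1%:M + sym_of x.1.1 + skew_of x.1.2.
Proof. by rewrite /fK fM_MNL fN_MNL. Qed.

Lemma SW_PD x :
  @SW R p q (sym_of x.1.1 + skew_of x.1.2, full_of x.2) <-> PD (theta x).
Proof.
rewrite /SW /PD /= fA_MNL.
suff -> : 2^-1 *: (sym_of x.1.1 + skew_of x.1.2 + (sym_of x.1.1 + skew_of x.1.2)^T) =
    sym_of x.1.1 by [].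
rewrite -(fM_MNL x) -(fN_MNL x) [_^T]raddfD /=.
rewrite fM_sym fN_skew addrACA subrr addr0.
by rewrite -mulr2n -[fM _ *+ 2]scaler_nat scalerA mulVf ?scale1r// pnatr_eq0.
Qed.

(** The condition lambda_(p+1) = sigma_(p+1) = 0 removes the end term of the
    summation by parts; the power of det A lowers all exponents of A. *)
Lemma SWintegrandE (lam sig : nat -> C) x : lam p.+1 = 0 -> sig p.+1 = 0 ->
  (p <= q)%N -> PD (theta x) ->
  SWintegrand lam sig (sym_of x.1.1) (skew_of x.1.2) (full_of x.2) =
  pivot_integrand (fun k => lam k.+1) (fun k => sig k.+1) (theta x).
Proof.
move=> lam0 sig0 pq xPD.
have dA := det_fA_gt0 xPD.
have mA := posdef_minors_gt0 xPD; have mK := fK_minors_gt0 xPD.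
rewrite /SWintegrand /pivot_integrand -fA_MNL -fK_MNL -addnA subnKC//.
rewrite chain_shift// -rmorphN cpow_real// big_split /=.
rewrite (prod_ulblock lam mA) lam0 mulrAC; congr (_ * _ * _).
  by apply: eq_chain => k _; rewrite subr0.
transitivity (chain (fK (icoord (theta x))) (fun k => - sig k.+1 - - sig p.+1)).
  rewrite -(prod_ulblock (fun k => - sig k) mK).
  by apply: eq_bigr => j _; rewrite -cpowN opprD.
by apply: eq_chain => k _; rewrite sig0 oppr0 subr0.
Qed.

Lemma measurable_theta : measurable_fun setT (theta : MNLcoords R p r -> coords R (Kidx p r)).
Proof. by apply: measurable_mkcoords; case: (leb_coords_dMNL R p r). Qed.

Lemma theta_transfer (h : coords R (Kidx p r) -> \bar R) :
  measurable_fun setT h -> (forall y, 0 <= h y)%E ->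
  (\int[dMNL R p r]_x ((1 : mR)%:E * h (theta x)) =
   \int[lebI (Kidx p r)]_y ((1 : mR)%:E * h y))%E.
Proof.
move=> mh h0; under eq_integral do rewrite mul1e.
under [RHS]eq_integral do rewrite mul1e.
by rewrite (leb_coords_unique (leb_coords_dMNL R p r)).
Qed.

Lemma SW_integral (lam sig : nat -> C) (z : C) :
  lam p.+1 = 0 -> sig p.+1 = 0 -> (p <= q)%N ->
  let g x := (PDfun x)%:C *
    @pivot_integrand R p r (fun k => lam k.+1) (fun k => sig k.+1) x in
  cintegrable (lebI (Kidx p r)) setT g /\ cintegral (lebI (Kidx p r)) setT g = z ->
  let D : set (MNLcoords R p r) :=
    [set x | @SW R p q (sym_of x.1.1 + skew_of x.1.2, full_of x.2)] in
  let f : MNLcoords R p r -> C :=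
    fun x => SWintegrand lam sig (sym_of x.1.1) (skew_of x.1.2) (full_of x.2) in
  cintegrable (dMNL R p r) D f /\ cintegral (dMNL R p r) D f = z.
Proof.
move=> lam0 sig0 pq g [ig vg] D f.
have DE : D = theta @^-1` (@PD R p r).
  by apply/seteqP; split => x /SW_PD.
have mD : measurable D.
  by rewrite DE -[X in measurable X]setTI; apply: measurable_theta => //; exact: measurable_PD.
have gE x : (\1_D x : R)%:C * f x = 1%:C * g (theta x).
  have DPD : (x \in D) = (theta x \in @PD R p r) by rewrite DE; apply/idP/idP; rewrite !inE.
  rewrite mul1r /g /PDfun !indicE DPD.
  have [xPD|_] := boolP (theta x \in PD (r:=r)); last by rewrite !mul0r.
  by rewrite /f SWintegrandE//; move: xPD; rewrite inE.
have [iE ->] := cintegral_mkcond (dMNL R p r) f mD.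
rewrite iE (_ : (fun x => (\1_D x : R)%:C * f x) = fun x => 1%:C * g (theta x)); last first.
  exact/funext.
have mg := cintegrable_cmeasurable ig.
have g1 y : 1%:C * g y = g y by rewrite mul1r.
split.
  apply: (transfer_cintegrable (theta2 := id) (w1 := fun=> 1) (w2 := fun=> 1)
    measurable_theta _ _ _ theta_transfer mg) => //.
  by rewrite (_ : (fun x => _) = g)//; exact/funext.
rewrite (transfer_cintegral (theta2 := id) (w1 := fun=> 1) (w2 := fun=> 1) _ _
  theta_transfer mg)//.
by rewrite (eq_cintegral _ g1).
Qed.

End Change.

(** * Matching the parameters *)
Section Exponents.
Context (R : realType).
Local Notation C := R[i].

Lemma argAE p q (lam : nat -> C) k : (p <= q)%N ->
  lam k.+1 - (q + k.+1)%:R / 2 + 1 = argA p (q - p) (fun k => lam k.+1) k.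
Proof.
move=> pq; rewrite /argA subnKC// rmorphB rmorph1 rmorphM fmorphV !rmorph_nat.
by rewrite opprB addrA addrAC.
Qed.

Lemma argBE p (lam sig : nat -> C) k :
  sig k.+1 - lam k.+1 - (p%:R - k.+1%:R) / 2 =
  argB p (fun k => lam k.+1) (fun k => sig k.+1) k.
Proof. by rewrite /argB rmorphM rmorphB fmorphV !rmorph_nat. Qed.

Lemma argCE p (sig : nat -> C) k :
  sig k.+1 - p%:R + k.+1%:R = argC p (fun k => sig k.+1) k.
Proof. by rewrite /argC rmorphB !rmorph_nat opprB addrA addrAC. Qed.

Lemma pi_exponent p q k : (p <= q)%N ->
  pi `^ (k.+1%:R + (q%:R - p%:R) / 2 - 1) = Num.sqrt pi ^+ (k + ((q - p) + k)) :> R.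
Proof.
move=> pq; rewrite -powR12_sqrt ?pi_ge0// -powR_mulrn ?powR_ge0// -powRrM.
by congr (_ `^ _); rewrite !natrD natrB// -natr1; field.
Qed.

End Exponents.

Theorem mainTheorem7 (R : realType) (p q : nat) (lam sig : nat -> R[i])
    (hp : (1 <= p)%N) (hpq : (p <= q)%N)
    (hlam0 : lam p.+1 = 0) (hsig0 : sig p.+1 = 0)
    (hlam : forall k : nat, (1 <= k <= p)%N ->
       0 < complex.Re (lam k - (q + k)%:R / 2 + 1))
    (hsig : forall k : nat, (1 <= k <= p)%N ->
       0 < complex.Re (sig k - lam k - (p%:R - k%:R) / 2)) :
  let D : set (MNLcoords R p (q - p)) :=
    [set x | @SW R p q (sym_of x.1.1 + skew_of x.1.2, full_of x.2)] in
  let f : MNLcoords R p (q - p) -> R[i] :=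
    fun x => SWintegrand lam sig (sym_of x.1.1) (skew_of x.1.2) (full_of x.2) in
  cintegrable (dMNL R p (q - p)) D f /\
  cintegral (dMNL R p (q - p)) D f =
    \prod_(1 <= k < p.+1)
      ((pi `^ (k%:R + (q%:R - p%:R) / 2 - 1))%:C *
       (cGamma (lam k - (q + k)%:R / 2 + 1) *
        cGamma (sig k - lam k - (p%:R - k%:R) / 2) /
        cGamma (sig k - p%:R + k%:R))).
Proof.
apply: SW_integral => //.
have kp k : (k < p)%N -> (1 <= k.+1 <= p)%N by [].
have [|| i1 v1] := @pivot_integral R p (q - p)
  (fun k => lam k.+1) (fun k => sig k.+1).
- by move=> k /kp/hlam; rewrite (argAE _ _ hpq).
- by move=> k /kp/hsig; rewrite argBE.
split => //; rewrite v1 /closed_form big_add1 big_mkord.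
by apply: eq_bigr => k _; rewrite (argAE _ _ hpq) argBE argCE pi_exponent.
Qed.
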